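(* Let $G=\prod_{\lambda\in\Lambda}G_\lambda$ be a group decomposed into nontrivial subgroups such that the family $\mathcal{G}=\{G_\lambda\mid\lambda\in\Lambda\}$ satisfies conditions (C1) and (C2) of the context, and let $(W,S)$ be a Coxeter system of arbitrary rank with decomposition $W=\prod_{\omega\in\Omega}W_\omega$ into irreducible components. (i) Put $H_1=(\mathrm{Hom}(G,Z(G))^\times)^\flat$, $H_2=\overline{\prod}_{\lambda\in\Lambda_{\neg Z}}\mathrm{Aut}(G_\lambda)$, $H_3=\overline{\prod}_{\xi\in\Xi}\mathrm{Sym}(\Lambda_\xi)$ and $H_4=\mathrm{Hom}(G,Z(G))_o^\flat$. Then $$\mathrm{Aut}(G)=(H_1H_2)\rtimes H_3,\quad H_1\lhd\mathrm{Aut}(G),\quad H_2\lhd H_2H_3,\quad H_1\cap H_2=H_4.$$ (ii) Put $H'_1=\mathrm{Hom}(W_{\rm inf},Z(W))^\flat$, $H'_2=\mathrm{Aut}(W_{\rm fin})$, $H'_3=\overline{\prod}_{\omega\in\Omega_{\rm inf}}\mathrm{Aut}(W_\omega)$ and $H'_4=\overline{\prod}_{\upsilon\in\Upsilon_{\rm inf}}\mathrm{Sym}(\Omega_\upsilon)$. Then $$\mathrm{Aut}(W)=H'_1\rtimes(H'_2\times H'_3)\rtimes H'_4,\quad H'_2H'_4=H'_2\times H'_4,\quad H'_3H'_4=H'_3\rtimes H'_4.$$ (iii) The subgroup $H=\left(\overline{\prod}_{\omega\in\Omega}\mathrm{Aut}(W_\omega)\right)\left(\overline{\prod}_{\upsilon\in\Upsilon}\mathrm{Sym}(\Omega_\upsilon)\right)$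 has finite index in $\mathrm{Aut}(W)$ if and only if either $Z(W)=1$ or the odd Coxeter graph $\Gamma^{\rm odd}$ of $(W,S)$ consists of only finitely many connected components. (Hence the index is finite whenever $W$ has finite rank.)
   Context: **Products.** $\prod$ denotes the restricted direct product (all but finitely many coordinates trivial) and $\overline{\prod}$ the complete direct product. In $A\rtimes B$ the factor $A$ is normal. **Coxeter groups.** A Coxeter system $(W,S)$ consists of a group $W$ with presentation $\langle S\mid (st)^{m(s,t)}=1 \text{ for } s,t\in S,\ m(s,t)<\infty\rangle$, where $m:S\times S\to\{1,2,\dots\}\cup\{\infty\}$ is symmetric and $m(s,t)=1$ iff $s=t$; $|S|$ (the rank) is arbitrary. The Coxeter graph $\Gamma$ has vertex set $S$ and an edge labelled $m(s,t)$ between $s,t$ whenever $m(s,t)\geq3$; $\Gamma^{\rm odd}$ is obtained from $\Gamma$ by removing all edges labelled by an even number or $\infty$. Irreducible components $W_\omega$ of $W$ are the subgroups generated by the vertex sets of the connected components of $\Gamma$. $\Omega_{\rm inf}=\{\omega\in\Omega: |W_\omega|=\infty\}$, $\Omega_{\rm fin}=\Omega\smallsetminus\Omega_{\rm inf}$, $W_{\rm fin}=\prod_{\omega\in\Omega_{\rm fin}}W_\omega$, $W_{\rm inf}=\prod_{\omega\in\Omega_{\rm inf}}W_\omega$, so $W=W_{\rm fin}\times W_{\rm inf}$. **Conditions on a family $\mathcal{G}$ of groups.** (C1) If $K=\prod_{\mu\in M}K_\mu$ with all $K_\mu\in\mathcal{G}$ (repetitions allowed), $K'\in\mathcal{G}$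 and $f:K\to K'$ is a surjective homomorphism, then $f$ maps some $K_\mu$ onto $K'$ (so that it maps all the other factors into $Z(K')$). (C2) Every $K\in\mathcal{G}$ has center trivial or cyclic of prime order. **Notation for $G$.** $\Lambda_Z=\{\lambda\in\Lambda\mid Z(G_\lambda)=G_\lambda\}$, $\Lambda_{\neg Z}=\Lambda\smallsetminus\Lambda_Z$, $G_{\Lambda'}=\prod_{\lambda\in\Lambda'}G_\lambda$ for $\Lambda'\subset\Lambda$. **The monoid $\mathrm{Hom}(K,Z(K))$.** For a group $K$, $\mathrm{Hom}(K,Z(K))$ is a monoid under $(f*g)(w)=f(w)g(w)\,f(g(w))^{-1}$, with unit the trivial map; $\mathrm{Hom}(K,Z(K))^\times$ is its group of invertible elements. For $f\in\mathrm{Hom}(K,Z(K))$ define $f^\flat\in\mathrm{End}(K)$ by $f^\flat(w)=wf(w)^{-1}$; this is an injective monoid homomorphism into $\mathrm{End}(K)$ (under composition) and maps $\mathrm{Hom}(K,Z(K))^\times$ into $\mathrm{Aut}(K)$. For a subset $X$, $X^\flat$ is its image. If $K=K_1\times K_2$, then $\mathrm{Hom}(K_1,Z(K))$ is regarded as a subset of $\mathrm{Hom}(K,Z(K))$ by composing with the projection $K\to K_1$; in particular $\mathrm{Hom}(W_{\rm inf},Z(W))\subset\mathrm{Hom}(W,Z(W))$ (it is a subgroup of $\mathrm{Hom}(W,Z(W))^\times$). Put $$\mathrm{Hom}(G,Z(G))_o=\{f\in\mathrm{Hom}(G,Z(G))\mid f(G_{\Lambda_Z})=1,\ f(G_\lambda)\subset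 Z(G_\lambda)\text{ for all }\lambda\in\Lambda_{\neg Z}\},$$ which is a subgroup of $\mathrm{Hom}(G,Z(G))^\times$. **Embeddings into automorphism groups.** $\mathrm{Aut}(G_\lambda)$, $\mathrm{Aut}(W_\omega)$, $\mathrm{Aut}(W_{\rm fin})$ are embedded in $\mathrm{Aut}(G)$, resp. $\mathrm{Aut}(W)$, by acting on the given factor and trivially on the complementary factors; complete products of such groups act factorwise. Partition $\Lambda_{\neg Z}=\bigsqcup_{\xi\in\Xi}\Lambda_\xi$ so that $\lambda,\lambda'$ lie in the same part iff $G_\lambda\simeq G_{\lambda'}$. For each $\xi$ choose isomorphisms $\mathrm{id}_{\mu,\lambda}:G_\lambda\to G_\mu$ ($\lambda,\mu\in\Lambda_\xi$) with $\mathrm{id}_{\lambda,\lambda}=\mathrm{id}$, $\mathrm{id}_{\lambda,\mu}=\mathrm{id}_{\mu,\lambda}^{-1}$, $\mathrm{id}_{\nu,\mu}\circ\mathrm{id}_{\mu,\lambda}=\mathrm{id}_{\nu,\lambda}$. The symmetric group $\mathrm{Sym}(\Lambda_\xi)$ acts on $G_{\Lambda_\xi}$ by $\tau(w)=\mathrm{id}_{\tau(\lambda),\lambda}(w)$ for $w\in G_\lambda$, and so embeds in $\mathrm{Aut}(G)$. Similarly partition $\Omega=\bigsqcup_{\upsilon\in\Upsilon}\Omega_\upsilon$ according to the isomorphism classes of the groups $W_\omega$, choose such isomorphisms between the $W_\omega$, and embed $\mathrm{Sym}(\Omega_\upsilon)$ in $\mathrm{Aut}(W)$. $\Upsilon_{\rm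 fin}=\{\upsilon\in\Upsilon\mid |W_\omega|<\infty\text{ for }\omega\in\Omega_\upsilon\}$ and $\Upsilon_{\rm inf}=\Upsilon\smallsetminus\Upsilon_{\rm fin}$. *)

(* Defs.v *)
From HB Require Import structures.
From Stdlib Require Import Relation_Operators.
From mathcomp Require Import all_boot.
From mathcomp Require Import boolp classical_sets functions cardinality.

Set Implicit Arguments.
Unset Strict Implicit.
Unset Printing Implicit Defensive.

Local Open Scope classical_set_scope.
Local Open Scope group_scope.

Definition subgroup_set (G : groupType) (A : set G) : Prop :=
  A 1 /\ forall x y, A x -> A y -> A (x / y).

Record subgroup (G : groupType) := Subgroup {
  sg_set :> set G;
  sg_closed : subgroup_set sg_set }.

Definition grp (G : groupType) (A : subgroup G) : Type := {x : G | x \in sg_set A}.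

Section SubgroupGroup.
Variables (G : groupType) (A : subgroup G).

HB.instance Definition _ := SubChoice.on (grp A).

Lemma grp_group_closed : group_closed (fun x : G => x \in sg_set A).
Proof.
case: (sg_closed A) => A1 AV; split; first exact: mem_set.
by move=> x y /set_mem Ax /set_mem Ay; apply: mem_set; apply: AV.
Qed.

HB.instance Definition _ :=
  SubChoice_isSubGroup.Build G (fun x : G => x \in sg_set A) (grp A)
    grp_group_closed.

Definition gval (x : grp A) : G := val x.

End SubgroupGroup.

Definition gen_set (G : groupType) (X : set G) : set G :=
  [set x | forall A : set G, subgroup_set A -> X `<=` A -> A x].

Lemma gen_set_subgroup (G : groupType) (X : set G) : subgroup_set (gen_set X).
Proof.
split=> [A [] //|x y Xx Xy A sA XA].
by case: (sA) => _; apply; [apply: Xx | apply: Xy].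
Qed.

Definition gen (G : groupType) (X : set G) : subgroup G :=
  Subgroup (gen_set_subgroup X).

Definition center (K : groupType) : set K := [set z | forall x, commute z x].

Definition setmul (G : groupType) (A B : set G) : set G :=
  [set a * b | a in A & b in B].

Definition normal_in (G : groupType) (N A : set G) : Prop :=
  [/\ subgroup_set N, subgroup_set A, N `<=` A &
      forall n a, N n -> A a -> N (n ^ a)].

Definition is_semidirect (G : groupType) (A N K : set G) : Prop :=
  [/\ normal_in N A, subgroup_set K, N `&` K = [set 1] & setmul N K = A].

Definition is_direct (G : groupType) (A N K : set G) : Prop :=
  [/\ normal_in N A, normal_in K A, N `&` K = [set 1] & setmul N K = A].

Definition finite_index (G : groupType) (A : set G) : Prop :=
  finite_set [set setmul [set g] A | g in [set: G]].

Definition isog (K L : groupType) : Prop :=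
  exists f : {multiplicative K -> L}, bijective f.

(* The stored inverse is determined by the underlying function ([autP]). *)
Record Aut (K : groupType) := MkAut {
  aut_fun :> K -> K;
  aut_inv : K -> K;
  aut_morph : {morph aut_fun : x y / x * y};
  aut_funK : cancel aut_fun aut_inv;
  aut_invK : cancel aut_inv aut_fun }.

Section AutGroup.
Variable K : groupType.

Lemma autP (a b : Aut K) : a =1 b -> a = b.
Proof.
case: a b => [f f' fM fK f'K] [g g' gM gK g'K] /= fg.
have {fg} efg : f = g by apply/funext.
case: g / efg gM gK g'K => gM gK g'K.
have efg' : f' = g' by apply/funext => x; rewrite -{1}(g'K x) fK.
case: g' / efg' gK g'K => gK g'K.
by congr MkAut; apply: Prop_irrelevance.
Qed.

Definition aut_one : Aut K.
Proof. by refine (@MkAut K id id _ _ _). Defined.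

Definition aut_mul (a b : Aut K) : Aut K.
Proof.
refine (@MkAut K (a \o b) (aut_inv b \o aut_inv a) _ _ _) => [x y|x|x] /=.
- by rewrite !aut_morph.
- by rewrite !aut_funK.
- by rewrite !aut_invK.
Defined.

Definition aut_V (a : Aut K) : Aut K.
Proof.
refine (@MkAut K (aut_inv a) a _ _ _) => [x y|x|x].
- by rewrite -{1}(aut_invK a x) -{1}(aut_invK a y) -aut_morph aut_funK.
- exact: aut_invK.
- exact: aut_funK.
Defined.

Lemma aut_mulA : associative aut_mul.
Proof. by move=> a b c; apply: autP. Qed.
Lemma aut_mul1 : left_id aut_one aut_mul.
Proof. by move=> a; apply: autP. Qed.
Lemma aut_mulr1 : right_id aut_one aut_mul.
Proof. by move=> a; apply: autP. Qed.
Lemma aut_mulV : left_inverse aut_one aut_V aut_mul.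
Proof. by move=> a; apply: autP => x; exact: aut_funK. Qed.
Lemma aut_mulrV : right_inverse aut_one aut_V aut_mul.
Proof. by move=> a; apply: autP => x; exact: aut_invK. Qed.

HB.instance Definition _ := gen_eqMixin (Aut K).
HB.instance Definition _ := gen_choiceMixin (Aut K).
HB.instance Definition _ := isGroup.Build (Aut K)
  aut_mulA aut_mul1 aut_mulr1 aut_mulV aut_mulrV.

End AutGroup.

Definition HomZ (K : groupType) : set (K -> K) :=
  [set f | {morph f : x y / x * y} /\ forall x, @center K (f x)].

Definition homz_mul (K : groupType) (f g : K -> K) : K -> K :=
  fun w => f w * g w * (f (g w))^-1.

Definition HomZ_units (K : groupType) : set (K -> K) :=
  [set f | @HomZ K f /\ exists g, [/\ @HomZ K g,
     homz_mul f g = (fun=> 1) & homz_mul g f = (fun=> 1)]].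

Definition flat (K : groupType) (f : K -> K) : K -> K := fun w => w * (f w)^-1.

(* A member of X whose flat is not bijective contributes nothing here; when X
   lies in [HomZ_units] there is no such member ([flat_unit_aut]). *)
Definition flat_set (K : groupType) (X : set (K -> K)) : set (Aut K) :=
  [set a : Aut K | exists2 f, X f & a =1 flat f].

Lemma flat_mul (K : groupType) (f g : K -> K) :
  @HomZ K f -> @HomZ K g -> flat (homz_mul f g) =1 flat f \o flat g.
Proof.
move=> [fM fZ] [gM gZ] w; rewrite /flat /homz_mul /=.
have fV x : f x^-1 = (f x)^-1.
  apply: esym; apply: mulg1_eq; rewrite -fM mulgV.
  by apply: (@mulgI _ (f 1)); rewrite -fM !mulg1.
rewrite fM fV !invgM !invgK -!mulgA; congr (w * _).
by rewrite !mulgA (fZ (g w)).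
Qed.

Lemma flat_unit_aut (K : groupType) (f : K -> K) :
  @HomZ_units K f -> exists a : Aut K, a =1 flat f.
Proof.
move=> [Hf [g [Hg fg gf]]].
have flat1 : flat (fun=> 1 : K) =1 id by move=> w; rewrite /flat invg1 mulg1.
have fM : {morph flat f : x y / x * y}.
  case: Hf => fM fZ x y; rewrite /flat fM invgM -!(mulgA x).
  by congr (x * _); rewrite mulgA (commuteV (commute_sym (fZ x (y * (f y)^-1)))).
have fK : cancel (flat f) (flat g).
  by move=> w; have /= <- := flat_mul Hg Hf w; rewrite gf flat1.
have gK : cancel (flat g) (flat f).
  by move=> w; have /= <- := flat_mul Hf Hg w; rewrite fg flat1.
by exists (MkAut fM fK gK).
Qed.

(* If K = K1 \x K2, a homomorphism K1 -> Z(K) is viewed in Hom(K, Z(K)) through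
   the projection K -> K1. *)
Definition HomZ_factor (K : groupType) (K1 K2 : subgroup K) : set (K -> K) :=
  [set f | @HomZ K f /\ exists2 f1 : {multiplicative grp K1 -> K},
     forall x, @center K (f1 x) &
     forall (x : grp K1) (y : grp K2), f (gval x * gval y) = f1 x].

Section Families.
Variables (G : groupType) (Lam : Type) (F : Lam -> subgroup G).

Definition subprod (P : set Lam) : subgroup G :=
  gen (\bigcup_(l in P) sg_set (F l)).

Definition is_dprod : Prop :=
  [/\ forall l m, l <> m -> forall x y,
     sg_set (F l) x -> sg_set (F m) y -> commute x y,
      sg_set (subprod [set: Lam]) = [set: G] &
      forall l, sg_set (F l) `&` subprod [set m | m <> l] = [set 1]].

Definition LamZ : set Lam := [set l | @center (grp (F l)) = [set: grp (F l)]].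
Definition LamNZ : set Lam := ~` LamZ.

Definition HomZo : set (G -> G) :=
  [set f | [/\ @HomZ G f,
     forall x, sg_set (subprod LamZ) x -> f x = 1 &
     forall l, LamNZ l -> forall x : grp (F l),
       exists2 z : grp (F l), center z & f (gval x) = gval z]].

(* The complete product of the Aut(F l), l in P, acting factorwise. *)
Definition factor_auts (P : set Lam) : set (Aut G) :=
  [set a : Aut G | exists b : forall l, Aut (grp (F l)),
    (forall l, P l -> forall x : grp (F l), a (gval x) = gval (b l x)) /\
    (forall l, ~ P l -> forall x : grp (F l), a (gval x) = gval x)].

(* The partition of P according to the isomorphism classes of the factors. *)
Definition iso_classes (P : set Lam) : set (set Lam) :=
  [set [set m | P m /\ isog (grp (F l)) (grp (F m))] | l in P].

(* [i m l : F l -> F m] is a coherent system of isomorphisms within each class;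
   its values across different classes are irrelevant. *)
Definition iso_system (P : set Lam)
    (i : forall m l, grp (F l) -> grp (F m)) : Prop :=
  forall X, iso_classes P X ->
  [/\ forall l m, X l -> X m ->
        {morph i m l : x y / x * y} /\ bijective (i m l),
      forall l, X l -> i l l =1 id,
      forall l m, X l -> X m -> cancel (i m l) (i l m) /\ cancel (i l m) (i m l) &
      forall l m n, X l -> X m -> X n -> i n m \o i m l =1 i n l].

(* The complete product of the Sym(X), X in C, for a set C of classes: a
   family of permutations [t X] of X acts by w |-> i (t X l) l w on F l. *)
Definition sym_auts (i : forall m l, grp (F l) -> grp (F m))
    (C : set (set Lam)) : set (Aut G) :=
  [set a : Aut G | exists t : set Lam -> Lam -> Lam,
    [/\ forall X, C X -> set_bij X X (t X),
        forall X l, C X -> X l -> forall x : grp (F l),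
          a (gval x) = gval (i (t X l) l x) &
        forall l, (forall X, C X -> ~ X l) -> forall x : grp (F l),
          a (gval x) = gval x]].

End Families.

(* The automorphisms of K1 extended by the identity on a complement K2. *)
Definition factor_Aut (K : groupType) (K1 K2 : subgroup K) : set (Aut K) :=
  [set a : Aut K | exists b : Aut (grp K1),
    (forall x : grp K1, a (gval x) = gval (b x)) /\
    (forall y : grp K2, a (gval y) = gval y)].

(* Membership of a group in the family is taken up to isomorphism. *)
Definition cond_C1 (Lam : Type) (F : Lam -> groupType) : Prop :=
  forall (M : Type) (K : groupType) (Km : M -> subgroup K),
  is_dprod Km -> (forall m, exists l, isog (grp (Km m)) (F l)) ->
  forall (l : Lam) (f : {multiplicative K -> F l}), range f = setT ->
  exists m, f @` sg_set (Km m) = setT.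

Definition cyclic_prime (K : groupType) (Z : set K) : Prop :=
  exists (z : K) (p : nat), [/\ prime p, Z = gen [set z] & (Z #= `I_p)%card].

Definition cond_C2 (Lam : Type) (F : Lam -> groupType) : Prop :=
  forall l, @center (F l) = [set 1] \/ cyclic_prime (@center (F l)).

(* [(s, true)] stands for the letter s^-1. *)
Definition word (S : Type) := seq (S * bool).

Definition eval_word (W : groupType) (S : Type) (e : S -> W) (u : word S) : W :=
  foldr (fun p w => (if p.2 then (e p.1)^-1 else e p.1) * w) 1 u.

(* Equality in the quotient of the free group on S by the relators R. *)
Inductive word_eqv (S : Type) (R : set (word S)) : word S -> word S -> Prop :=
| we_refl u : word_eqv R u u
| we_sym u v : word_eqv R u v -> word_eqv R v u
| we_trans u v w : word_eqv R u v -> word_eqv R v w -> word_eqv R u w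
| we_cat u u' v v' :
    word_eqv R u u' -> word_eqv R v v' -> word_eqv R (u ++ v) (u' ++ v')
| we_cancel s b : word_eqv R [:: (s, b); (s, ~~ b)] [::]
| we_relator r : R r -> word_eqv R r [::].

Definition has_presentation (W : groupType) (S : Type) (e : S -> W)
    (R : set (word S)) : Prop :=
  (forall w, exists u, eval_word e u = w) /\
  (forall u v, eval_word e u = eval_word e v <-> word_eqv R u v).

Section Coxeter.
Variables (S : Type) (m : S -> S -> option nat).

(* [None] stands for infinity. *)
Definition coxeter_matrix : Prop :=
  [/\ forall s t, m s t = m t s,
      forall s t, m s t = Some 1%N <-> s = t &
      forall s t, m s t <> Some 0%N].

Definition coxeter_relators : set (word S) :=
  [set r | exists s t k, m s t = Some k /\
     r = flatten (nseq k [:: (s, false); (t, false)])].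

Definition coxeter_system (W : groupType) (e : S -> W) : Prop :=
  coxeter_matrix /\ has_presentation e coxeter_relators.

Definition cox_edge (s t : S) : Prop :=
  if m s t is Some k then 3 <= k else True.

Definition odd_edge (s t : S) : Prop :=
  if m s t is Some k then (3 <= k) && odd k else False.

End Coxeter.

Definition components (S : Type) (r : S -> S -> Prop) : set (set S) :=
  [set [set t | clos_refl_sym_trans S r s t] | s in [set: S]].

Definition Omega (S : Type) (m : S -> S -> option nat) : Type :=
  set_type (components (cox_edge m)).

Section CoxeterComponents.
Variables (S : Type) (m : S -> S -> option nat) (W : groupType) (e : S -> W).

Definition Wcomp (o : Omega m) : subgroup W := gen (e @` val o).

Definition Om_fin : set (Omega m) := [set o | finite_set (sg_set (Wcomp o))].
Definition Om_inf : set (Omega m) := ~` Om_fin.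

Definition Wfin : subgroup W := subprod Wcomp Om_fin.
Definition Winf : subgroup W := subprod Wcomp Om_inf.

Definition Ups : set (set (Omega m)) := iso_classes Wcomp setT.
Definition Ups_fin : set (set (Omega m)) :=
  [set X | Ups X /\ forall o, X o -> Om_fin o].
Definition Ups_inf : set (set (Omega m)) := Ups `\` Ups_fin.

End CoxeterComponents.

Arguments Om_fin {S} m {W} e.
Arguments Om_inf {S} m {W} e.
Arguments Wfin {S} m {W} e.
Arguments Winf {S} m {W} e.
Arguments Ups {S} m {W} e.
Arguments Ups_fin {S} m {W} e.
Arguments Ups_inf {S} m {W} e.

(* Main.v *)
(* Part (i).  Composing an automorphism of G with the projection to a nonabelian
   factor G_l, (C1) yields a unique factor G_(s l) mapped onto G_l, all the others
   being mapped into Z(G_l).  Comparing with the inverse automorphism shows that s is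
   a permutation of the nonabelian factors; the induced map G_(s l) -> G_l is then
   injective because (C1) and (C2) force every homomorphism from a nonabelian factor
   to its center to kill the center.  Dividing by the resulting elements of H3 and H2
   leaves an automorphism a with a(w)^-1 w always central, and these automorphisms
   make up H1.

   Parts (ii) and (iii).  The same argument works for the factors W_o of a Coxeter
   group with trivial center, once these are known to be directly indecomposable.
   Let an irreducible W_o be the product of commuting subgroups A and B.  Write a
   simple reflection as s = a0 b0.  In the Tits representation the rank one operator
   s - 1 is a scalar multiple of a0 - b0^-1, so that b (s - 1) b^-1 - (s - 1)
   commutes with A for every b in B.  Hence, if neither A nor B centralises s, the
   plane spanned by the root of s and its image under b is stable under A and B, thus
   contains all roots, and W_o has rank at most 2.  If each simple reflection is
   centralised by A or by B, then A or B is central, or two adjacent roots span a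
   stable plane.  In rank 2 the claim is elementary.  A nontrivial central element of
   W_o acts as -1 on its roots, which forces W_o to be finite. *)

From HB Require Import structures.
From Stdlib Require Import Relation_Operators Reals Lra.
Require Import Defs.
From mathcomp Require Import all_boot.
From mathcomp Require Import boolp classical_sets functions cardinality.

Set Implicit Arguments.
Unset Strict Implicit.
Unset Printing Implicit Defensive.

Local Open Scope classical_set_scope.
Local Open Scope group_scope.

(** One theorem, [aut_decomposition], serves all three parts. It is stated for a set P of factors:
    the nonabelian ones in (i), the infinite components in (ii), and all components in (iii) when
    the center of W is trivial. For Coxeter groups, indecomposability takes the role of (C1) and
    triviality of the centers that of (C2). Finite components may have a center, so in (ii) they are
    kept together in one block [Wfin], which turns out to be characteristic.

    As the rank is arbitrary, the Coxeter side does not rely on finite dimension: roots are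
    functions on S + S, their independence is read off coordinates, and the Tits representation is
    faithful because induction on length determines the sign of w applied to a simple root.

    For (iii), a homomorphism from W to its center is constant on the generators in an odd
    component. With finitely many odd components this leaves finitely many central automorphisms,
    and [Wfin] is finite as well. Conversely, multiplying the generators in one odd component by a
    fixed central element gives automorphisms that H cannot absorb. *)

Section Subgroups.
Variable G : groupType.
Implicit Types A B N K : set G.

Lemma subg1 A : subgroup_set A -> A 1. Proof. by case. Qed.

Lemma subgV A x : subgroup_set A -> A x -> A x^-1.
Proof. by move=> [A1 AV] Ax; rewrite -[x^-1]mul1g; apply: AV. Qed.

Lemma subgM A x y : subgroup_set A -> A x -> A y -> A (x * y).
Proof.
move=> sA Ax Ay; rewrite -[y]invgK; case: (sA) => _; apply=> //.
exact: subgV.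
Qed.

Lemma subgroup_setP A : A 1 -> (forall x y, A x -> A y -> A (x * y)) ->
  (forall x, A x -> A x^-1) -> subgroup_set A.
Proof. by move=> A1 AM AV; split=> // x y Ax Ay; apply: AM => //; apply: AV. Qed.

Lemma gen_sub (X : set G) x : X x -> sg_set (gen X) x.
Proof. by move=> Xx A sA; apply. Qed.

Lemma gen_min (X A : set G) : subgroup_set A -> X `<=` A -> sg_set (gen X) `<=` A.
Proof. by move=> sA XA x; apply. Qed.

Lemma centraliser_subgroup (X : set G) :
  subgroup_set [set x | forall y, X y -> commute x y].
Proof.
apply: subgroup_setP => [y _|x y cx cy z Xz|x cx y Xy].
- exact/commute_sym/commute1.
- by apply/commute_sym/commuteM; apply/commute_sym; [apply: cx | apply: cy].
- by apply/commute_sym/commuteV/commute_sym/cx.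
Qed.

Lemma gen_commute (X Y : set G) :
  (forall x y, X x -> Y y -> commute x y) ->
  forall x y, sg_set (gen X) x -> sg_set (gen Y) y -> commute x y.
Proof.
move=> XY x y Xx Yy.
apply: (Xx [set x | forall y, gen_set Y y -> commute x y]) => //.
  exact: centraliser_subgroup.
move=> {}x {}Xx {}y {}Yy; apply/commute_sym.
apply: (Yy [set y | forall x, X x -> commute y x]) => //.
  exact: centraliser_subgroup.
by move=> z Yz w Xw; apply/commute_sym/XY.
Qed.

Lemma center_subgroup : subgroup_set (@center G).
Proof.
have := centraliser_subgroup setT.
congr subgroup_set; apply/seteqP; split=> x /= h y //; exact: h.
Qed.

Lemma subgroup_setI A B : subgroup_set A -> subgroup_set B ->
  subgroup_set (A `&` B).
Proof.
move=> [A1 AV] [B1 BV]; split=> // x y [Ax Bx] [Ay By].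
by split; [apply: AV | apply: BV].
Qed.

Lemma setmul_subgroup N K : subgroup_set N -> subgroup_set K ->
  (forall n k, N n -> K k -> N (n ^ k)) -> subgroup_set (setmul N K).
Proof.
move=> sN sK nNK; apply: subgroup_setP.
- by exists 1; [exact: subg1|exists 1; [exact: subg1|rewrite mulg1]].
- move=> _ _ [a Na [b Kb <-]] [c Nc [d Kd <-]].
  exists (a * c ^ b^-1).
    by apply: subgM => //; apply: nNK => //; apply: subgV.
  by exists (b * d); [exact: subgM|rewrite /conjg invgK !mulgA mulgVK].
- move=> _ [a Na [b Kb <-]]; exists ((a^-1) ^ b).
    by apply: nNK => //; apply: subgV.
  by exists b^-1; [exact: subgV|rewrite /conjg invgM !mulgA mulgK].
Qed.

Lemma setmul_l N K : subgroup_set K -> N `<=` setmul N K.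
Proof. by move=> sK x Nx; exists x => //; exists 1; [exact: subg1|exact: mulg1]. Qed.

Lemma setmul_r N K : subgroup_set N -> K `<=` setmul N K.
Proof. by move=> sN x Kx; exists 1; [exact: subg1|exists x => //; exact: mul1g]. Qed.

Lemma setmul_normal N K : subgroup_set N -> subgroup_set K ->
  (forall n k, N n -> K k -> N (n ^ k)) -> normal_in N (setmul N K).
Proof.
move=> sN sK nNK; split=> //; first exact: setmul_subgroup.
  exact: setmul_l.
move=> n _ Nn [a Na [b Kb <-]]; rewrite conjgM; apply: nNK => //.
by rewrite /conjg; apply: subgM => //; [exact: subgV|exact: subgM].
Qed.

Lemma setI1P N K : subgroup_set N -> subgroup_set K ->
  (forall x, N x -> K x -> x = 1) -> N `&` K = [set 1].
Proof.
move=> sN sK NK; apply/seteqP; split=> [x [] | x ->]; first exact: NK.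
by split; exact: subg1.
Qed.

Lemma semidirect_setmul N K : subgroup_set N -> subgroup_set K ->
  (forall n k, N n -> K k -> N (n ^ k)) ->
  (forall x, N x -> K x -> x = 1) -> is_semidirect (setmul N K) N K.
Proof.
by move=> sN sK nNK NK; split=> //; [exact: setmul_normal|exact: setI1P].
Qed.

Lemma direct_setmul N K : subgroup_set N -> subgroup_set K ->
  (forall n k, N n -> K k -> commute n k) ->
  (forall x, N x -> K x -> x = 1) -> is_direct (setmul N K) N K.
Proof.
move=> sN sK cNK NK.
have nNK n k (Nn : N n) (Kk : K k) : N (n ^ k).
  by rewrite conjgE (cNK n k) // mulKg.
have [nN _ eNK _] := semidirect_setmul sN sK nNK NK.
split=> //.
suff -> : setmul N K = setmul K N.
  by apply: setmul_normal => // k n Kk Nn; rewrite conjgE -(cNK n k) // mulKg.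
apply/seteqP; split=> _ [a Na [b Kb <-]];
  exists b => //; exists a => //; [apply/esym|]; exact: cNK.
Qed.

End Subgroups.

Lemma morph_mul1 (K L : groupType) (f : K -> L) :
  {morph f : x y / x * y} -> f 1 = 1.
Proof. by move=> fM; apply: (@mulgI _ (f 1)); rewrite -fM !mulg1. Qed.

Lemma morph_mulV (K L : groupType) (f : K -> L) :
  {morph f : x y / x * y} -> {morph f : x / x^-1}.
Proof. by move=> fM x; apply/esym/mulg1_eq; rewrite -fM mulgV morph_mul1. Qed.

Lemma morph_inj (K L : groupType) (f : K -> L) :
  {morph f : x y / x * y} -> (forall x, f x = 1 -> x = 1) -> injective f.
Proof.
move=> fM f1 x y fxy; apply: divg1_eq; apply: f1.
by rewrite fM morph_mulV // fxy mulgV.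
Qed.

Definition mkmul (K L : groupType) (f : K -> L) (fM : {morph f : x y / x * y}) :
  {multiplicative K -> L} := HB.pack f (isMultiplicative.Build K L f fM).

Lemma preim_subgroup (K L : groupType) (f : K -> L) (A : set L) :
  {morph f : x y / x * y} -> subgroup_set A -> subgroup_set [set x | A (f x)].
Proof.
move=> fM sA; apply: subgroup_setP => /= [|x y Ax Ay|x Ax].
- by rewrite morph_mul1 //; exact: subg1.
- by rewrite fM; exact: subgM.
- by rewrite morph_mulV //; exact: subgV.
Qed.

Lemma image_subgroup (K L : groupType) (f : K -> L) (A : set K) :
  {morph f : x y / x * y} -> subgroup_set A -> subgroup_set (f @` A).
Proof.
move=> fM sA; apply: subgroup_setP.
- by exists 1; [exact: subg1|exact: morph_mul1].
- by move=> _ _ [x Ax <-] [y Ay <-]; exists (x * y); [exact: subgM|exact: fM].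
- by move=> _ [x Ax <-]; exists x^-1; [exact: subgV|exact: morph_mulV].
Qed.

Lemma eq_subgroup (K L : groupType) (f g : K -> L) :
  {morph f : x y / x * y} -> {morph g : x y / x * y} ->
  subgroup_set [set x | f x = g x].
Proof.
move=> fM gM; apply: subgroup_setP => /= [|x y|x].
- by rewrite !morph_mul1.
- by rewrite fM gM => -> ->.
- by rewrite !morph_mulV // => ->.
Qed.

Section Grp.
Variables (G : groupType) (A : subgroup G).

Lemma sg1 : sg_set A 1. Proof. exact: subg1 (sg_closed A). Qed.

Lemma sgV x : sg_set A x -> sg_set A x^-1.
Proof. exact: subgV (sg_closed A). Qed.

Lemma sgM x y : sg_set A x -> sg_set A y -> sg_set A (x * y).
Proof. exact: subgM (sg_closed A). Qed.

Lemma gvalP (x : grp A) : sg_set A (gval x). Proof. exact: set_mem (valP x). Qed.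

Definition mkg x (Ax : sg_set A x) : grp A := exist _ x (mem_set Ax).

Lemma gval_mkg x (Ax : sg_set A x) : gval (mkg Ax) = x. Proof. by []. Qed.

Lemma gval_inj : injective (@gval G A). Proof. exact: val_inj. Qed.

Lemma gvalM : {morph @gval G A : x y / x * y}. Proof. exact: valM. Qed.

Lemma gval1 : gval (1 : grp A) = 1. Proof. exact: morph_mul1 gvalM. Qed.

Lemma grpP x : sg_set A x -> exists y : grp A, gval y = x.
Proof. by move=> Ax; exists (mkg Ax). Qed.

Lemma center_grpP (x : grp A) :
  center x <-> forall y, sg_set A y -> commute (gval x) y.
Proof.
split=> [cx y /grpP[z <-]|cx y]; first by rewrite /commute -!gvalM cx.
by apply: gval_inj; rewrite !gvalM; apply/cx/gvalP.
Qed.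

End Grp.

Lemma isog_refl (K : groupType) : isog K K.
Proof.
by exists (@mkmul K K id (fun _ _ => erefl)); exists id.
Qed.

Lemma isog_sym (K L : groupType) : isog K L -> isog L K.
Proof.
move=> [f [g fK gK]].
have gM : {morph g : x y / x * y}.
  by move=> x y; rewrite -{1}(gK x) -{1}(gK y) -gmulfM fK.
by exists (mkmul gM); exists f.
Qed.

Lemma isog_trans (K L M : groupType) : isog K L -> isog L M -> isog K M.
Proof.
move=> [f bf] [g bg].
have gfM : {morph g \o f : x y / x * y} by move=> x y /=; rewrite !gmulfM.
by exists (mkmul gfM); exact: bij_comp.
Qed.

Lemma aut_bij (K : groupType) (f : K -> K) : {morph f : x y / x * y} ->
  injective f -> (forall y, exists x, f x = y) -> exists a : Aut K, a =1 f.
Proof.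
move=> fM fI /choice[g gK].
have fK : cancel f g by move=> x; apply: fI.
by exists (MkAut fM fK gK).
Qed.

Section AutFacts.
Variable K : groupType.
Implicit Types a b : Aut K.

Lemma autM a b x : (a * b) x = a (b x). Proof. by []. Qed.
Lemma autKV a x : a ((a^-1)%g x) = x. Proof. exact: aut_invK. Qed.
Lemma autVK a x : (a^-1)%g (a x) = x. Proof. exact: aut_funK. Qed.
Lemma autV1 a : aut_inv a =1 (a^-1)%g. Proof. by []. Qed.
Lemma autJ a b x : (a ^ b) x = (b^-1)%g (a (b x)). Proof. by []. Qed.
Lemma aut_invM a : {morph aut_inv a : x y / x * y}.
Proof. exact: aut_morph (a^-1)%g. Qed.
Lemma aut_inj a : injective a. Proof. exact: can_inj (autVK a). Qed.
Lemma autV_fix a x : a x = x -> (a^-1)%g x = x.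
Proof. by move=> {1}<-; rewrite autVK. Qed.

Lemma aut_center a x : center x -> center (a x).
Proof.
move=> cx y; apply: (@aut_inj (a^-1)%g).
by rewrite !(aut_morph (a^-1)%g) autVK; exact: cx.
Qed.

End AutFacts.

(** * Restricted direct products *)

Section Dprod.
Variables (G : groupType) (Lam : Type) (F : Lam -> subgroup G).
Hypothesis GF : is_dprod F.
Implicit Types (l k : Lam) (x y : G) (Q : set Lam).

Lemma dprod_comm l k x y : l <> k -> sg_set (F l) x -> sg_set (F k) y ->
  commute x y.
Proof. by case: GF => c _ _ ne; exact: c. Qed.

Lemma dprod_ind (A : set G) : subgroup_set A ->
  (forall l x, sg_set (F l) x -> A x) -> forall x, A x.
Proof.
case: GF => _ gF _ sA FA x; have : [set: G] x by [].
by rewrite -gF; apply: gen_min => // y [l _]; apply: FA.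
Qed.

Lemma sub_subprod Q l x : Q l -> sg_set (F l) x -> sg_set (subprod F Q) x.
Proof. by move=> Ql lx; apply: gen_sub; exists l. Qed.

Lemma subprod_ind Q (A : set G) : subgroup_set A ->
  (forall l x, Q l -> sg_set (F l) x -> A x) -> sg_set (subprod F Q) `<=` A.
Proof. by move=> sA QA; apply: gen_min => // x [l]; exact: QA. Qed.

Lemma subprod_commute Q Q' x y : Q `&` Q' = set0 ->
  sg_set (subprod F Q) x -> sg_set (subprod F Q') y -> commute x y.
Proof.
move=> QQ'; apply: gen_commute x y => x y [l Ql lx] [k Qk ky].
apply: dprod_comm lx ky => elk.
have : (Q `&` Q') l by split=> //; rewrite elk.
by rewrite QQ'.
Qed.

Lemma eq_dprod (L : groupType) (f g : G -> L) :
  {morph f : x y / x * y} -> {morph g : x y / x * y} ->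
  (forall l x, sg_set (F l) x -> f x = g x) -> f =1 g.
Proof. by move=> fM gM fg; apply: dprod_ind => //; exact: eq_subgroup. Qed.

Section Lift.
Variables (L : groupType) (f : Lam -> G -> L).
Hypothesis fM : forall l x y, sg_set (F l) x -> sg_set (F l) y ->
  f l (x * y) = f l x * f l y.
Hypothesis fC : forall l k x y, l <> k -> sg_set (F l) x -> sg_set (F k) y ->
  commute (f l x) (f k y).

Let inF (p : Lam * G) := sg_set (F p.1) p.2.
(** Elements of G are written as words of labelled letters. The label is kept because [f l] depends
    on it, and each letter must lie in the factor of its label, the only place where [f l] is known
    to be multiplicative. *)
Fixpoint allF (u : seq (Lam * G)) : Prop :=
  if u is p :: u' then inF p /\ allF u' else True.
Definition ev (u : seq (Lam * G)) : G := foldr (fun p => mul p.2) 1 u.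
Definition fv (u : seq (Lam * G)) : L := foldr (fun p => mul (f p.1 p.2)) 1 u.

Let f1 l : f l 1 = 1.
Proof.
have F1 : sg_set (F l) 1 by exact: sg1.
by apply: (@mulgI _ (f l 1)); rewrite -fM // !mulg1.
Qed.

Lemma allF_cat u v : allF u -> allF v -> allF (u ++ v).
Proof. by elim: u => //= p u IH [? ?] ?; split=> //; exact: IH. Qed.

Lemma ev_cat u v : ev (u ++ v) = ev u * ev v.
Proof. by elim: u => /= [|p u ->]; rewrite ?mul1g ?mulgA. Qed.

Lemma fv_cat u v : fv (u ++ v) = fv u * fv v.
Proof. by elim: u => /= [|p u ->]; rewrite ?mul1g ?mulgA. Qed.

Let invw (u : seq (Lam * G)) := rev [seq (p.1, p.2^-1) | p <- u].

Lemma invwP u : allF u ->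
  [/\ allF (invw u), ev (invw u) = (ev u)^-1 & fv (invw u) = (fv u)^-1].
Proof.
elim: u => [_|[l x] u IH /= [/= lx /IH[h1 h2 h3]]].
  by rewrite /invw /= !invg1.
have lx' : sg_set (F l) x^-1 by exact: sgV.
rewrite /invw /= rev_cons -cats1 ev_cat fv_cat /= !invgM !mulg1 h2 h3.
split=> //; first exact: allF_cat.
by congr (_ * _); apply/esym/mulg1_eq; rewrite -fM // mulgV f1.
Qed.

Lemma ev_onto x : exists u, allF u /\ ev u = x.
Proof.
apply: (dprod_ind (A := [set x | exists u, allF u /\ ev u = x])).
  apply: subgroup_setP => [|_ _ [u [au <-]] [v [av <-]]|_ [u [au <-]]].
  - by exists [::].
  - by exists (u ++ v); split; [exact: allF_cat|exact: ev_cat].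
  - by exists (invw u); case: (invwP au).
by move=> l {}x lx; exists [:: (l, x)]; rewrite /= mulg1.
Qed.

(** Letters with different labels commute, in G and after applying f, so those labelled l can be
    moved to the front and merged. The bound on [size u'] is what the inductions over words run
    on. *)
Lemma split_label l u : allF u -> exists x u', [/\ sg_set (F l) x,
   allF u' /\ sg_set (subprod F [set k | k <> l]) (ev u'),
   size u' <= size u, ev u = x * ev u' & fv u = f l x * fv u'].
Proof.
have F1 k : sg_set (F k) 1 by exact: sg1.
elim: u => [_|[k y] u IH /= [/= ky /IH[x [u' [lx [au' Nu'] su' eu fu]]]]].
  exists 1, [::]; rewrite !mulg1 f1; split=> //.
  by split=> //; exact: sg1.
have [ekl|nkl] := pselect (k = l).
  exists (y * x), u'; rewrite ekl in ky *; split=> //.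
  - exact: sgM.
  - exact: leqW.
  - by rewrite /= eu mulgA.
  - by rewrite /= fu fM // mulgA.
exists x, ((k, y) :: u'); split=> //=.
- split; first by split.
  by apply: (sgM (A := subprod F [set k | k <> l])) => //; exact: sub_subprod ky.
- by rewrite eu !mulgA (dprod_comm nkl ky lx).
- by rewrite fu !mulgA (fC nkl ky lx).
Qed.

(** The first letter y merges with the other letters labelled l into one element of [F l] that also
    lies in the product of the remaining factors, hence is 1. What is left is a shorter word. *)
Lemma ev1_fv1 u : allF u -> ev u = 1 -> fv u = 1.
Proof.
have [n] := ubnP (size u); elim: n u => // n IH [//|[l y] u] /= /ltnSE sn.
move=> [/= ly au].
have [x [u' [lx [au' Nu'] su -> ->]]] := split_label l au.
rewrite !mulgA => e1.
have yx1 : y * x = 1.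
  case: GF => _ _ /(_ l) /seteqP[+ _]; apply; split=> /=.
    exact: sgM.
  suff -> : y * x = (ev u')^-1 by apply: (sgV (A := subprod F [set k | k <> l])).
  by apply/invg_inj; rewrite invgK; exact: mulg1_eq.
rewrite -fM // yx1 f1 mul1g; apply: IH => //; first exact: leq_ltn_trans sn.
by move: e1; rewrite yx1 mul1g.
Qed.

Lemma dprod_lift : exists g : G -> L, {morph g : x y / x * y} /\
  forall l x, sg_set (F l) x -> g x = f l x.
Proof.
have /choice[w wP] := ev_onto.
have fvE u v : allF u -> allF v -> ev u = ev v -> fv u = fv v.
  move=> au av euv; have [av' ev' fv'] := invwP av.
  apply: divg1_eq; rewrite -fv' -fv_cat; apply: ev1_fv1.
    exact: allF_cat.
  by rewrite ev_cat ev' euv mulgV.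
exists (fv \o w); split=> [x y|l x lx] /=.
  have [[ax ex] [ay ey]] := (wP x, wP y); have [axy exy] := wP (x * y).
  rewrite -fv_cat; apply: fvE => //; first exact: allF_cat.
  by rewrite ev_cat ex ey.
have [ax ex] := wP x.
by rewrite (fvE _ [:: (l, x)]) //= ?mulg1.
Qed.

End Lift.

(** Projections to subproducts are kept as endomorphisms of G, so that coordinates can be multiplied
    and compared inside G. *)
Lemma restr_ex Q : exists g : G -> G, {morph g : x y / x * y} /\
  forall l x, sg_set (F l) x -> g x = if `[< Q l >] then x else 1.
Proof.
apply: (dprod_lift (f := fun l x => if `[< Q l >] then x else 1)).
  by move=> l x y _ _; case: ifP; rewrite // mulg1.
move=> l k x y nlk lx ky; case: ifP => _; last exact/commute_sym/commute1.
by case: ifP => _; [exact: dprod_comm lx ky|exact: commute1].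
Qed.

Definition restr Q : G -> G := projT1 (cid (restr_ex Q)).

Lemma restrM Q : {morph restr Q : x y / x * y}.
Proof. by rewrite /restr; case: cid => g []. Qed.

Lemma restrE Q l x : sg_set (F l) x -> restr Q x = if `[< Q l >] then x else 1.
Proof. by rewrite /restr; case: cid => g [_ +] /=; apply. Qed.

Lemma restr_id Q l x : Q l -> sg_set (F l) x -> restr Q x = x.
Proof. by move=> Ql /(restrE Q) ->; rewrite asboolT. Qed.

Lemma restr_1 Q l x : ~ Q l -> sg_set (F l) x -> restr Q x = 1.
Proof. by move=> Ql /(restrE Q) ->; rewrite asboolF. Qed.

Lemma restr_in Q x : sg_set (subprod F Q) (restr Q x).
Proof.
apply: (dprod_ind (A := [set x | sg_set (subprod F Q) (restr Q x)])).
  by apply: preim_subgroup; [exact: restrM|exact: sg_closed].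
move=> l {}x lx /=; rewrite (restrE _ lx); case: asboolP => [Ql|_].
  exact: sub_subprod lx.
exact: (@sg1 _ (subprod F Q)).
Qed.

Lemma restr_subprod Q x : sg_set (subprod F Q) x -> restr Q x = x.
Proof.
apply: (subprod_ind (A := [set x | restr Q x = x])).
  by apply: (eq_subgroup (g := id)); first exact: restrM.
by move=> l {}x Ql; exact: restr_id.
Qed.

Lemma restr_subprod1 Q Q' x : Q `&` Q' = set0 ->
  sg_set (subprod F Q) x -> restr Q' x = 1.
Proof.
move=> QQ'; apply: (subprod_ind (A := [set x | restr Q' x = 1])).
  by apply: (eq_subgroup (g := fun=> 1)) => [|y z]; rewrite ?mulg1 //; exact: restrM.
move=> l {}x Ql; apply: restr_1 => Q'l.
by have : (Q `&` Q') l by []; rewrite QQ'.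
Qed.

Lemma restr_split Q x : x = restr Q x * restr (~` Q) x.
Proof.
have cQ y z : commute (restr Q y) (restr (~` Q) z).
  exact: subprod_commute (setICr Q) (restr_in y) (restr_in z).
apply: (eq_dprod (f := id) (g := fun x => restr Q x * restr (~` Q) x)) => //.
  move=> y z; rewrite !restrM !mulgA; congr (_ * _).
  by rewrite -!mulgA; congr (_ * _); exact: cQ.
move=> l y ly; rewrite !(restrE _ ly) asbool_neg.
by case: asboolP; rewrite ?mulg1 ?mul1g.
Qed.

Definition coord l : G -> G := restr [set l].

Lemma coordM l : {morph coord l : x y / x * y}. Proof. exact: restrM. Qed.
Lemma coord1 l : coord l 1 = 1. Proof. exact: morph_mul1 (@coordM l). Qed.
Lemma coordV l : {morph coord l : x / x^-1}. Proof. exact: morph_mulV (@coordM l). Qed.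

Lemma coord_in l x : sg_set (F l) (coord l x).
Proof.
apply: (subprod_ind (Q := [set l]) (A := sg_set (F l))); last exact: restr_in.
  exact: sg_closed.
by move=> _ y ->.
Qed.

Lemma coord_id l x : sg_set (F l) x -> coord l x = x.
Proof. exact: restr_id. Qed.

Lemma coord_ne l k x : k <> l -> sg_set (F k) x -> coord l x = 1.
Proof. by move=> nkl; exact: restr_1. Qed.

Lemma coord_ext1 x : (forall l, coord l x = 1) -> x = 1.
Proof.
(* Only the [ev] half of [split_label] is wanted, so it is fed the trivial family of
   homomorphisms. *)
pose f0 (_ : Lam) (_ : G) : G := 1.
have f0M l y z : sg_set (F l) y -> sg_set (F l) z -> f0 l (y * z) = f0 l y * f0 l z.
  by rewrite mulg1.
have f0C l k y z : l <> k -> sg_set (F l) y -> sg_set (F k) z ->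
  commute (f0 l y) (f0 k z) by [].
have [u [au <-]] := ev_onto f0M x.
have [n] := ubnP (size u); elim: n u au => // n IH [//|[l y] u] /=.
move=> [/= ly au] /ltnSE sn.
have [z [u' [lz [au' Nu'] su -> _]]] := split_label f0M f0C l au.
rewrite mulgA => h; have lyz : sg_set (F l) (y * z).
  exact: sgM.
have u'1 : coord l (ev u') = 1.
  apply: restr_subprod1 Nu'; apply/seteqP; split=> // k [/= nk ek].
  exact: nk.
have yz1 : y * z = 1.
  by have := h l; rewrite coordM u'1 mulg1 coord_id.
rewrite yz1 mul1g; apply: IH => // [|k]; first exact: leq_ltn_trans sn.
by have := h k; rewrite yz1 mul1g.
Qed.

Lemma coord_ext x y : (forall l, coord l x = coord l y) -> x = y.
Proof.
move=> h; apply: divg1_eq; apply: coord_ext1 => l.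
by rewrite coordM coordV h mulgV.
Qed.

Lemma coord_subprod Q x : sg_set (subprod F Q) x <-> forall l, ~ Q l -> coord l x = 1.
Proof.
split=> [Qx l Ql|h].
  apply: restr_subprod1 Qx; apply/seteqP; split=> // k [Qk ek].
  by apply: Ql; rewrite -ek.
suff <- : restr Q x = x by exact: restr_in.
apply: coord_ext => l; rewrite [in RHS](restr_split Q x) coordM.
have [Ql|Ql] := pselect (Q l).
  suff -> : coord l (restr (~` Q) x) = 1 by rewrite mulg1.
  apply: restr_subprod1 (restr_in _); apply/seteqP; split=> // k [Qk ek].
  by apply: Qk; rewrite ek.
rewrite -coordM -restr_split h //.
apply: restr_subprod1 (restr_in _); apply/seteqP; split=> // k [Qk ek].
by apply: Ql; rewrite -ek.
Qed.

Lemma coord_comm l x y : sg_set (F l) y -> commute (coord l x) y -> commute x y.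
Proof.
move=> ly c; rewrite (restr_split [set l] x).
apply/commute_sym/commuteM; apply/commute_sym => //.
exact: subprod_commute (setICl [set l]) (restr_in x)
  (sub_subprod (Q := [set l]) erefl ly).
Qed.

Lemma center_coord x :
  center x <-> forall l y, sg_set (F l) y -> commute (coord l x) y.
Proof.
split=> [cx l y ly|h y].
  by have := congr1 (coord l) (cx y); rewrite !coordM (coord_id ly).
apply: (dprod_ind (A := [set y | commute x y])).
  apply: subgroup_setP => [|a b|a]; first exact: commute1.
    exact: commuteM.
  exact: commuteV.
by move=> l {}y ly; exact: coord_comm ly (h _ _ ly).
Qed.

Lemma center_factor l x : sg_set (F l) x ->
  center x <-> forall y, sg_set (F l) y -> commute x y.
Proof.
move=> lx; split=> [cx y _|h]; first exact: cx.
apply/center_coord => k y ky; have [e|n] := pselect (l = k).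
  by rewrite -e in ky *; rewrite coord_id //; exact: h.
by rewrite (coord_ne n) //; exact/commute_sym/commute1.
Qed.

(** Covers both kinds of automorphisms built later: permutations of isomorphic factors and, with t =
    id, factorwise automorphisms. *)
Lemma dprod_aut (t : Lam -> Lam) (j : Lam -> G -> G) :
  injective t -> (forall k, exists l, t l = k) ->
  (forall l x y, sg_set (F l) x -> sg_set (F l) y -> j l (x * y) = j l x * j l y) ->
  (forall l x, sg_set (F l) x -> sg_set (F (t l)) (j l x)) ->
  (forall l x, sg_set (F l) x -> j l x = 1 -> x = 1) ->
  (forall l y, sg_set (F (t l)) y -> exists2 x, sg_set (F l) x & j l x = y) ->
  exists a : Aut G, forall l x, sg_set (F l) x -> a x = j l x.
Proof.
move=> tI tS jM jin j1 jS.
have jC l k x y : l <> k -> sg_set (F l) x -> sg_set (F k) y ->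
  commute (j l x) (j k y).
  by move=> nlk lx ky; apply: dprod_comm (jin _ _ lx) (jin _ _ ky) => /tI.
have [g [gM gE]] := dprod_lift jM jC.
have gcoord l x : coord (t l) (g x) = j l (coord l x).
  apply: (eq_dprod (f := coord (t l) \o g) (g := j l \o coord l)) => [y z|y z|k y ky] /=.
  - by rewrite gM coordM.
  - by rewrite coordM jM //; exact: coord_in.
  have [e|n] := pselect (k = l).
    by rewrite -e (gE k) // !coord_id //; exact: jin.
  rewrite (coord_ne n) // (gE k) // (coord_ne (k := t k)); first last.
  - exact: jin.
  - by move=> /tI.
  apply: (@mulgI _ (j l 1)); rewrite mulg1 -jM ?mulg1 //; exact: sg1.
have [||a aE] := aut_bij gM.
- apply: morph_inj => // x gx; apply: coord_ext1 => l; apply: (@j1 l).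
    exact: coord_in.
  by rewrite -gcoord gx coord1.
- apply: (dprod_ind (A := [set y | exists x, g x = y])).
    have := image_subgroup (A := setT) gM.
    suff -> : [set y | exists x, g x = y] = range g by apply; split.
    by apply/seteqP; split=> y [x]; [exists x|exists x].
  move=> k y; have [l <-] := tS k; move=> /jS[x lx <-].
  by exists x; exact: gE.
by exists a => l x lx; rewrite aE (gE l).
Qed.

End Dprod.

(** * Automorphisms of a restricted direct product *)

Section FactorAuts.
Variables (G : groupType) (Lam : Type) (F : Lam -> subgroup G) (P : set Lam).

(** Works with elements of G instead of a family of automorphisms of subgroup types. The inverse is
    mentioned because mapping [F l] into itself does not mean mapping it onto itself. *)
Lemma factor_autsP (a : Aut G) : factor_auts F P a <->
  (forall l, P l -> forall x, sg_set (F l) x ->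
     sg_set (F l) (a x) /\ sg_set (F l) (aut_inv a x)) /\
  (forall l, ~ P l -> forall x, sg_set (F l) x -> a x = x).
Proof.
split=> [[b [bP bN]]|[aP aN]].
  split=> l Pl x /grpP[y <-]; last exact: bN.
  split; first by rewrite bP //; exact: gvalP.
  suff -> : aut_inv a (gval y) = gval (aut_inv (b l) y) by exact: gvalP.
  by apply: (@aut_inj _ a); rewrite aut_invK bP // aut_invK.
have bex l : exists b : Aut (grp (F l)),
    P l -> forall x, a (gval x) = gval (b x).
  have [Pl|nPl] := pselect (P l); last by exists (aut_one _).
  pose f (x : grp (F l)) := mkg (proj1 (aP l Pl _ (gvalP x))).
  pose g (x : grp (F l)) := mkg (proj2 (aP l Pl _ (gvalP x))).
  have fM : {morph f : x y / x * y}.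
    by move=> x y; apply: gval_inj; rewrite gvalM !gval_mkg gvalM aut_morph.
  have fK : cancel f g by move=> x; apply: gval_inj; rewrite !gval_mkg aut_funK.
  have gK : cancel g f by move=> x; apply: gval_inj; rewrite !gval_mkg aut_invK.
  by exists (MkAut fM fK gK).
exists (fun l => projT1 (cid (bex l))); split=> l Pl x.
  by case: cid => b /= ->.
by apply: aN Pl _ _; exact: gvalP.
Qed.

Lemma factor_auts_subgroup : subgroup_set (factor_auts F P).
Proof.
apply: subgroup_setP => [|a b /factor_autsP[aP aN] /factor_autsP[bP bN]|
    a /factor_autsP[aP aN]]; apply/factor_autsP => //.
- split=> l Pl x lx; last by rewrite autM (bN l) // (aN l).
  rewrite autM /=; split; first exact: (aP _ Pl _ (bP _ Pl _ lx).1).1.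
  exact: (bP _ Pl _ (aP _ Pl _ lx).2).2.
- split=> l Pl x lx; first by case: (aP _ Pl _ lx).
  by apply: autV_fix; exact: aN lx.
Qed.

Lemma factor_auts_in a l x : factor_auts F P a -> P l ->
  sg_set (F l) x -> sg_set (F l) (a x).
Proof. by case/factor_autsP => + _ Pl lx => /(_ l Pl x lx)[]. Qed.

End FactorAuts.

Section Transport.
Variables (G : groupType) (Lam : Type) (F : Lam -> subgroup G).
Variable i : forall m l, grp (F l) -> grp (F m).

(** The isomorphism [i m l] as a total map on G, so that it composes with automorphisms of G; the
    value 1 outside [F l] is a dummy. *)
Definition transport m l (x : G) : G :=
  if pselect (sg_set (F l) x) is left lx then gval (i m (mkg lx)) else 1.

Lemma transportE m l (x : grp (F l)) : transport m l (gval x) = gval (i m x).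
Proof.
rewrite /transport; case: pselect => [lx|]; last by case; exact: gvalP.
by congr (gval (i m _)); exact: gval_inj.
Qed.

Lemma transport_in m l x : sg_set (F l) x -> sg_set (F m) (transport m l x).
Proof. by move=> /grpP[y <-]; rewrite transportE; exact: gvalP. Qed.

End Transport.

Section SymAuts.
Variables (G : groupType) (Lam : Type) (F : Lam -> subgroup G) (P : set Lam).
Hypothesis GF : is_dprod F.
Variable i : forall m l, grp (F l) -> grp (F m).
Hypothesis iP : iso_system P i.
Local Notation J := (transport i).
Let ism l m := [/\ P l, P m & isog (grp (F l)) (grp (F m))].

Let ism_sym l m : ism l m -> ism m l.
Proof. by case=> Pl Pm h; split=> //; exact: isog_sym. Qed.

Let ism_trans l m n : ism l m -> ism m n -> ism l n.
Proof. by move=> [Pl Pm h] [_ Pn h']; split=> //; exact: isog_trans h h'. Qed.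

Let cls l := [set m | P m /\ isog (grp (F l)) (grp (F m))].

Let clsP l m : ism l m -> [/\ iso_classes F P (cls l), cls l l & cls l m].
Proof.
by case=> Pl Pm h; split=> //; [exists l|split=> //; exact: isog_refl].
Qed.

Let J_M l m x y : ism l m -> sg_set (F l) x -> sg_set (F l) y ->
  J m l (x * y) = J m l x * J m l y.
Proof.
move=> /clsP[Cl ll lm] /grpP[a <-] /grpP[b <-].
have [/(_ l m ll lm)[iM _] _ _ _] := iP Cl.
by rewrite -gvalM !transportE iM gvalM.
Qed.

Let J_id l x : P l -> sg_set (F l) x -> J l l x = x.
Proof.
move=> Pl /grpP[a <-]; have [|Cl ll _] := clsP (l := l) (m := l).
  by split=> //; exact: isog_refl.
by have [_ /(_ l ll a) ia _ _] := iP Cl; rewrite transportE ia.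
Qed.

Let J_J l m n x : ism l m -> ism m n -> sg_set (F l) x ->
  J n m (J m l x) = J n l x.
Proof.
move=> lm mn /grpP[a <-]; have ln := ism_trans lm mn.
have [[Cl ll lm'] [_ _ ln']] := (clsP lm, clsP ln).
have [_ _ _ /(_ l m n ll lm' ln' a) /= ia] := iP Cl.
by rewrite !transportE ia.
Qed.

(** The permutations of the separate classes are glued to one permutation t of all indices, trivial
    outside P. Products and inverses in [sym_auts] then become compositions and inverses of such
    t. *)
Definition sym_spec (t t' : Lam -> Lam) (a : Aut G) : Prop :=
  [/\ cancel t t' /\ cancel t' t, forall l, P l -> ism l (t l),
      forall l, ~ P l -> t l = l,
      forall l x, P l -> sg_set (F l) x -> a x = J (t l) l x &
      forall l x, ~ P l -> sg_set (F l) x -> a x = x].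

Lemma sym_autsP a :
  sym_auts i (iso_classes F P) a <-> exists t t', sym_spec t t' a.
Proof.
split=> [[t [tb tE t1]]|[t [t' [[tK t'K] tP tN aP aN]]]].
  pose tt l := if pselect (P l) then t (cls l) l else l.
  have self l : P l -> ism l l by move=> Pl; split=> //; exact: isog_refl.
  have ttP l : P l -> ism l (tt l).
    move=> Pl; have [Cl ll _] := clsP (self l Pl).
    have [/(_ l ll) [h1 h2] _ _] := tb _ Cl.
    by rewrite /tt; case: pselect.
  have cls_eq l m : ism l m -> cls l = cls m.
    move=> lm; apply/seteqP; split=> n [Pn ln]; split=> //.
      by have [] : ism m n by apply: ism_trans (ism_sym lm) _; case: lm.
    by have [] : ism l n by apply: ism_trans (lm) _; case: lm.
  have ttI : injective tt.
    move=> l m elm.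
    have [Pl|nPl] := pselect (P l); last first.
      have ettl : tt l = l by rewrite /tt; case: pselect.
      have [Pm|nPm] := pselect (P m); last first.
        have ettm : tt m = m by rewrite /tt; case: pselect.
        by rewrite -ettl elm.
      by case: nPl; rewrite -ettl elm; case: (ttP m Pm).
    have [Pm|nPm] := pselect (P m); last first.
      have ettm : tt m = m by rewrite /tt; case: pselect.
      by case: nPm; rewrite -ettm -elm; case: (ttP l Pl).
    have lm : ism l m.
      apply: ism_trans (ttP _ Pl) _; rewrite elm; apply: ism_sym; exact: ttP.
    have [Cl ll lm'] := clsP lm.
    have [_ tI _] := tb _ Cl.
    move: elm; rewrite /tt; case: pselect => [?|//]; case: pselect => [?|//] /=.
    rewrite -(cls_eq _ _ lm) => elm.
    by apply: tI elm; exact: mem_set.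
  have ttS m : exists l, tt l = m.
    have [Pm|nPm] := pselect (P m); last by exists m; rewrite /tt; case: pselect.
    have [Cm mm _] := clsP (self m Pm).
    have [_ _ /(_ m mm)[l [Pl ml] e]] := tb _ Cm.
    exists l; rewrite /tt; case: pselect => [?|//] /=.
    by rewrite -(cls_eq m l).
  have [t' t'K] := choice ttS.
  exists tt, t'; split=> //.
  - by split=> // l; apply: ttI.
  - by move=> l nPl; rewrite /tt; case: pselect.
  - move=> l x Pl /grpP[y <-]; have [Cl ll _] := clsP (self l Pl).
    by rewrite (tE _ _ Cl ll) transportE /tt; case: pselect.
  - move=> l x nPl /grpP[y <-]; apply: t1 => _ [m Pm <-] [Pl _].
    exact: nPl.
exists (fun _ => t); split=> [X [l Pl <-]|X m [l Pl <-] [Pm lm] x|l h x].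
- split=> [m [Pm lm]|m n _ _ /(can_inj tK)|m [Pm lm]] //.
    have [_ Ptm mtm] := tP m Pm; split=> //; exact: isog_trans lm mtm.
  have Pt'm : P (t' m).
    have [//|nP] := pselect (P (t' m)).
    by move: Pm; rewrite -(t'K m) tN // -{2}(tN _ nP) t'K.
  exists (t' m) => //; split=> //; apply: isog_trans lm _.
  by have [_ _] := tP _ Pt'm; rewrite t'K; exact: isog_sym.
- by rewrite (aP m) ?transportE //; exact: gvalP.
- apply: (aN l); last exact: gvalP.
  move=> Pl; apply: (h (cls l)); first by exists l.
  by split=> //; exact: isog_refl.
Qed.

Lemma sym_spec_in t t' a l x : sym_spec t t' a -> sg_set (F l) x ->
  sg_set (F (t l)) (a x).
Proof.
move=> [_ _ tN aP aN] lx; have [Pl|nPl] := pselect (P l).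
  by rewrite (aP l) //; exact: transport_in.
by rewrite tN // (aN l).
Qed.

Lemma sym_spec_P t t' a l : sym_spec t t' a -> P (t l) <-> P l.
Proof.
move=> [[tK _] tP tN _ _]; have [Pl|nPl] := pselect (P l).
  by split=> // _; have [] := tP l Pl.
by rewrite tN.
Qed.

Lemma sym_specV t t' a : sym_spec t t' a -> sym_spec t' t a^-1.
Proof.
move=> ta; case: (ta) => [[tK t'K] tP tN aP aN].
have Pt' l : P (t' l) <-> P l by rewrite -(sym_spec_P (t' l) ta) t'K.
have tP' l : P l -> ism l (t' l).
  by move=> /Pt' Pl; have := tP _ Pl; rewrite t'K; exact: ism_sym.
split=> // [l nPl|l x Pl lx|l x nPl lx]; first by rewrite -{1}(tN l nPl) tK.
- apply: (@aut_inj _ a); rewrite autKV (aP (t' l)); last exact: transport_in.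
    rewrite t'K J_J ?J_id //; first exact: tP'.
    by apply/ism_sym/tP'.
  exact/Pt'.
- by apply: autV_fix; exact: aN lx.
Qed.

Lemma sym_specM t t' a u u' b : sym_spec t t' a -> sym_spec u u' b ->
  sym_spec (t \o u) (u' \o t') (a * b).
Proof.
move=> ta ub; case: (ta) => [[tK t'K] tP tN aP aN].
case: (ub) => [[uK u'K] uP uN bP bN].
split=> /=; first by split; exact: can_comp.
- move=> l Pl; apply: ism_trans (uP l Pl) _.
  by apply: tP; have [] := uP l Pl.
- by move=> l nPl; rewrite uN // tN.
- move=> l x Pl lx; have [_ Pul _] := uP l Pl.
  rewrite (aP (u l)) //; last exact: sym_spec_in ub lx.
  by rewrite (bP l) // J_J //; [exact: uP|exact: tP].
- by move=> l x nPl lx; rewrite (bN l) // (aN l).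
Qed.

Lemma sym_spec1 : sym_spec id id 1.
Proof.
split=> //; first by move=> l Pl; split=> //; exact: isog_refl.
by move=> l x Pl lx; rewrite J_id.
Qed.

Lemma sym_auts_subgroup : subgroup_set (sym_auts i (iso_classes F P)).
Proof.
apply: subgroup_setP => [|a b /sym_autsP[t [t' ta]] /sym_autsP[u [u' ub]]|
    a /sym_autsP[t [t' ta]]]; apply/sym_autsP.
- by exists id, id; exact: sym_spec1.
- by do 2 eexists; exact: sym_specM ta ub.
- by exists t', t; exact: sym_specV.
Qed.

Lemma sym_spec_norm t t' (a b : Aut G) l x : sym_spec t t' b ->
  (forall y, sg_set (F (t l)) y -> sg_set (F (t l)) (a y)) ->
  sg_set (F l) x -> sg_set (F l) ((a ^ b) x).
Proof.
move=> tb ha lx; rewrite autJ; case: (tb) => [[tK _] _ _ _ _].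
rewrite -{1}(tK l); apply: sym_spec_in (sym_specV tb) _.
by apply: ha; exact: sym_spec_in tb lx.
Qed.

Lemma factor_auts_sym a b : factor_auts F P a -> sym_auts i (iso_classes F P) b ->
  factor_auts F P (a ^ b).
Proof.
move=> /factor_autsP[aP aN] /sym_autsP[t [t' tb]]; apply/factor_autsP.
split=> l Pl x lx.
  have Ptl : P (t l) by apply/(sym_spec_P l tb).
  split; first by apply: sym_spec_norm tb _ lx => y ly; case: (aP _ Ptl _ ly).
  rewrite autV1 -conjVg; apply: sym_spec_norm tb _ lx => y ly.
  by case: (aP _ Ptl _ ly).
case: (tb) => _ _ _ _ bN.
by rewrite autJ (bN l) // (aN l) // autV_fix // (bN l).
Qed.

(** If [F l] were moved to another factor, the l-th coordinate would vanish on its image. The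
    trivial intersections with the symmetric groups are proved this way. *)
Lemma sym_auts_eq1 a : sym_auts i (iso_classes F P) a ->
  (forall l, P l -> exists2 x, sg_set (F l) x & coord GF l (a x) <> 1) -> a = 1.
Proof.
move=> /sym_autsP[t [t' ta]] h; apply: autP.
have tid l : P l -> t l = l.
  move=> Pl; have [x lx nx] := h l Pl; apply: contrapT => ntl; apply: nx.
  by apply: coord_ne ntl _; exact: sym_spec_in ta lx.
case: ta => _ _ _ aP aN.
apply: (eq_dprod GF (g := id)) => //; first exact: aut_morph.
move=> l x lx; have [Pl|nPl] := pselect (P l); last exact: aN lx.
by rewrite (aP l) // tid // J_id.
Qed.

Lemma sym_spec_ex t t' : cancel t t' -> cancel t' t ->
  (forall l, P l -> ism l (t l)) -> (forall l, ~ P l -> t l = l) ->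
  exists a, sym_spec t t' a.
Proof.
move=> tK t'K tP tN.
pose j l x := if pselect (P l) then J (t l) l x else x.
have jP l x : P l -> j l x = J (t l) l x by rewrite /j; case: pselect.
have jN l x : ~ P l -> j l x = x by rewrite /j; case: pselect.
have back l x : P l -> sg_set (F l) x -> J l (t l) (J (t l) l x) = x.
  by move=> Pl lx; rewrite J_J ?J_id //; [exact: tP|exact/ism_sym/tP].
have [||||||a aE] := @dprod_aut _ _ _ GF t j.
- exact: can_inj tK.
- by move=> k; exists (t' k).
- move=> l x y lx ly; have [Pl|nPl] := pselect (P l); last by rewrite !jN.
  by rewrite !jP // J_M //; exact: tP.
- move=> l x lx; have [Pl|nPl] := pselect (P l); last by rewrite jN // tN.
  by rewrite jP //; exact: transport_in.
- move=> l x lx; have [Pl|nPl] := pselect (P l); last by rewrite jN.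
  move=> jx1; rewrite -(back l x) // -jP // jx1.
  have J1 : sg_set (F (t l)) 1 by exact: sg1.
  apply: (@mulgI _ (J l (t l) 1)); rewrite mulg1 -J_M ?mulg1 //.
  exact/ism_sym/tP.
- move=> l y; have [Pl|nPl] := pselect (P l); last first.
    by rewrite tN // => ly; exists y; rewrite ?jN.
  move=> ly; exists (J l (t l) y); first exact: transport_in.
  rewrite jP // J_J ?J_id //; last exact: tP.
    by have [] := tP _ Pl.
  exact/ism_sym/tP.
exists a; split=> // l x Pl lx; first by rewrite (aE l) // jP.
by rewrite (aE l) // jN.
Qed.

End SymAuts.

Section Core.
Variables (G : groupType) (Lam : Type) (F : Lam -> subgroup G) (P : set Lam).
Hypothesis GF : is_dprod F.
Local Notation coord := (coord GF).

(** The form of (C1) that also holds for centerless Coxeter components. The factor found must again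
    lie in P, since the resulting map on indices has to permute P. *)
Hypothesis onto_P : forall l (f : G -> G), P l -> {morph f : x y / x * y} ->
  (forall x, sg_set (F l) (f x)) ->
  (forall y, sg_set (F l) y -> exists x, f x = y) ->
  exists2 k, P k & forall y, sg_set (F l) y -> exists2 x, sg_set (F k) x & f x = y.
Hypothesis nonabelian_P : forall l, P l ->
  ~ (forall x y, sg_set (F l) x -> sg_set (F l) y -> commute x y).
Hypothesis kill_center_P : forall l (c : G -> G), P l ->
  (forall x y, sg_set (F l) x -> sg_set (F l) y -> c (x * y) = c x * c y) ->
  (forall x, sg_set (F l) x -> sg_set (F l) (c x) /\ center (c x)) ->
  forall z, sg_set (F l) z -> center z -> c z = 1.

Lemma center_coord_center l x : center x -> center (coord l x).
Proof.
move=> /(center_coord GF) cx; apply/(center_factor GF (coord_in GF l x)) => y.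
exact: cx.
Qed.

Let onto (a : Aut G) k l := [/\ P k, P l,
  forall y, sg_set (F l) y -> exists2 x, sg_set (F k) x & coord l (a x) = y &
  forall m x, m <> k -> sg_set (F m) x -> center (coord l (a x))].

Let coord_autM (a : Aut G) l : {morph (fun x => coord l (a x)) : x y / x * y}.
Proof. by move=> x y; rewrite aut_morph coordM. Qed.

Let onto_ex a l : P l -> exists k, onto a k l.
Proof.
move=> Pl.
have [||k Pk kl] := onto_P Pl (@coord_autM a l).
- by move=> x; exact: coord_in.
- by move=> y ly; exists (aut_inv a y); rewrite aut_invK coord_id.
exists k; split=> // m x nmk mx.
(* [F m] commutes with [F k], whose image is all of [F l]. *)
apply/(center_factor GF (coord_in GF l (a x))) => _ /kl[y ky <-].
rewrite /commute -!coordM -!aut_morph; congr (coord l (a _)).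
exact: dprod_comm nmk mx ky.
Qed.

Let onto_uniq a k k' l : onto a k l -> onto a k' l -> k = k'.
Proof.
move=> [Pk Pl kl _] [_ _ _ k'l]; apply: contrapT => nkk'.
apply: (nonabelian_P Pl) => _ y /kl[x kx <-] _.
exact: (k'l k x).
Qed.

Let center_off a k l x : onto a k l -> sg_set (subprod F (~` [set k])) x ->
  center (coord l (a x)).
Proof.
move=> [_ _ _ h].
apply: (subprod_ind (A := [set x | center (coord l (a x))])).
  by apply: (preim_subgroup (f := fun x => coord l (a x))) => //; exact: center_subgroup.
by move=> m {}x nmk; exact: h.
Qed.

(** The k-th coordinate of a^-1(a x), with a x cut into its l-th coordinate and the rest, like one
    entry of a product of two inverse matrices. *)
Let coordE a k l x : sg_set (F k) x ->
  x = coord k (aut_inv a (coord l (a x))) *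
      coord k (aut_inv a (restr GF (~` [set l]) (a x))).
Proof.
move=> kx; rewrite -coordM -(aut_invM a) -restr_split.
by rewrite /= aut_funK coord_id.
Qed.

(** Suppose a maps another factor onto [F n]. Then the n-th coordinate of a w is central for w in
    [F k], and a^-1 sends the rest of a w into the center at k; by [coordE] all of [F k] would be
    central. *)
Let onto_inv (a : Aut G) n k : onto (a^-1)%g n k -> onto a k n.
Proof.
move=> nk; have [Pn Pk _ _] := nk.
have [k' k'n] := onto_ex a Pn.
have [-> //|nkk'] := pselect (k = k').
case: (nonabelian_P Pk) => w w' kw _; move: w'; suff: center w by [].
rewrite (coordE a n kw); apply: (subgM (@center_subgroup G)).
  apply: center_coord_center; apply: (@aut_center _ (a^-1)%g).
  by case: k'n => _ _ _ /(_ k w nkk' kw).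
exact: (center_off nk (restr_in GF _)).
Qed.

(** For x in the kernel only the second term c x of [coordE] survives, so x = c x is central; but c
    kills central elements. *)
Let onto_inj (a : Aut G) k l x : onto a k l -> sg_set (F k) x ->
  coord l (a x) = 1 -> x = 1.
Proof.
move=> kl kx p1; have lk : onto (a^-1)%g l k by apply: onto_inv; rewrite invgK.
pose c x := coord k (aut_inv a (restr GF (~` [set l]) (a x))).
have cM : {morph c : x y / x * y}.
  by move=> y z; rewrite /c aut_morph restrM aut_invM coordM.
have cZ y : center (c y) by exact: (center_off lk (restr_in GF _)).
have [Pk _ _ _] := kl.
have ex : x = c x.
  by rewrite {1}(coordE a l kx) p1 (morph_mul1 (aut_invM a)) coord1 mul1g.
have cx : center x by rewrite ex; exact: cZ.
rewrite ex; apply: (kill_center_P Pk) => // y; split=> //; exact: coord_in.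
Qed.

Let onto_isog (a : Aut G) k l : onto a k l -> isog (grp (F k)) (grp (F l)).
Proof.
move=> kl.
pose f (x : grp (F k)) := mkg (coord_in GF l (a (gval x))).
have fM : {morph f : x y / x * y}.
  move=> x y; apply: gval_inj.
  by rewrite gvalM !gval_mkg gvalM coord_autM.
have fI : injective f.
  apply: morph_inj => // x /(congr1 (@gval _ _)); rewrite gval_mkg gval1 => p1.
  by apply: gval_inj; rewrite gval1; exact: onto_inj kl (gvalP x) p1.
have fS y : exists x, f x = y.
  have [_ _ /(_ _ (gvalP y))[x kx ex] _] := kl; have [x' ex'] := grpP kx.
  by exists x'; apply: gval_inj; rewrite gval_mkg ex'.
have [g gK] := choice fS.
by exists (mkmul fM), g => // x; apply: fI.
Qed.

(** Nothing is asked of the coordinates outside P. In part (i) they lie in abelian factors, so that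
    c becomes central; in part (ii) they make up [Wfin]. *)
Definition core_auts : set (Aut G) := [set c : Aut G | forall l, P l ->
  (forall x, sg_set (F l) x -> coord l (c x) = x) /\
  (forall m x, m <> l -> sg_set (F m) x -> center (coord l (c x)))].

Variable i : forall m l, grp (F l) -> grp (F m).
Hypothesis iP : iso_system P i.

Theorem aut_decomposition (a : Aut G) : exists c b s : Aut G,
  [/\ core_auts c, factor_auts F P b, sym_auts i (iso_classes F P) s &
      a = c * b * s].
Proof.
have sex l : exists k, P l -> onto a k l.
  have [/(onto_ex a)[k kl]|nPl] := pselect (P l); first by exists k.
  by exists l.
have s'ex k : exists n, P k -> onto (a^-1)%g n k.
  have [/(onto_ex (a^-1)%g)[n nk]|nPk] := pselect (P k); first by exists n.
  by exists k.
have [[s0 s0P] [s0' s0P']] := (choice sex, choice s'ex).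
(* The functions obtained by choice are arbitrary outside P; making them the identity there yields
   mutually inverse permutations of all indices. *)
pose s l := if pselect (P l) then s0 l else l.
pose s' l := if pselect (P l) then s0' l else l.
have sP l : P l -> onto a (s l) l by rewrite /s; case: pselect => // Pl _; exact: s0P.
have s'P k : P k -> onto (a^-1)%g (s' k) k.
  by rewrite /s'; case: pselect => // Pk _; exact: s0P'.
have sN l : ~ P l -> s l = l by rewrite /s; case: pselect.
have s'N l : ~ P l -> s' l = l by rewrite /s'; case: pselect.
have sK : cancel s s'.
  move=> l; have [Pl|nPl] := pselect (P l); last by rewrite sN // s'N.
  have := sP l Pl; rewrite -{1}[a]invgK => /onto_inv lsl.
  have Psl : P (s l) by have [] := sP l Pl.
  exact: onto_uniq (s'P _ Psl) lsl.
have s'K : cancel s' s.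
  move=> k; have [Pk|nPk] := pselect (P k); last by rewrite s'N // sN.
  have := onto_inv (s'P k Pk).
  have Psk : P (s' k) by have [] := s'P k Pk.
  exact: onto_uniq (sP _ Psk).
(* b carries [F (s l)] to [F l], so a composed with the inverse of b maps [F l] onto [F l] modulo
   the center. Below, [f l] is its diagonal part at l, and h collects these parts. *)
have [||||b sb] := sym_spec_ex GF iP (t := s') (t' := s) => //.
  move=> k Pk; have [Psk _ _ _] := s'P k Pk; split=> //.
  exact: onto_isog (onto_inv (s'P k Pk)).
have bin l x : sg_set (F l) x -> sg_set (F (s' l)) (b x) := sym_spec_in sb.
have bVin l x : sg_set (F l) x -> sg_set (F (s l)) (aut_inv b x) :=
  sym_spec_in (sym_specV iP sb).
pose f l x := coord l (a (aut_inv b x)).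
have fM l : {morph f l : x y / x * y} by move=> x y; rewrite /f aut_invM coord_autM.
have fS l y : P l -> sg_set (F l) y -> exists2 x, sg_set (F l) x & f l x = y.
  move=> Pl ly; have [_ _ /(_ y ly)[x sx ex] _] := sP l Pl.
  exists (b x); last by rewrite /f aut_funK.
  by have := bin _ _ sx; rewrite sK.
have f1 l x : P l -> sg_set (F l) x -> f l x = 1 -> x = 1.
  move=> Pl lx fx1; have sx := bVin l x lx.
  have e1 := onto_inj (sP l Pl) sx fx1.
  by rewrite -(aut_invK b x) e1 (morph_mul1 (@aut_morph _ b)).
pose j l x := if pselect (P l) then f l x else x.
have jP l x : P l -> j l x = f l x by rewrite /j; case: pselect.
have jN l x : ~ P l -> j l x = x by rewrite /j; case: pselect.
have [||||||h hE] := @dprod_aut _ _ _ GF id j.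
- exact: inj_id.
- by move=> k; exists k.
- move=> l x y _ _; have [Pl|nPl] := pselect (P l); last by rewrite !jN.
  by rewrite !jP // fM.
- move=> l x lx; have [Pl|nPl] := pselect (P l); last by rewrite jN.
  by rewrite jP //; exact: coord_in.
- move=> l x lx; have [Pl|nPl] := pselect (P l); last by rewrite jN.
  by rewrite jP //; exact: f1.
- move=> l y ly; have [Pl|nPl] := pselect (P l); last by exists y; rewrite ?jN.
  by have [x lx ex] := fS l y Pl ly; exists x => //; rewrite jP.
have hin l x : sg_set (F l) x -> sg_set (F l) (aut_inv h x).
  move=> lx; have [Pl|nPl] := pselect (P l).
    have [y ly <-] := fS l x Pl lx.
    by rewrite -jP // -(hE l) // aut_funK.
  by suff -> : aut_inv h x = x by []; apply: autV_fix; rewrite (hE l) // jN.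
exists (a * b^-1 * h^-1), h, b; split.
- move=> l Pl; split=> [x lx|m x nml mx].
    by rewrite -{2}(aut_invK h x) (hE l) ?jP //; exact: hin.
  have [_ _ _ h4] := sP l Pl; apply: (h4 (s m)).
    by move=> /(can_inj sK).
  by apply: bVin; exact: hin.
- apply/factor_autsP; split=> l Pl x lx; last by rewrite (hE l) // jN.
  split; last exact: hin.
  by rewrite (hE l) // jP //; exact: coord_in.
- by apply/sym_autsP; exists s', s.
- by rewrite !mulgVK.
Qed.

End Core.

(** * Central automorphisms and the map flat *)

Definition central_auts (K : groupType) : set (Aut K) :=
  [set a : Aut K | forall w, center ((a w)^-1 * w)].

Section CentralAuts.
Variable K : groupType.
Implicit Types a b : Aut K.

Lemma center1 : @center K 1. Proof. exact: subg1 (@center_subgroup K). Qed.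

Lemma centerM (x y : K) : center x -> center y -> center (x * y).
Proof. exact: subgM (@center_subgroup K). Qed.

Lemma centerV (x : K) : center x -> center x^-1.
Proof. exact: subgV (@center_subgroup K). Qed.

Lemma central_HomZ a : central_auts a -> HomZ (fun w => (a w)^-1 * w).
Proof.
move=> ca; split=> // x y; rewrite aut_morph invgM -[LHS]mulgA.
by rewrite (mulgA (a x)^-1) (mulgA (a y)^-1) -(ca x) -mulgA.
Qed.

Lemma central_on_subgroup a : subgroup_set [set w | center ((a w)^-1 * w)].
Proof.
apply: subgroup_setP => [|x y cx cy|x cx] /=.
- by rewrite mulg1 morph_mul1; [exact/centerV/center1|exact: aut_morph].
- rewrite aut_morph invgM -mulgA (mulgA (a x)^-1) (mulgA (a y)^-1).
  by rewrite -(cx (a y)^-1) -mulgA; exact: centerM.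
- rewrite (morph_mulV (@aut_morph _ a)) invgK.
  suff -> : a x * x^-1 = ((a x)^-1 * x)^-1 by exact: centerV.
  apply: (@mulIg _ x); rewrite mulgVK -[X in _ = _ * X](mulVKg (a x) x) mulgA.
  by rewrite (centerV cx) mulgVK.
Qed.

Lemma central_autsV a : central_auts a -> central_auts a^-1.
Proof.
move=> ca w; have := centerV (ca (aut_inv a w)).
by rewrite aut_invK invgM invgK.
Qed.

Lemma central_auts_subgroup : subgroup_set (@central_auts K).
Proof.
apply: subgroup_setP => [w|a b ca cb w|a].
- by rewrite mulVg; exact: center1.
- have -> : ((a * b) w)^-1 * w = (a (b w))^-1 * b w * ((b w)^-1 * w).
    by rewrite !mulgA mulgK.
  exact: centerM.
- exact: central_autsV.
Qed.

Lemma central_autsJ a b : central_auts a -> central_auts (a ^ b).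
Proof.
move=> ca w; rewrite autJ -(autVK b w) -(morph_mulV (aut_morph _)) -(aut_morph _).
by apply: aut_center; rewrite autVK; exact: ca.
Qed.

Lemma flat_central (f : K -> K) a : HomZ f -> a =1 flat f -> forall w,
  (a w)^-1 * w = f w.
Proof. by move=> _ af w; rewrite af /flat invgM invgK mulgVK. Qed.

(** The map f is recovered from a as w |-> (a w)^-1 w. Its inverse in the monoid belongs to a^-1,
    because [flat] turns the monoid product into composition and is injective. *)
Lemma flat_units : flat_set (@HomZ_units K) = @central_auts K.
Proof.
apply/seteqP; split=> [a [f [Hf _] af] w|a ca].
  by rewrite (flat_central Hf af); case: Hf.
pose f w := (a w)^-1 * w; pose g w := ((a^-1)%g w)^-1 * w.
have Hf : HomZ f := central_HomZ ca.
have Hg : HomZ g := central_HomZ (central_autsV ca).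
have af : flat f =1 a by move=> w; rewrite /flat /f invgM invgK mulVKg.
have ag : flat g =1 (a^-1)%g by move=> w; rewrite /flat /g invgM invgK mulVKg.
have flat1 h h' : HomZ h -> HomZ h' -> flat h \o flat h' =1 id ->
    homz_mul h h' = fun=> 1.
  move=> Hh Hh' e; apply/funext => w.
  have fw : w * (homz_mul h h' w)^-1 = w by have := flat_mul Hh Hh' w; rewrite e.
  by apply: invg_inj; apply: (@mulgI _ w); rewrite fw invg1 mulg1.
exists f; last by move=> w; rewrite af.
split=> //; exists g; split=> //; apply: flat1 => // w /=; rewrite af ag.
  exact: autKV.
exact: autVK.
Qed.

(** When f kills its own values, the correction term of [homz_mul] disappears between f and its
    pointwise inverse, which is thus the inverse in the monoid. *)
Lemma HomZ_units_sq1 (f : K -> K) : HomZ f -> (forall x, f (f x) = 1) ->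
  HomZ_units f.
Proof.
move=> Hf ff; have [fM fZ] := Hf; have fV := morph_mulV fM.
split=> //; exists (fun x => (f x)^-1); split.
- split=> [x y|x]; last exact: centerV.
  by rewrite fM invgM -(centerV (fZ x)).
- by apply/funext => x; rewrite /homz_mul fV ff invgK mulg1 mulgV.
- by apply/funext => x; rewrite /homz_mul ff invgK mulg1 mulVg.
Qed.

End CentralAuts.

(** On the group Z of prime order p, c is z |-> z^k. Being nontrivial there, it has k prime to p,
    and j is an inverse of k modulo p. *)
Lemma cyclic_prime_retract (K : groupType) (Z : set K) (c : K -> K) z0 :
  cyclic_prime Z -> {morph c : x y / x * y} -> (forall x, Z (c x)) ->
  Z z0 -> c z0 <> 1 -> exists j, forall z, Z z -> c z ^+ j = z.
Proof.
move=> [z [p [pp ZE Zp]]] cM cZ Zz0 cz0.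
have finZ : finite_set Z by exists p.
have Zz n : Z (z ^+ n).
  rewrite ZE; elim: n => [|n IH]; first exact: sg1.
  by rewrite expgS; apply: (@sgM _ (gen [set z])) => //; exact: gen_sub.
have [n n0 zn] : exists2 n, 0 < n & z ^+ n = 1.
  apply: contrapT => h; apply: infinite_nat.
  have -> : [set: nat] = (fun n => z ^+ n) @^-1` Z.
    by apply/seteqP; split=> n // _; exact: Zz.
  apply: finite_preimage finZ => a b _ _; wlog ab : a b / a <= b.
    by case/orP: (leq_total a b) => ? H ?; [apply: H | apply/esym/H].
  move=> eab; apply: contrapT => nab; apply: h; exists (b - a).
    by rewrite subn_gt0 ltn_neqAle ab andbT; apply/eqP.
  by rewrite expgnFr // eab mulgV.
pose n0z n := (0 < n) && (z ^+ n == 1).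
have ex_n : exists n, n0z n by exists n; rewrite /n0z n0 zn eqxx.
case: (ex_minnP ex_n) => q /andP[q0 /eqP zq] qmin {n n0 zn ex_n}.
have zmod k : z ^+ k = z ^+ (k %% q).
  by rewrite {1}(divn_eq k q) expgnDr mulnC expgnA zq expg1n mul1g.
have ZP x : Z x -> exists2 k, k < q & x = z ^+ k.
  rewrite ZE; apply: (@gen_min _ _ [set x | exists2 k, k < q & x = z ^+ k]).
    apply: subgroup_setP.
    - by exists 0.
    - move=> _ _ [k _ ->] [l _ ->]; exists ((k + l) %% q); first by rewrite ltn_mod.
      by rewrite -zmod expgnDr.
    - move=> _ [k kq ->]; exists ((q - k) %% q); first by rewrite ltn_mod.
      by rewrite -zmod; apply: mulg1_eq; rewrite -expgnDr subnKC ?zq // ltnW.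
  by move=> _ ->; exists (1 %% q); [rewrite ltn_mod|rewrite -zmod].
have qp : q = p.
  apply/(@card_eq_II q p)/(card_eq_trans _ Zp).
  have -> : Z = (fun k => z ^+ k) @` `I_q.
    by apply/seteqP; split=> [x /ZP[k kq ->]|_ [k _ <-]]; [exists k|exact: Zz].
  rewrite card_eq_sym; apply: inj_card_eq => k l; rewrite !inE /=.
  move=> kq lq; wlog kl : k l kq lq / k <= l.
    by case/orP: (leq_total k l) => ? H ?; [exact: H | exact/esym/H].
  move=> ekl; apply/eqP; rewrite eqn_leq kl /=; case: leqP => // nkl.
  have /qmin : n0z (l - k).
    by rewrite /n0z subn_gt0 nkl expgnFr // ekl mulgV eqxx.
  by rewrite leqNgt (leq_ltn_trans (leq_subr _ _) lq).
rewrite {}qp in q0 zq qmin zmod ZP *.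
have [k kp czE] := ZP _ (cZ z).
have cX n : c (z ^+ n) = (z ^+ n) ^+ k.
  rewrite expgnAC -czE; elim: n => [|n IH]; first exact: morph_mul1.
  by rewrite !expgS cM IH.
have k0 : 0 < k.
  rewrite lt0n; apply/eqP => k0; apply: cz0.
  by have [n _ ->] := ZP _ Zz0; rewrite cX k0.
have /(coprimeP _ k0)[u uE] : coprime k p.
  by rewrite coprime_sym prime_coprime // gtnNdvd.
exists u.1 => x /ZP[n _ ->]; rewrite cX -!expgnA (mulnC k).
have -> : (u.1 * k = 1 + u.2 * p)%N.
  by rewrite -uE subnK // ltnW // -subn_gt0 uE.
by rewrite mulnDr muln1 mulnA expgnDr mulnC expgnA zq expg1n mulg1.
Qed.

(* If c were nontrivial on the center Z, some power d of c would be a retraction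
   onto Z, and (x, y) |-> x d(x)^-1 c(y) would be onto although it maps neither
   factor onto F l. *)
Lemma C1_kill_center (Lam : Type) (F : Lam -> groupType) l (c : F l -> F l) :
  cond_C1 F -> cond_C2 F -> ~ (forall x y : F l, commute x y) ->
  {morph c : x y / x * y} -> (forall x, center (c x)) ->
  forall z, center z -> c z = 1.
Proof.
move=> C1 C2 nab cM cZ z0 Zz0; apply: contrapT => cz0.
case: (C2 l) => [Z1|Zp].
  by apply: cz0; have : center z0 by []; rewrite Z1 => ->; exact: morph_mul1.
have [j cj] := cyclic_prime_retract Zp cM cZ Zz0 cz0.
pose d x := c x ^+ j.
have dM : {morph d : x y / x * y} by move=> x y; rewrite /d cM expgMn //; exact: cZ.
have dZ x : center (d x).
  by rewrite /d; elim: (j) => [|n IH]; [exact: center1|rewrite expgS; exact: centerM].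
have dV := morph_mulV dM.
pose K : groupType := (F l * F l)%type.
have sK (b : bool) : subgroup_set [set p : K | (if b then p.2 else p.1) = 1].
  apply: (eq_subgroup (f := fun p : K => if b then p.2 else p.1) (g := fun=> 1)).
    by move=> p q; case: b.
  by move=> p q; rewrite mulg1.
pose Km b := Subgroup (sK b).
have cX x : c (x ^+ j) = c x ^+ j.
  by elim: (j) => [|n IH]; [exact: morph_mul1|rewrite !expgS cM IH].
pose g (p : K) := (d p.1)^-1 * c p.2.
have gZ p : center (g p) by apply: centerM => //; exact: centerV.
have gM : {morph g : p q / p * q}.
  move=> p q; rewrite /g dM cM invgM (centerV (dZ q.1)) -!mulgA; congr (_ * _).
  by rewrite (mulgA _ (c p.2)) (centerV (dZ q.1)) -mulgA.
pose f (p : K) := p.1 * g p.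
have fM : {morph f : p q / p * q}.
  move=> p q; rewrite /f gM; have -> : (p * q).1 = p.1 * q.1 by [].
  rewrite -[LHS]mulgA -[RHS]mulgA; congr (_ * _).
  by rewrite [LHS]mulgA -(gZ p) -[LHS]mulgA.
have pairE (p : K) : p = ((p.1, 1) : K) * ((1, p.2) : K).
  by case: p => x y; congr pair; rewrite /= ?mulg1 ?mul1g.
have Kdprod : is_dprod Km.
  split=> [b b' nbb' p q|| b].
  - case: p q => [p1 p2] [q1 q2]; case: b b' nbb' => [] [] //= _ -> ->.
      by congr pair; rewrite /= ?mulg1 ?mul1g.
    by congr pair; rewrite /= ?mulg1 ?mul1g.
  - apply/seteqP; split=> // p _; rewrite (pairE p).
    apply: (@sgM _ (subprod Km setT)).
      by apply: (@sub_subprod _ _ Km setT true).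
    by apply: (@sub_subprod _ _ Km setT false).
  - apply/seteqP; split=> [p [bp b'p]|_ ->]; last by split; exact: sg1.
    have {}b'p : sg_set (Km (~~ b)) p.
      apply: (subprod_ind _ _ b'p); first exact: sg_closed.
      move=> b' q /= nb; suff -> : ~~ b = b' by [].
      by clear -nb; case: b b' nb => [] [] // [].
    by move: bp b'p; case: p => p1 p2; case: (b) => /= -> ->.
have selM (b : bool) (p q : K) : (if b then (p * q).1 else (p * q).2) =
    (if b then p.1 else p.2) * (if b then q.1 else q.2) by case: b.
have selK (b : bool) (p : K) : (if b then p.2 else p.1) = 1 ->
    (if b then (if b then p.1 else p.2, 1) else (1, if b then p.1 else p.2)) = p.
  by case: b p => [] [p1 p2] /= ->.
have sel1 (b : bool) (x : F l) (p := (if b then (x, 1) else (1, x)) : K) :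
    (if b then p.2 else p.1) = 1 by case: b @p.
have Kisog b : isog (grp (Km b)) (F l).
  pose h (p : grp (Km b)) := if b then (gval p).1 else (gval p).2.
  have hM : {morph h : p q / p * q} by move=> p q; rewrite /h gvalM selM.
  pose h' x : K := if b then (x, 1) else (1, x).
  have h'b x : sg_set (Km b) (h' x) by exact: sel1.
  exists (mkmul hM), (fun x => mkg (h'b x)) => [p|x].
    by apply: gval_inj; rewrite gval_mkg; exact: selK (gvalP p).
  by rewrite /= /h gval_mkg /h'; case: (b).
(* The second coordinate makes c cancel d w: c((d w)^j) = c(d w)^j = d w, since d w is central. *)
have fS : range f = setT.
  apply/seteqP; split=> // w _; exists (w, d w ^+ j) => //.
  suff e : c (d w ^+ j) = d w by rewrite /f /g /= e mulVg mulg1.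
  by rewrite cX cj.
(* The first factor has as image the elements x d(x)^-1, which c kills, unlike z0. The image of the
   second consists of values of c, which are central. *)
have [[] fb] := C1 bool K Km Kdprod (fun b => ex_intro _ l (Kisog b)) l (mkmul fM) fS.
- apply: cz0; have : [set: F l] z0 by [].
  rewrite -fb => -[[x y] /= y1 <-]; rewrite /f /g /= y1 morph_mul1 // mulg1.
  rewrite cM morph_mulV // -[X in X * _](cj (c x)) // cX mulgV //.
- apply: nab => x y; have : [set: F l] x by [].
  rewrite -fb => -[[x1 x2] /= x11 <-]; rewrite /f /g /= x11 morph_mul1 // invg1.
  by rewrite !mul1g; exact: cZ.
Qed.

(** * Automorphisms of products satisfying (C1) and (C2) *)

Section AutDprod.
Variables (G : groupType) (Lam : Type) (F : Lam -> subgroup G).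
Hypothesis GF : is_dprod F.

Lemma LamZP l : LamZ F l <->
  forall x y, sg_set (F l) x -> sg_set (F l) y -> commute x y.
Proof.
split=> [lZ x y /grpP[x' <-] ly|h].
  have : [set: grp (F l)] x' by [].
  by rewrite -lZ => /(@center_grpP _ _ x') ; exact.
apply/seteqP; split=> // x _; apply/center_grpP => y ly.
exact: h (gvalP x) ly.
Qed.

Hypothesis C1 : cond_C1 (fun l => grp (F l) : groupType).
Hypothesis C2 : cond_C2 (fun l => grp (F l) : groupType).
Local Notation P := (LamNZ F).
Local Notation coord := (coord GF).

Let nab l : P l ->
  ~ (forall x y, sg_set (F l) x -> sg_set (F l) y -> commute x y).
Proof. by move=> Pl h; apply: Pl; apply/LamZP. Qed.

Let onto_P l (f : G -> G) : P l -> {morph f : x y / x * y} ->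
  (forall x, sg_set (F l) (f x)) ->
  (forall y, sg_set (F l) y -> exists x, f x = y) ->
  exists2 k, P k & forall y, sg_set (F l) y -> exists2 x, sg_set (F k) x & f x = y.
Proof.
move=> Pl fM fl fS; pose f' x := mkg (fl x).
have f'M : {morph f' : x y / x * y}.
  by move=> x y; apply: gval_inj; rewrite gvalM !gval_mkg fM.
have [|k kl] := C1 GF (fun k => ex_intro _ k (isog_refl _)) (f := mkmul f'M).
  apply/seteqP; split=> // y _; have [x ex] := fS _ (gvalP y).
  by exists x => //; apply: gval_inj; rewrite gval_mkg.
have {}kl y : sg_set (F l) y -> exists2 x, sg_set (F k) x & f x = y.
  move=> /grpP[y' <-]; have : [set: grp (F l)] y' by [].
  by rewrite -kl => -[x kx <-]; exists x.
exists k => // kZ; apply: (nab Pl) => _ _ /kl[x kx <-] /kl[y ky <-].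
by rewrite /commute -!fM; congr f; move/LamZP: kZ; apply.
Qed.

Let kill_center l (c : G -> G) : P l ->
  (forall x y, sg_set (F l) x -> sg_set (F l) y -> c (x * y) = c x * c y) ->
  (forall x, sg_set (F l) x -> sg_set (F l) (c x) /\ center (c x)) ->
  forall z, sg_set (F l) z -> center z -> c z = 1.
Proof.
move=> Pl cM cZ z /grpP[z' <-] zZ.
pose c' (x : grp (F l)) := mkg (proj1 (cZ _ (gvalP x))).
suff : c' z' = 1 by move/(congr1 (@gval _ _)); rewrite gval_mkg gval1.
apply: (C1_kill_center C1 C2) => [h|x y|x|].
- apply: (nab Pl) => _ _ /grpP[x <-] /grpP[y <-].
  by rewrite /commute -!gvalM h.
- by apply: gval_inj; rewrite gvalM !gval_mkg gvalM cM //; exact: gvalP.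
- by apply/center_grpP => y _; rewrite gval_mkg; case: (cZ _ (gvalP x)) => _; exact.
- by apply/center_grpP => y _; exact: zZ.
Qed.

(** On a nonabelian factor f is a homomorphism into the center of that factor, so [kill_center]
    applies; on the abelian factors f vanishes already. *)
Lemma HomZo_sq1 (f : G -> G) x : HomZo F f -> f (f x) = 1.
Proof.
move=> [[fM fZ] f1 fP]; apply: (eq_dprod GF (f := f \o f) (g := fun=> 1)).
- by move=> y z; rewrite /= !fM.
- by move=> y z; rewrite mulg1.
move=> l {}x lx /=; have [Pl|nPl] := pselect (P l); last first.
  rewrite (f1 x) ?morph_mul1 //; apply: sub_subprod lx.
  exact: contrapT.
have fl y : sg_set (F l) y -> sg_set (F l) (f y).
  by move=> /grpP[y' <-]; have [w _ ->] := fP l Pl y'; exact: gvalP.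
apply: (@kill_center l f) => //; last exact: fl.
by move=> y ly; split=> //; exact: fl.
Qed.

Variable idG : forall m l, grp (F l) -> grp (F m).
Hypothesis idGP : iso_system P idG.

Let H1 := @central_auts G.
Let H2 := factor_auts F P.
Let H3 := sym_auts idG (iso_classes F P).

Let H123 (a : Aut G) : exists h1 h2 h3, [/\ H1 h1, H2 h2, H3 h3 & a = h1 * h2 * h3].
Proof.
have [c [b [s [cP bP sP ->]]]] := aut_decomposition GF onto_P nab kill_center idGP a.
exists c, b, s; split=> // w.
apply: (dprod_ind GF (A := [set w | center ((c w)^-1 * w)])) => [|l {}w lw].
  exact: central_on_subgroup.
apply/(center_coord GF) => k y ky.
have [Pk|nPk] := pselect (P k); last first.
  have /LamZP : LamZ F k by exact: contrapT.
  by apply=> //; exact: coord_in.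
have [ck1 ck2] := cP k Pk; rewrite coordM coordV.
have [e|n] := pselect (l = k).
  rewrite -e in ck1 ky *; rewrite ck1 // coord_id // mulVg.
  exact/commute_sym/commute1.
rewrite (coord_ne GF n lw) mulg1; move: (y); apply: centerV; exact: (ck2 l).
Qed.

Let H1s : subgroup_set H1. Proof. exact: central_auts_subgroup. Qed.
Let H2s : subgroup_set H2. Proof. exact: factor_auts_subgroup. Qed.
Let H3s : subgroup_set H3. Proof. exact: sym_auts_subgroup. Qed.

(** If the l-th coordinate of c b vanished on [F l], so would that of c, since b preserves [F l]. As
    (c x)^-1 x is central, every x in [F l] would be central. *)
Let H12_H3 a : setmul H1 H2 a -> H3 a -> a = 1.
Proof.
move=> [c cH [b bH <-]] cbH; apply: (sym_auts_eq1 (GF := GF) idGP cbH) => l Pl.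
apply: contrapT => h; apply: (nab Pl) => x y lx ly.
pose x' := aut_inv b x.
have lx' : sg_set (F l) x' by move/factor_autsP: bH => [/(_ l Pl x lx)[]].
have cx1 : coord l (c x) = 1.
  apply: contrapT => n1; apply: h; exists x' => //.
  by rewrite autM aut_invK.
have /(@center_coord_center _ _ _ GF l) := cH x.
rewrite coordM coordV cx1 invg1 mul1g coord_id // => cx.
Qed.

Theorem aut_dprod :
  [/\ is_semidirect [set: Aut G] (setmul H1 H2) H3,
      normal_in H1 [set: Aut G],
      normal_in H2 (setmul H2 H3),
      HomZo F `<=` @HomZ_units G &
      H1 `&` H2 = flat_set (HomZo F)].
Proof.
have H1n a b : H1 a -> H1 (a ^ b) by exact: central_autsJ.
have H2n a b : H2 a -> H3 b -> H2 (a ^ b) by exact: factor_auts_sym.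
have H12s : subgroup_set (setmul H1 H2) by apply: setmul_subgroup => // a b /H1n.
have setTs : subgroup_set [set: Aut G] by [].
(* With b = h1 h2 h3, the product h1 h2 lies in H1 H2 itself, and h3 normalises H1 and H2
   separately. *)
have H12n a b : setmul H1 H2 a -> setmul H1 H2 (a ^ b).
  have [h1 [h2 [h3 [h1P h2P h3P ->]]]] := H123 b.
  have H12J x y : setmul H1 H2 x -> setmul H1 H2 y -> setmul H1 H2 (x ^ y).
    by move=> hx hy; apply: subgM => //; [exact: subgV|exact: subgM].
  move=> ha; rewrite conjgM; have : setmul H1 H2 (a ^ (h1 * h2)).
    by apply: H12J => //; exists h1 => //; exists h2.
  move=> [u uP [v vP <-]]; rewrite conjMg.
  by exists (u ^ h3); [exact: H1n|exists (v ^ h3) => //; exact: H2n].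
split.
- split=> //.
  + by split=> // n a nH _; exact: H12n.
  + exact: setI1P.
  + apply/seteqP; split=> // a _.
    have [h1 [h2 [h3 [h1P h2P h3P ->]]]] := H123 a.
    by exists (h1 * h2); [exists h1 => //; exists h2|exists h3].
- by split=> // n a /H1n.
- exact: setmul_normal.
- move=> f fo; apply: HomZ_units_sq1; first by case: fo.
  by move=> x; exact: HomZo_sq1.
- apply/seteqP; split=> [a [ca /factor_autsP[aP aN]]|a [f fo af]].
    exists (fun w => (a w)^-1 * w); last first.
      by move=> w; rewrite /flat invgM invgK mulVKg.
    have [fM fZ] := central_HomZ ca.
    split=> [|x|l Pl x]; first exact: central_HomZ.
      apply: (subprod_ind (A := [set x | (a x)^-1 * x = 1])).
        apply: (eq_subgroup (f := fun x => (a x)^-1 * x) (g := fun=> 1)) => // y z.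
        by rewrite mulg1.
      by move=> l y lZ ly /=; rewrite (aN l) ?mulVg.
    have lz : sg_set (F l) ((a (gval x))^-1 * gval x).
      apply: sgM; last exact: gvalP.
      by apply: sgV; have [] := aP l Pl _ (gvalP x).
    by exists (mkg lz) => //; apply/center_grpP => y _; exact: fZ.
  have fu : HomZ_units f.
    by apply: HomZ_units_sq1; [case: fo|move=> x; exact: HomZo_sq1].
  split; first by rewrite /H1 -flat_units; exists f.
  have [[fM fZ] f1 fP] := fo; apply/factor_autsP; split=> l Pl x lx; last first.
    rewrite af /flat f1 ?invg1 ?mulg1 //; apply: sub_subprod lx; exact: contrapT.
  have lfx : sg_set (F l) (f x).
    by have [x' <-] := grpP lx; have [w _ ->] := fP l Pl x'; exact: gvalP.
  split; first by rewrite af; apply: sgM => //; exact: sgV.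
  (* As f kills its values, w |-> w f(w) is inverse to w |-> w f(w)^-1. *)
  suff -> : aut_inv a x = x * f x by exact: sgM.
  apply: (@aut_inj _ a); rewrite aut_invK af /flat fM HomZo_sq1 // mulg1.
  by rewrite mulgK.
Qed.

End AutDprod.

Delimit Scope R_scope with coqR.

(** * The Tits representation *)

Section Dihedral.
Local Open Scope R_scope.
Variable c : R.

(* [cheb n] is sin(n t)/sin t for c = 2 cos t. *)
Definition cheb_pair n : R * R := iter n (fun p => (p.2, c * p.2 - p.1)) (0, 1).
Definition cheb n : R := (cheb_pair n).1.

Lemma cheb0 : cheb 0 = 0. Proof. by []. Qed.
Lemma cheb1 : cheb 1 = 1. Proof. by []. Qed.
Lemma chebS n : cheb n.+2 = c * cheb n.+1 - cheb n. Proof. by []. Qed.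

(** The roots in a dihedral plane have consecutive values of [cheb] as coefficients; this says that
    they have the norm of a simple root. *)
Lemma cheb_norm n :
  cheb n.+1 * cheb n.+1 - c * cheb n * cheb n.+1 + cheb n * cheb n = 1.
Proof.
elim: n => [|n IH]; first by rewrite cheb0 cheb1; ring.
by rewrite -[RHS]IH chebS; ring.
Qed.

Lemma cheb_sin t n : c = 2 * cos t -> cheb n * sin t = sin (INR n * t).
Proof.
move=> ct; suff : cheb n * sin t = sin (INR n * t) /\
  cheb n.+1 * sin t = sin (INR n.+1 * t) by case.
elim: n => [|n [IH1 IH2]].
  by rewrite cheb0 cheb1 /= !Rmult_0_l sin_0 !Rmult_1_l.
split=> //; rewrite chebS Rmult_minus_distr_r Rmult_assoc IH1 IH2 ct.
have -> : INR n * t = INR n.+1 * t - t by rewrite S_INR; ring.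
have -> : INR n.+2 * t = INR n.+1 * t + t by rewrite (S_INR n.+1); ring.
by rewrite sin_plus sin_minus; ring.
Qed.

End Dihedral.

Section Geometry.
Local Open Scope R_scope.
Variables (S : Type) (m : S -> S -> option nat).
Hypothesis mP : coxeter_matrix m.

(** Minus twice the usual Tits form, so that roots have norm 2 (on the diagonal m = 1 gives 2
    cos(PI) = -2). The infinite label gets the limit value 2. *)
Definition cox_cos s t : R := if m s t is Some k then 2 * cos (PI / INR k) else 2.

Lemma cox_cosC s t : cox_cos s t = cox_cos t s.
Proof. by case: mP => mC _ _; rewrite /cox_cos mC. Qed.

Lemma cox_cos_id s : cox_cos s s = -2.
Proof.
case: mP => _ /(_ s s)[_ m1] _; rewrite /cox_cos m1 //= /Rdiv Rinv_1 Rmult_1_r cos_PI.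
ring.
Qed.

Lemma cox_mP s t k : s <> t -> m s t = Some k -> (1 < k)%N.
Proof.
case: mP => _ m1 m0 nst mk; case: k mk => [|[|//]] mk; first by case: (m0 s t).
by case: nst; apply/m1.
Qed.

Lemma INR_gt0 k : (0 < k)%N -> 0 < INR k.
Proof. by move=> /ltP; exact: lt_0_INR. Qed.

Let angle k : (1 < k)%N -> 0 < PI / INR k < PI.
Proof.
move=> k1; have k0 := INR_gt0 (ltnW k1); have p0 := PI_RGT_0.
split; first exact: Rdiv_lt_0_compat.
apply: (Rmult_lt_reg_r (INR k)) => //.
rewrite /Rdiv Rmult_assoc Rinv_l; last lra.
have : 1 < INR k by rewrite -[1]/(INR 1); apply: lt_INR; apply/ltP.
by nra.
Qed.

Lemma cheb_eq0 s t k : s <> t -> m s t = Some k -> cheb (cox_cos s t) k = 0.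
Proof.
move=> nst mk; have k1 := cox_mP nst mk; have [a1 a2] := angle k1.
have k0 := INR_gt0 (ltnW k1).
have := cheb_sin k (erefl (2 * cos (PI / INR k))).
have -> : INR k * (PI / INR k) = PI by field; lra.
rewrite /cox_cos mk sin_PI => /Rmult_integral[//|s0].
by have := sin_gt_0 _ a1 a2; lra.
Qed.

Lemma cheb_ge0 s t n : s <> t -> (if m s t is Some k then (n <= k)%N else true) ->
  0 <= cheb (cox_cos s t) n.
Proof.
move=> nst; rewrite /cox_cos; case mk: (m s t) => [k|] nk; last first.
  suff [-> _] : cheb 2 n = INR n /\ cheb 2 n.+1 = INR n.+1 by exact: pos_INR.
  elim: n {nk} => [//|n [IH1 IH2]]; split=> //.
  by rewrite chebS IH1 IH2 !S_INR; ring.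
have k1 := cox_mP nst mk; have [a1 a2] := angle k1; have s0 := sin_gt_0 _ a1 a2.
have k0 := INR_gt0 (ltnW k1).
apply: (Rmult_le_reg_r (sin (PI / INR k))) => //.
rewrite Rmult_0_l (cheb_sin n (erefl _)).
have nk' : INR n <= INR k by apply: le_INR; apply/leP.
apply: sin_ge_0; first by apply: Rmult_le_pos; [exact: pos_INR|lra].
have {2}-> : PI = INR k * (PI / INR k) by field; lra.
by apply: Rmult_le_compat_r => //; lra.
Qed.

Lemma cox_cos_edge s t : cox_edge m s t -> 0 < cox_cos s t.
Proof.
rewrite /cox_edge /cox_cos; case: (m s t) => [k|] k3; last lra.
have k0 : 0 < INR k by apply: INR_gt0; exact: leq_trans k3.
have k2 : 2 < INR k.
  by apply: (@Rlt_le_trans _ (INR 3)); [rewrite /=; lra|apply: le_INR; apply/leP].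
have p0 := PI_RGT_0; have a0 : 0 < PI / INR k by exact: Rdiv_lt_0_compat.
apply: Rmult_lt_0_compat; first lra.
apply: cos_gt_0; first lra.
apply: (Rmult_lt_reg_r (INR k)) => //.
rewrite /Rdiv Rmult_assoc Rinv_l; last lra.
by nra.
Qed.

Lemma cox_cos_nonedge s t : s <> t -> ~ cox_edge m s t -> m s t = Some 2%N.
Proof.
move=> nst; rewrite /cox_edge; case mk: (m s t) => [k|] // /negP.
by have := cox_mP nst mk; case: k mk => [|[|[|k]]].
Qed.

Lemma cox_cos2 s t : m s t = Some 2%N -> cox_cos s t = 0.
Proof. by rewrite /cox_cos => -> /=; rewrite cos_PI2; ring. Qed.

(* Besides the coordinates given by the Tits form, the space carries a second set
   of coordinates [inr t] in which the simple roots [rvec s] are the standard basis, so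
   that they are linearly independent even if the Tits form is degenerate. *)
Definition rvec s (x : S + S) : R :=
  match x with inl t => - cox_cos s t | inr t => if pselect (s = t) then 1 else 0 end.

(** The coordinate [inl s] of a vector is its pairing with the root of s, so the reflection is
    written without a bilinear form on the space. *)
Definition refl s (f : S + S -> R) (x : S + S) : R := f x - f (inl s) * rvec s x.

Definition lin p (f : S + S -> R) q g (x : S + S) : R := p * f x + q * g x.

Lemma rvec_id s : rvec s (inl s) = 2. Proof. by rewrite /= cox_cos_id; ring. Qed.

Lemma rvecC s t : rvec s (inl t) = rvec t (inl s). Proof. by rewrite /= cox_cosC. Qed.

Lemma rvec_inr s : rvec s (inr s) = 1. Proof. by rewrite /=; case: pselect. Qed.

Lemma rvec_inr0 s t : s <> t -> rvec s (inr t) = 0.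
Proof. by rewrite /=; case: pselect. Qed.

Lemma refl_lin s p f q g : refl s (lin p f q g) = lin p (refl s f) q (refl s g).
Proof. by apply/funext => x; rewrite /refl /lin; ring. Qed.

Lemma refl_rvec s t : refl s (rvec t) = lin 1 (rvec t) (cox_cos t s) (rvec s).
Proof. by apply/funext => x; rewrite /refl /lin /=; ring. Qed.

Lemma refl_dihedral s t n f : s <> t ->
  let c := cox_cos s t in let p := cheb c n in let q := cheb c n.+1 in
  iter n (refl s \o refl t) f =
  fun x => f x - p * (q * f (inl t) + p * f (inl s)) * rvec s x
               - p * (p * f (inl t) + (c * p - q) * f (inl s)) * rvec t x.
Proof.
move=> nst c; elim: n => [|n IH] p q.
  by apply/funext => x; rewrite /p cheb0 /=; ring.
have st : rvec s (inl t) = - c by [].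
have ts : rvec t (inl s) = - c by rewrite rvecC.
have N := cheb_norm c n.
rewrite iterS IH /q chebS -/p; apply/funext => x; rewrite /refl /comp.
rewrite !rvec_id st ts.
move: (rvec s x) (rvec t x) (f x) (f (inl s)) (f (inl t)) => a b fx u v.
move: N; rewrite -/p; move: p (cheb c n) => p r N.
apply: Rminus_diag_uniq.
transitivity ((p * p - c * r * p + r * r - 1) * (v * b + (u + c * v) * a)); first ring.
by rewrite N; ring.
Qed.

Lemma refl_dihedral_id s t k f : m s t = Some k ->
  iter k (refl s \o refl t) f = f.
Proof.
move=> mk; have [est|nst] := pselect (s = t).
  have -> : k = 1%N.
    by case: mP => _ /(_ s t)[_ m1] _; have := m1 est; rewrite mk => -[].
  by apply/funext => x; rewrite est /= /comp /refl rvec_id; ring.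
rewrite refl_dihedral // (cheb_eq0 nst mk); apply/funext => x; ring.
Qed.

Fixpoint comb (l : seq (R * S)) (x : S + S) : R :=
  if l is p :: l' then p.1 * rvec p.2 x + comb l' x else 0.

Definition in_span (f : S + S -> R) := exists l, f = comb l.

Lemma in_span_rvec s : in_span (rvec s).
Proof. by exists [:: (1, s)]; apply/funext => x /=; ring. Qed.

Lemma in_span_refl s f : in_span f -> in_span (refl s f).
Proof.
move=> [l ->]; exists ((- comb l (inl s), s) :: l); apply/funext => x.
by rewrite /refl [RHS]/=; ring.
Qed.

Lemma in_span_lin p f q g : in_span f -> in_span g -> in_span (lin p f q g).
Proof.
move=> [l ->] [k ->].
have scale a (n : seq (R * S)) x : a * comb n x = comb [seq (a * p.1, p.2) | p <- n] x.
  by elim: n => [|b n IH] /=; [ring|rewrite -IH; ring].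
have cat a b x : comb (a ++ b) x = comb a x + comb b x.
  by elim: a => [|d a IH] /=; [ring|rewrite IH; ring].
eexists; apply/funext => x; rewrite /lin !scale -cat; reflexivity.
Qed.

Lemma comb_split s (l : seq (R * S)) : exists (b : R) (l' : seq (R * S)),
  [/\ (size l' <= size l)%N, forall x, comb l x = b * rvec s x + comb l' x &
      comb l' (inr s) = 0].
Proof.
elim: l => [|[a t] l [b [l' [sl' e e0]]]] /=.
  by exists 0, [::]; split=> // x; rewrite /=; ring.
have [est|nst] := pselect (s = t).
  exists (a + b), l'; split=> [||//]; first exact: leqW.
  by move=> x; rewrite e -est; ring.
exists b, ((a, t) :: l'); split=> //= [x|]; first by rewrite e; ring.
by rewrite e0; case: pselect => [/esym //|_ /=]; ring.
Qed.

(** Linear independence of the simple roots: repeated roots are merged by [comb_split], and the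
    coordinate [inr s] returns the coefficient of [rvec s]. *)
Lemma in_span_eq0 f : in_span f -> (forall t, f (inr t) = 0) -> f = fun=> 0.
Proof.
move=> [l ->]; have [n] := ubnP (size l); elim: n l => // n IH [//|[a s] l] /= /ltnSE sn h.
have [b [l' [sl' e e0]]] := comb_split s l.
have ab : a + b = 0.
  by have := h s; rewrite e e0 /=; case: pselect => // _ /=; lra.
have e' x : a * rvec s x + comb l x = comb l' x.
  by rewrite e -[RHS]Rplus_0_l -(Rmult_0_l (rvec s x)) -ab; ring.
rewrite (funext e'); apply: IH => [|t]; first exact: leq_ltn_trans sn.
by rewrite -e'; exact: h.
Qed.

Lemma in_span_inr f s : in_span f -> (forall t, t <> s -> f (inr t) = 0) ->
  f = lin (f (inr s)) (rvec s) 0 (rvec s).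
Proof.
move=> sf h; set g := lin _ _ _ _.
have /in_span_eq0 h0 : in_span (lin 1 f (-1) g).
  by apply: in_span_lin => //; apply: in_span_lin; exact: in_span_rvec.
have {}h0 : lin 1 f (-1) g = fun=> 0.
  apply: h0 => t; rewrite /lin /g /lin; have [->|nts] := pselect (t = s).
    by rewrite rvec_inr; ring.
  by rewrite h // rvec_inr0; [ring|exact/nesym].
apply/funext => x; have := congr1 (fun u => u x) h0; rewrite /lin; lra.
Qed.

End Geometry.

(** * Length, the Tits representation and the signs of roots *)

Section CoxeterGroup.
Variables (S : Type) (m : S -> S -> option nat) (W : groupType) (e : S -> W).
Hypothesis WS : coxeter_system m e.

Let mP : coxeter_matrix m := proj1 WS.

Lemma cox_m1 s : m s s = Some 1%N.
Proof. by case: mP => _ /(_ s s)[_ m1] _; exact: m1. Qed.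

(** The universal property of the presentation, phrased for actions. It yields the Tits
    representation and, with T = W, homomorphisms into the center. The case s = t makes each [r s]
    an involution, so inverse letters may act by the same map. *)
Lemma cox_action (T : Type) (r : S -> T -> T) :
  (forall s t k, m s t = Some k -> forall x, iter k (r s \o r t) x = x) ->
  exists act : W -> T -> T, [/\ forall s, act (e s) =1 r s,
    forall x y, act (x * y) =1 act x \o act y & act 1 =1 id].
Proof.
move=> rP; have rr s x : r s (r s x) = x := rP s s 1%N (cox_m1 s) x.
pose aw (u : word S) x := foldr (fun p => r p.1) x u.
have aw_cat u v x : aw (u ++ v) x = aw u (aw v x) by rewrite /aw foldr_cat.
have awP u v : word_eqv (coxeter_relators m) u v -> aw u =1 aw v.
  elim=> {u v} [//|u v _ IH x|u v w _ IH1 _ IH2 x|u u' v v' _ IH1 _ IH2 x|s b x|].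
  - by rewrite IH.
  - by rewrite IH1.
  - by rewrite !aw_cat IH2 IH1.
  - by rewrite /= rr.
  move=> _ [s [t [k [mk ->]]]] x; rewrite -[RHS](rP s t k mk).
  by elim: k {mk} => //= k IH; rewrite IH.
have [_ [/choice[wd wdP] eqP]] := WS.
have awE u x : aw (wd (eval_word e u)) x = aw u x.
  by apply: awP; apply/eqP; rewrite wdP.
exists (fun w => aw (wd w)); split.
- by move=> s x; rewrite -[e s]mulg1 (awE [:: (s, false)]).
- by move=> x y z; rewrite /= -aw_cat; apply: awP; apply/eqP; rewrite wdP
    -{1}(wdP x) -{1}(wdP y); elim: (wd x) => [|p u IH] /=; rewrite ?mul1g // -mulgA IH.
- by move=> x; exact: (awE [::]).
Qed.

Lemma cox_sq s : e s * e s = 1.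
Proof.
have [_ [_ eqP]] := WS; have /eqP : word_eqv (coxeter_relators m)
   [:: (s, false); (s, false)] [::].
  by apply: we_relator; exists s, s, 1%N; rewrite cox_m1.
by rewrite /= mulg1.
Qed.

Lemma cox_inv s : (e s)^-1 = e s. Proof. exact: mulg1_eq (cox_sq s). Qed.

Lemma cox_sqK s x : x * e s * e s = x. Proof. by rewrite -mulgA cox_sq mulg1. Qed.

Lemma cox_rel s t k : m s t = Some k -> (e s * e t) ^+ k = 1.
Proof.
move=> mk; have [_ [_ eqP]] := WS; have /eqP : word_eqv (coxeter_relators m)
    (flatten (nseq k [:: (s, false); (t, false)])) [::].
  by apply: we_relator; exists s, t, k.
move=> /= <-; elim: k {mk} => //= k IH; rewrite expgS IH mulgA //.
Qed.

Definition prods (u : seq S) : W := foldr (fun s => mul (e s)) 1 u.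

Lemma prods_cat u v : prods (u ++ v) = prods u * prods v.
Proof. by elim: u => /= [|s u ->]; rewrite ?mul1g ?mulgA. Qed.

Lemma prods_onto w : exists u, prods u = w.
Proof.
have [_ [ev _]] := WS; have [u <-] := ev w.
elim: u => [|[s b] u [v ev']]; first by exists [::].
by exists (s :: v); rewrite /= ev' cox_inv; case: b.
Qed.

Lemma cox_gen (A : set W) : subgroup_set A -> (forall s, A (e s)) -> forall w, A w.
Proof.
move=> sA Ae w; have [u <-] := prods_onto w.
by elim: u => [|s u IH] /=; [exact: subg1|exact: subgM].
Qed.

Let len_ex w : exists n, `[< exists2 u, size u = n & prods u = w >].
Proof. by have [u uw] := prods_onto w; exists (size u); apply/asboolP; exists u. Qed.

Definition len w := ex_minn (len_ex w).

Lemma len_prods w : exists2 u, size u = len w & prods u = w.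
Proof. by rewrite /len; case: ex_minnP => n /asboolP. Qed.

Lemma len_min u : len (prods u) <= size u.
Proof.
by rewrite /len; case: ex_minnP => n _; apply; apply/asboolP; exists u.
Qed.

Lemma lenM x y : len (x * y) <= len x + len y.
Proof.
have [[u su ux] [v sv vy]] := (len_prods x, len_prods y).
by rewrite -su -sv -ux -vy -prods_cat -size_cat; exact: len_min.
Qed.

Lemma len_gen s : len (e s) <= 1.
Proof. by have := len_min [:: s]; rewrite /= mulg1. Qed.

Lemma lenMe x s : len (x * e s) <= (len x).+1.
Proof. by apply: leq_trans (lenM _ _) _; rewrite -addn1 leq_add2l len_gen. Qed.

Lemma len_eq0 w : len w = 0%N -> w = 1.
Proof. by have [[|s u] //= <- <-] := len_prods w. Qed.

Lemma len_last w : 0 < len w -> exists s, len (w * e s) < len w.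
Proof.
have [u <- <-] := len_prods w; case/lastP: u => // u s _.
exists s; rewrite -cats1 prods_cat /= mulg1 cox_sqK size_cat addn1 ltnS.
exact: len_min.
Qed.

(* [alt s t k] is the alternating product of k letters s, t ending with t. *)
Fixpoint alt s t k : W := if k is k'.+1 then alt t s k' * e t else 1.

Lemma alt_cons s t k : alt s t k.+1 = e (if odd k then s else t) * alt s t k.
Proof.
elim: k s t => [|k IH] s t; first by rewrite /= mul1g mulg1.
by rewrite [LHS]/= -/(alt s t k) -/(alt t s k.+1) IH /= mulgA; case: (odd k).
Qed.

Lemma alt_len s t k : len (alt s t k) <= k.
Proof.
elim: k s t => [|k IH] s t; first exact: (len_min [::]).
by apply: leq_trans (lenMe _ _) _; rewrite ltnS.
Qed.

Lemma alt_split s t n k : exists2 z, len z <= n & alt s t (n + k) = z * alt s t k.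
Proof.
elim: n => [|n [z zn ez]]; first by exists 1; [exact: (len_min [::])|rewrite mul1g].
exists (e (if odd (n + k) then s else t) * z); last first.
  by rewrite addSn alt_cons ez mulgA.
by apply: leq_trans (lenM _ _) _; rewrite -add1n leq_add // len_gen.
Qed.

Lemma alt_double s t k : alt s t k.*2 = (e s * e t) ^+ k.
Proof. by elim: k => [//|k IH]; rewrite doubleS /= IH -mulgA expgSr. Qed.

Lemma braid s t k : m s t = Some k -> alt s t k = alt t s k.
Proof.
move=> mk; have mk' : m t s = Some k by case: mP => mC _ _; rewrite mC.
(* Starting from (x y)^k = 1, each step moves one letter to the other side, and i = k is the braid
   relation. The roles of x and y alternate, hence the quantification over both. *)
suff h i : i <= k -> forall x y, m x y = Some k -> alt x y (k.*2 - i) = alt y x i.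
  by have := h k (leqnn k) s t mk; rewrite -addnn addnK.
elim: i => [_ x y mxy|i IH ik x y mxy]; first by rewrite subn0 alt_double cox_rel.
have myx : m y x = Some k by case: mP => mC _ _; rewrite mC.
apply: (@mulIg _ (e x)); rewrite /= -/(alt x y i) cox_sqK -(IH (ltnW ik) _ _ myx).
have -> // : k.*2 - i = (k.*2 - i.+1).+1.
by rewrite subnSK // -addnn (leq_trans ik) // leq_addr.
Qed.

Local Notation R := Rdefinitions.R.
Local Notation V := (S + S -> R).

Lemma tits_ex : exists act : W -> V -> V, [/\ forall s, act (e s) =1 refl m s,
    forall x y, act (x * y) =1 act x \o act y & act 1 =1 id].
Proof. by apply: cox_action => s t k mk f; exact: refl_dihedral_id. Qed.

Definition act : W -> V -> V := projT1 (cid tits_ex).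

Lemma act_gen s f : act (e s) f = refl m s f.
Proof. by rewrite /act; case: cid => a [h _ _] /=; exact: h. Qed.

Lemma actM x y f : act (x * y) f = act x (act y f).
Proof. by rewrite /act; case: cid => a [_ h _] /=; exact: h. Qed.

Lemma act1 f : act 1 f = f.
Proof. by rewrite /act; case: cid => a [_ _ h] /=; exact: h. Qed.

Lemma actK w : cancel (act w) (act w^-1).
Proof. by move=> f; rewrite -actM mulVg act1. Qed.

Lemma actVK w : cancel (act w^-1) (act w).
Proof. by move=> f; rewrite -actM mulgV act1. Qed.

Lemma act_lin w p f q g : act w (lin p f q g) = lin p (act w f) q (act w g).
Proof.
have [u <-] := prods_onto w; elim: u => [|s u IH] /=; first by rewrite !act1.
by rewrite !actM IH !act_gen refl_lin.
Qed.

Local Notation rvec := (rvec m).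

Lemma act_span w f : in_span m f -> in_span m (act w f).
Proof.
have [u <-] := prods_onto w; elim: u f => [|s u IH] f sf /=; first by rewrite act1.
by rewrite actM act_gen; apply: in_span_refl; exact: IH.
Qed.

(** Prolonging the alternating word shifts the indices of [cheb]; [cheb_ge0] then gives the signs in
    rank 2 up to length m(s, t). *)
Lemma act_alt s t k : s <> t -> let c := cox_cos m s t in
  act (alt s t k) (rvec s) =
  if odd k then lin (cheb c k) (rvec s) (cheb c k.+1) (rvec t)
  else lin (cheb c k.+1) (rvec s) (cheb c k) (rvec t).
Proof.
move=> nst c; elim: k => [|k IH].
  by rewrite act1 /=; apply/funext => x; rewrite /lin cheb0 cheb1; lra.
have ct : cox_cos m t s = c by rewrite cox_cosC.
rewrite alt_cons actM IH act_gen /=; apply/funext => x.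
case: (odd k) => /=; rewrite refl_lin /lin /refl chebS.
  by rewrite rvec_id // [rvec t (inl s)]/= ct; lra.
by rewrite rvec_id // [rvec s (inl t)]/= -/c; lra.
Qed.

Definition pos (f : V) := forall t, Rle 0 (f (inr t)).

Lemma pos_lin p f q g : Rle 0 p -> Rle 0 q -> pos f -> pos g -> pos (lin p f q g).
Proof.
move=> p0 q0 f0 g0 t; rewrite /lin; have := f0 t; have := g0 t => a b.
by have := Rmult_le_pos _ _ p0 b; have := Rmult_le_pos _ _ q0 a; lra.
Qed.

Lemma rvec_pos s : pos (rvec s).
Proof. by move=> t /=; case: pselect => _ /=; lra. Qed.

(* Write w = v * alt s t k with k maximal such that lengths add up; then v does not
   shorten on either side of {s, t}, and k is smaller than m(s, t). *)
Theorem tits_pos w s : len w <= len (w * e s) -> pos (act w (rvec s)).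
Proof.
have [n] := ubnP (len w); elim: n w s => // n IH w s /ltnSE wn ws.
have [/len_eq0 ->|w0] := posnP (len w); first by rewrite act1; exact: rvec_pos.
have [t wt] := len_last w0.
have nst : s <> t by move=> est; move: wt; rewrite -est ltnNge ws.
pose Q k := `[< exists2 v, w = v * alt s t k & len v + k = len w >].
have Q1 : Q 1%N.
  apply/asboolP; exists (w * e t); first by rewrite /= mul1g cox_sqK.
  apply/eqP; rewrite eqn_leq addn1 wt /=.
  by rewrite -{1}(cox_sqK t w) lenMe.
have Qle k : Q k -> k <= len w by move=> /asboolP[v _ <-]; rewrite leq_addl.
have exQ : exists k, Q k by exists 1%N.
case: (ex_maxnP exQ Qle) => k /asboolP[v wE lv] kmax.
have k1 : 0 < k by apply: kmax Q1.
case: k k1 kmax wE lv => // k _ kmax wE lv.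
have lvn : len v < n by apply: leq_trans wn; rewrite -lv addnS ltnS leq_addr.
(* This letter would prolong the alternating word at its front, against the maximality of its
   length. *)
have out : len v <= len (v * e (if odd k.+1 then s else t)).
  rewrite leqNgt; apply/negP => h.
  suff /kmax : Q k.+2 by rewrite ltnn.
  apply/asboolP; exists (v * e (if odd k.+1 then s else t)).
    by rewrite [alt _ _ _]alt_cons mulgA cox_sqK.
  apply/eqP; rewrite eqn_leq; apply/andP; split.
    by rewrite -lv addnS -addSn leq_add2r.
  rewrite {1}wE -[v in v * _](cox_sqK (if odd k.+1 then s else t)).
  rewrite -(mulgA _ _ (alt _ _ _)).
  by rewrite -alt_cons; apply: leq_trans (lenM _ _) _; rewrite leq_add2l alt_len.
(* This is the first letter of the alternating word; absorbing it into v would make w too short. *)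
have inn : len v <= len (v * e (if odd k then s else t)).
  rewrite leqNgt; apply/negP => h.
  have : len w <= len (v * e (if odd k then s else t)) + k.
    rewrite {1}wE alt_cons mulgA; apply: leq_trans (lenM _ _) _.
    by rewrite leq_add2l alt_len.
  by rewrite leqNgt -lv addnS ltnS ltnW // ltn_add2r.
have [vs vt] : pos (act v (rvec s)) /\ pos (act v (rvec t)).
  by move: out inn => /=; case: (odd k) => /= o i; split; apply: IH.
(* Otherwise the braid relation would let w end in s, and w e(s) would be shorter than w. *)
have km : if m s t is Some q then k.+1 < q else true.
  case mk: (m s t) => [q|] //; rewrite ltnNge; apply/negP => qk.
  have [z zk ez] := alt_split s t (k.+1 - q) q.
  move: ez; rewrite subnK // => ez.
  have q1 := cox_mP mP nst mk; case: q mk q1 qk zk ez => // q mk q1 qk zk ez.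
  move: ws; rewrite leqNgt => /negP; apply.
  have -> : w * e s = v * z * alt s t q.
    by rewrite wE ez (braid mk) /= !mulgA cox_sqK.
  apply: leq_ltn_trans (lenM _ _) _; rewrite -lv.
  have h : len (v * z) <= len v + (k.+1 - q.+1).
    by apply: leq_trans (lenM _ _) _; rewrite leq_add2l.
  apply: leq_ltn_trans (leq_add h (alt_len _ _ _)) _.
  by rewrite subSS -addnA subnK // addnS.
rewrite wE actM act_alt //; case: ifP => _; rewrite act_lin; apply: pos_lin => //;
  apply: cheb_ge0 => //; move: km; case: (m s t) => // q; exact: ltnW.
Qed.

Definition neg (f : V) := forall t, Rle (f (inr t)) 0.

Lemma tits_neg w s : len (w * e s) <= len w -> neg (act w (rvec s)).
Proof.
move=> h; have := @tits_pos (w * e s) s; rewrite cox_sqK => /(_ h) p t.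
have := p t; rewrite actM act_gen.
have -> : refl m s (rvec s) = lin (-1) (rvec s) 0 (rvec s).
  by apply/funext => x; rewrite /refl /lin rvec_id //; lra.
by rewrite act_lin /lin; lra.
Qed.

Lemma tits_pos_neg w s : pos (act w (rvec s)) \/ neg (act w (rvec s)).
Proof.
by case/orP: (leq_total (len w) (len (w * e s))) => [/tits_pos|/tits_neg]; [left|right].
Qed.

Lemma act_faithful w : (forall t, act w (rvec t) = rvec t) -> w = 1.
Proof.
move=> h; have [/len_eq0 //|/len_last[s /ltnW /tits_neg]] := posnP (len w).
by rewrite h => /(_ s); rewrite rvec_inr; lra.
Qed.

(** Invariance of the Tits form, a pairing with a root being a coordinate. *)
Lemma act_sym w s t : act w^-1 (rvec t) (inl s) = act w (rvec s) (inl t).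
Proof.
have [u <-] := prods_onto w; elim: u s t => [|r u IH] s t /=.
  by rewrite invg1 !act1; exact: rvecC.
rewrite invgM cox_inv !actM !act_gen refl_rvec // act_lin /lin /refl !IH.
by rewrite [rvec r (inl t)]rvecC //=; lra.
Qed.

(** Pairs to 1 with the root of t and to 0 with the other simple roots. Such a vector exists in the
    function space even if the form is degenerate on the roots; by [act_dual] it reads off
    coefficients. *)
Definition dual_basis t : V := fun x =>
  if x is inl r then (if pselect (t = r) then 1%coqR else 0%coqR) else 0%coqR.

Lemma act_dual w s t : act w^-1 (dual_basis t) (inl s) = act w (rvec s) (inr t).
Proof.
have [u <-] := prods_onto w; elim: u s t => [|r u IH] s t /=.
  by rewrite invg1 !act1 /=; case: pselect => a; case: pselect => b //=; congruence.
rewrite invgM cox_inv !actM !act_gen.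
have -> : refl m r (dual_basis t) =
    lin 1 (dual_basis t) (- (dual_basis t (inl r))) (rvec r).
  by apply/funext => x; rewrite /refl /lin; lra.
rewrite act_lin /lin IH act_sym /refl /=.
by case: pselect => a; case: pselect => b /=; [lra|congruence|congruence|lra].
Qed.

Lemma act_conj w s f : act (w * e s * w^-1) f =
  lin 1 f (- act w^-1 f (inl s)) (act w (rvec s)).
Proof.
rewrite !actM act_gen.
have -> : refl m s (act w^-1 f) = lin 1 (act w^-1 f) (- act w^-1 f (inl s)) (rvec s).
  by apply/funext => x; rewrite /refl /lin; lra.
by rewrite act_lin actVK.
Qed.

Lemma act_inj x y : (forall t, act x (rvec t) = act y (rvec t)) -> x = y.
Proof.
move=> h; apply: (@mulgI _ y^-1); rewrite mulVg; apply: act_faithful => t.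
by rewrite actM h actK.
Qed.

(** The norm 2 is preserved, so k has square 1; then w e(s) w^-1 and e(s) act as the same
    reflection, and faithfulness applies. *)
Lemma act_scal_comm w s k : act w (rvec s) = lin k (rvec s) 0 (rvec s) ->
  Rmult k k = 1%coqR /\ commute w (e s).
Proof.
move=> h; have kk : Rmult k k = 1%coqR.
  have : act w^-1 (act w (rvec s)) (inl s) = 2%coqR by rewrite actK rvec_id.
  by rewrite {1}h act_lin /lin act_sym h /lin rvec_id //; lra.
split=> //; apply: (@mulIg _ w^-1); rewrite -[RHS]mulgA mulgV mulg1.
apply: act_inj => t; rewrite act_conj act_gen act_sym h; apply/funext => x.
rewrite /lin /refl [rvec t (inl s)]rvecC //.
transitivity (rvec t x - (k * k) * rvec s (inl t) * rvec s x)%coqR; first ring.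
by rewrite kk; ring.
Qed.

(** w preserves the image of e(s) - 1, which is the line of the root of s. *)
Lemma comm_act_scal w s : commute w (e s) ->
  exists k, act w (rvec s) = lin k (rvec s) 0 (rvec s).
Proof.
move=> c; have : act (w * e s * w^-1) (rvec s) = act (e s) (rvec s).
  by rewrite c -mulgA mulgV mulg1.
rewrite act_conj act_gen => h.
have ck : (act w^-1 (rvec s) (inl s) <> 0)%coqR.
  move=> c0; have := congr1 (fun f => f (inr s)) h.
  by rewrite /lin /refl c0 rvec_id // rvec_inr; lra.
exists (2 / act w^-1 (rvec s) (inl s))%coqR; apply/funext => x.
have := congr1 (fun f => f x) h; rewrite /lin /refl rvec_id // => hx.
apply: (Rmult_eq_reg_l (act w^-1 (rvec s) (inl s))) => //.
set a := act w^-1 _ _ in hx ck *; set b := act w _ _ in hx *.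
transitivity (2 * rvec s x)%coqR; first lra.
by field.
Qed.

(** The reflection in r changes only the coefficient of [rvec r], so all others are both nonnegative
    and nonpositive. What is left is a multiple k of [rvec r], and k = 1 by norm and sign. *)
Lemma pos_neg_refl w s r : pos (act w (rvec s)) ->
  neg (act (e r * w) (rvec s)) -> act w (rvec s) = rvec r.
Proof.
move=> p n; have sp : in_span m (act w (rvec s)) by apply/act_span/in_span_rvec.
have h0 t : t <> r -> act w (rvec s) (inr t) = 0%coqR.
  move=> ntr; have := n t; have := p t; rewrite actM act_gen /refl rvec_inr0; first lra.
  exact/nesym.
have h := in_span_inr sp h0; set k := act w (rvec s) (inr r) in h.
have k0 : (0 <= k)%coqR by exact: p.
have kk : (k * k = 1)%coqR.
  have : act w^-1 (act w (rvec s)) (inl s) = 2%coqR by rewrite actK rvec_id.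
  rewrite {1}h act_lin /lin act_sym h /lin rvec_id //; lra.
have k1 : k = 1%coqR by nra.
by rewrite h k1; apply/funext => x; rewrite /lin; lra.
Qed.

(** When the letters of u are applied one by one, the sign flips at some r, where the vector must be
    [rvec r]. A word thus negates at most as many positive roots as it has letters. *)
Lemma neg_root_mem (u : seq S) w s : pos (act w (rvec s)) ->
  neg (act (prods u * w) (rvec s)) ->
  exists u1 r u2, u = u1 ++ r :: u2 /\ act w (rvec s) = act (prods u2)^-1 (rvec r).
Proof.
elim: u => [p n|r u IH p n].
  have := n; rewrite mul1g => {}n.
  have /act_span sp := in_span_rvec m s.
  have h0 := in_span_eq0 (sp w) (fun t => Rle_antisym _ _ (n t) (p t)).
  have : act w^-1 (act w (rvec s)) (inl s) = 2%coqR by rewrite actK rvec_id.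
  have -> : act w (rvec s) = lin 0 (rvec s) 0 (rvec s).
    by rewrite h0; apply/funext => x; rewrite /lin; lra.
  by rewrite act_lin /lin; lra.
have [pu|nu] := tits_pos_neg (prods u * w) s; last first.
  by have [u1 [r' [u2 [-> h]]]] := IH p nu; exists (r :: u1), r', u2.
exists [::], r, u; split=> //.
have er : act (prods u * w) (rvec s) = rvec r.
  by apply: pos_neg_refl => //; rewrite mulgA.
by rewrite -er actM actK.
Qed.

End CoxeterGroup.

(** * Indecomposability of irreducible Coxeter groups *)

Section DihedralGroup.
Variables (G : groupType) (x y : G).
Hypotheses (xx : x * x = 1) (yy : y * y = 1).
Let r := x * y.
Let C := gen [set r].
Let D := gen [set x; y].

Let xV : x^-1 = x. Proof. exact: mulg1_eq. Qed.
Let yV : y^-1 = y. Proof. exact: mulg1_eq. Qed.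

Let Ccomm c d : sg_set C c -> sg_set C d -> commute c d.
Proof. by apply: gen_commute => _ _ -> ->. Qed.

Let Cinv c : sg_set C c -> x * c * x = c^-1.
Proof.
move=> Cc; suff [] : sg_set C c /\ x * c * x = c^-1 by [].
apply: (@gen_min _ _ [set c | sg_set C c /\ x * c * x = c^-1]) Cc.
  apply: subgroup_setP => [|a b [Ca ea] [Cb eb]|a [Ca ea]].
  - by split; [exact: sg1|rewrite mulg1 xx invg1].
  - split; first exact: (@sgM _ C).
    have -> : x * (a * b) * x = x * a * x * (x * b * x).
      by rewrite !mulgA -(mulgA _ x x) xx mulg1.
    by rewrite ea eb invgM; apply: Ccomm; exact: (@sgV _ C).
  - split; first exact: (@sgV _ C).
    by rewrite -[in RHS]ea !invgM !xV mulgA.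
move=> _ ->; split; first exact: gen_sub.
by rewrite /r mulgA xx mul1g invgM xV yV.
Qed.

Let odd_case w : sg_set D w -> sg_set C w \/ sg_set C (w * x).
Proof.
apply: (@gen_min _ _ [set w | sg_set C w \/ sg_set C (w * x)]); last first.
  move=> _ [] ->; right; first by rewrite xx; exact: sg1.
  have -> : y * x = r^-1 by rewrite /r invgM xV yV.
  by apply: (@sgV _ C); exact: gen_sub.
have CxV c : sg_set C c -> sg_set C (x * c * x).
  by move=> Cc; rewrite Cinv //; exact: (@sgV _ C).
apply: subgroup_setP => [|a b [Ca|Ca] [Cb|Cb]|a [Ca|Ca]].
- by left; exact: sg1.
- by left; exact: (@sgM _ C).
- by right; rewrite -mulgA; exact: (@sgM _ C).
- right; have -> : a * b * x = a * x * (x * b * x).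
    by rewrite !mulgA -(mulgA a x x) xx mulg1.
  by apply: (@sgM _ C) => //; exact: CxV.
- left; have -> : a * b = a * x * (x * (b * x) * x).
    by rewrite !mulgA -(mulgA a x x) xx mulg1 -(mulgA _ x x) xx mulg1.
  by apply: (@sgM _ C) => //; exact: CxV.
- by left; exact: (@sgV _ C).
- right; have -> : a^-1 * x = x * (a * x)^-1 * x.
    by rewrite invgM xV mulgA xx mul1g.
  by apply: CxV; exact: (@sgV _ C).
Qed.

Let odd_conj w c : sg_set C (w * x) -> sg_set C c -> w * c * w^-1 = c^-1.
Proof.
move=> Cw Cc; have -> : w * c * w^-1 = w * x * (x * c * x) * (w * x)^-1.
  rewrite invgM xV !mulgA -(mulgA w x x) xx mulg1 -(mulgA _ x x) xx mulg1 //.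
rewrite Cinv // (Ccomm Cw) ?mulgK //; exact: (@sgV _ C).
Qed.

Let odd_sq w : sg_set C (w * x) -> w * w = 1.
Proof.
move=> Cw; have -> : w * w = w * x * (x * (w * x) * x).
  by rewrite !mulgA -(mulgA w x x) xx mulg1 -(mulgA _ x x) xx mulg1.
by rewrite Cinv // mulgV.
Qed.

(** As x = a0 b0 with a0 in C, the element b0 lies in C x and inverts C. It also commutes with A, so
    elements of A are their own inverses and commute with x as well. *)
Let even_central (A B : set G) :
  (forall a b, A a -> B b -> commute a b) ->
  (exists a b, [/\ A a, B b & x = a * b]) -> A `<=` sg_set C ->
  forall a w, A a -> sg_set D w -> commute a w.
Proof.
move=> AB [a0 [b0 [Aa0 Bb0 xE]]] AC a w Aa Dw.
have ob : sg_set C (b0 * x).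
  have -> : b0 * x = a0^-1.
    by rewrite -[b0 * x]invgK invgM xV {1}xE mulgK.
  by apply: (@sgV _ C); exact: AC.
have aV : a^-1 = a.
  by rewrite -(odd_conj ob (AC _ Aa)) -(AB a b0) // mulgK.
have cax : commute a x.
  by apply: (@mulIg _ x); rewrite -!mulgA xx mulg1 mulgA Cinv ?aV //; exact: AC.
apply/commute_sym; apply: (@gen_min _ _ [set w | commute w a]) Dw.
  have := centraliser_subgroup [set a]; congr subgroup_set.
  by apply/seteqP; split=> [v /= h|v /= h _ ->] //; exact: h.
have rin : sg_set C r by exact: gen_sub.
move=> _ [] ->; first exact/commute_sym.
have -> : y = x * r by rewrite /r mulgA xx mul1g.
by apply/commute_sym/commuteM => //; apply: Ccomm => //; exact: AC.
Qed.

(** If neither set lies in C, each contains an element of C x, which inverts C and commutes with the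
    other set; so all squares in A and in B are 1. Then x y squares to 1 and D is commutative. *)
Lemma dihedral_indec (A B : set G) : A `<=` sg_set D -> B `<=` sg_set D ->
  (forall a b, A a -> B b -> commute a b) ->
  (forall w, sg_set D w -> exists a b, [/\ A a, B b & w = a * b]) ->
  (forall a w, A a -> sg_set D w -> commute a w) \/
  (forall b w, B b -> sg_set D w -> commute b w).
Proof.
move=> AD BD AB DAB.
have Dx : sg_set D x by apply: gen_sub; left.
have Dy : sg_set D y by apply: gen_sub; right.
have [AC|nAC] := pselect (A `<=` sg_set C).
  by left; apply: even_central AB _ AC; exact: DAB.
have [BC|nBC] := pselect (B `<=` sg_set C).
  right; apply: (even_central (B := A)) BC => [b a Bb Aa|].
    exact/commute_sym/AB.
  by have [a [b [Aa Bb ->]]] := DAB x Dx; exists b, a; split=> //; exact: AB.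
have [a1 Aa1 oa1] : exists2 a, A a & sg_set C (a * x).
  apply: contrapT => h; apply: nAC => a Aa.
  by have [//|oa] := odd_case (AD _ Aa); case: h; exists a.
have [b1 Bb1 ob1] : exists2 b, B b & sg_set C (b * x).
  apply: contrapT => h; apply: nBC => b Bb.
  by have [//|ob] := odd_case (BD _ Bb); case: h; exists b.
have rC : sg_set C r by exact: gen_sub.
have Asq a : A a -> a * a = 1.
  move=> Aa; have [ea|/odd_sq //] := odd_case (AD _ Aa).
  by rewrite -[a in a * _](mulgK b1) (AB a b1) // (odd_conj ob1) // mulVg.
have Bsq b : B b -> b * b = 1.
  move=> Bb; have [eb|/odd_sq //] := odd_case (BD _ Bb).
  by rewrite -[b in b * _](mulgK a1) -(AB a1 b) // (odd_conj oa1) // mulVg.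
have cxy : commute x y.
  have [a [b [Aa Bb rE]]] := DAB r (@sgM _ D _ _ Dx Dy).
  have rr : r * r = 1.
    by rewrite rE -mulgA (mulgA b) -(AB a b) // -mulgA Bsq // mulg1 Asq.
  by have := mulg1_eq rr; rewrite {1}/r invgM xV yV.
left=> a w Aa Dw; apply: gen_commute (AD _ Aa) Dw => u v [] -> [] -> //.
Qed.

End DihedralGroup.

Lemma finite_det (T I Y : Type) (X : set T) (D : set I) (E : set Y) (r : T -> I -> Y) :
  finite_set D -> finite_set E -> (forall x i, X x -> D i -> E (r x i)) ->
  (forall x y, X x -> X y -> (forall i, D i -> r x i = r y i) -> x = y) ->
  finite_set X.
Proof.
move=> /(@finite_seqP {classic I})[s sE] finE XE inj.
have fin_s u : (forall i : {classic I}, i \in u -> D i) ->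
    finite_set [set [seq r x i | i <- u] | x in X].
  elim: u => [|i u IH] uD.
    by apply: sub_finite_set (finite_set1 [::]) => _ [x _ <-].
  apply: (finite_image11 cons) => [|]; last first.
    by apply: IH => j ju; apply: uD; rewrite inE ju orbT.
  apply: sub_finite_set finE => _ [x Xx <-]; apply: XE => //.
  by apply: uD; exact: mem_head.
have inj_s : {in X &, injective (fun x => [seq r x i | i <- s])}.
  move=> x y /set_mem Xx /set_mem Xy e; apply: inj => // i Di.
  have h := (@eq_in_map {classic I} Y (r x) (r y) s).2 e.
  by apply: h; move: Di; rewrite sE.
have := fin_s s; rewrite -(eq_finite_set (inj_card_eq inj_s)); apply=> i.
by rewrite sE.
Qed.

Lemma finite_inj (T U : Type) (X : set T) (Y : set U) (f : T -> U) :
  finite_set Y -> (forall x, X x -> Y (f x)) ->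
  (forall x y, X x -> X y -> f x = f y -> x = y) -> finite_set X.
Proof.
move=> finY XY inj.
have inj' : {in X &, injective f} by move=> x y /set_mem Xx /set_mem Xy; exact: inj.
rewrite -(eq_finite_set (inj_card_eq inj')).
by apply: sub_finite_set finY => _ [x Xx <-]; exact: XY.
Qed.

Section Components.
Variables (S : Type) (m : S -> S -> option nat) (W : groupType) (e : S -> W).
Hypothesis WS : coxeter_system m e.

Let mP : coxeter_matrix m := proj1 WS.
Local Notation rv := (rvec m).
Local Notation ac := (act WS).
Local Notation V := (S + S -> Rdefinitions.R).

Lemma cox_edge_sym s t : cox_edge m s t -> cox_edge m t s.
Proof. by case: mP => mC _ _; rewrite /cox_edge mC. Qed.

Lemma cox_edge_neq s t : cox_edge m s t -> s <> t.
Proof. by move=> h est; move: h; rewrite est /cox_edge (cox_m1 WS). Qed.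

Lemma gen_neq1 s : e s <> 1.
Proof.
move=> h; have := act_gen WS s (rv s); rewrite h act1 => /(congr1 (fun f => f (inr s))).
by rewrite /refl rvec_id // rvec_inr; lra.
Qed.

Lemma comm_nonedge s t : s <> t -> ~ cox_edge m s t -> commute (e s) (e t).
Proof.
move=> nst h; have := cox_rel WS (cox_cos_nonedge mP nst h).
rewrite expg2 -mulgA => /mulg1_eq; rewrite (cox_inv WS) => h'.
by rewrite /commute {1}h' -!mulgA (cox_sq WS) mulg1.
Qed.

Lemma edge_ncomm s t : cox_edge m s t -> ~ commute (e s) (e t).
Proof.
move=> st /(comm_act_scal WS)[k]; rewrite act_gen => /(congr1 (fun f => f (inr s))).
have nst := cox_edge_neq st; have := cox_cos_edge (cox_edge_sym st).
rewrite /refl /lin rvec_inr (@rvec_inr0 _ m t s) => [|/esym //] /=.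
by lra.
Qed.

Implicit Types o : Omega m.

Lemma omega_ex s : exists o, val o s.
Proof.
pose X := [set t | clos_refl_sym_trans S (cox_edge m) s t].
have Xc : X \in components (cox_edge m) by apply: mem_set; exists s.
by exists (SigSub Xc) => /=; exact: rst_refl.
Qed.

Lemma omegaP o : exists s, val o = [set t | clos_refl_sym_trans S (cox_edge m) s t].
Proof. by case: o => X /= /set_mem[s _ <-]; exists s. Qed.

Lemma omega_path o s t : val o s -> val o t ->
  clos_refl_sym_trans S (cox_edge m) s t.
Proof.
have [r ->] := omegaP o => rs rt; apply: (rst_trans _ _ _ r) rt; exact: rst_sym.
Qed.

Lemma omega_eq o o' s : val o s -> val o' s -> o = o'.
Proof.
move=> os o's; apply: val_inj; have [[r hr] [r' hr']] := (omegaP o, omegaP o').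
move: os o's; rewrite hr hr' => /= rs r's; apply/seteqP; split=> t h.
  by apply: (rst_trans _ _ _ s) => //; apply: (rst_trans _ _ _ r) => //; exact: rst_sym.
by apply: (rst_trans _ _ _ s) => //; apply: (rst_trans _ _ _ r') => //; exact: rst_sym.
Qed.

Lemma omega_edge o s t : val o s -> cox_edge m s t -> val o t.
Proof.
have [r ->] := omegaP o => rs st; apply: (rst_trans _ _ _ s) => //; exact: rst_step.
Qed.

Lemma omega_ind o (Q : S -> Prop) s t :
  (forall s t, val o s -> val o t -> cox_edge m s t -> Q s -> Q t) ->
  val o s -> val o t -> Q s -> Q t.
Proof.
move=> h os ot; have p := omega_path os ot.
(* Paths may run against the edges, so the property is propagated as an equivalence, with membership
   in the component carried along. *)
suff : (val o s <-> val o t) /\ (val o s -> (Q s <-> Q t)) by case=> _ /(_ os)[].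
elim: p {os ot} => {s t}.
- move=> s t st; split.
    by split=> h'; [exact: omega_edge st|exact: omega_edge (cox_edge_sym st)].
  move=> os; have ot := omega_edge os st.
  by split; [exact: h|apply: h => //; exact: cox_edge_sym].
- by move=> s.
- move=> s t _ [h1 h2]; split; first exact: iff_sym.
  by move=> /h1 /h2; exact: iff_sym.
- move=> s t r _ [h1 h2] _ [h3 h4]; split; first exact: iff_trans h1 h3.
  by move=> os; apply: iff_trans (h2 os) _; apply: h4; exact/h1.
Qed.

Lemma Wcomp_gen o s : val o s -> sg_set (Wcomp e o) (e s).
Proof. by move=> os; apply: gen_sub; exists s. Qed.

Lemma Wcomp_ind o (A : set W) : subgroup_set A -> (forall s, val o s -> A (e s)) ->
  sg_set (Wcomp e o) `<=` A.
Proof. by move=> sA h; apply: gen_min => // _ [s os <-]; exact: h. Qed.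

Lemma act_fix_subgroup (f : V) : subgroup_set [set w | ac w f = f].
Proof.
apply: subgroup_setP => /= [|x y|x h]; first exact: act1.
  by rewrite actM => ex ->.
by rewrite -{1}h actK.
Qed.

Lemma refl_fix s t : s <> t -> ~ cox_edge m s t -> refl m s (rv t) = rv t.
Proof.
move=> nst h; apply/funext => x; rewrite /refl.
have -> : rv t (inl s) = 0%coqR.
  by rewrite /= cox_cosC // (cox_cos2 (cox_cos_nonedge mP nst h)); lra.
lra.
Qed.

Lemma Wcomp_fix o w t : sg_set (Wcomp e o) w -> ~ val o t -> ac w (rv t) = rv t.
Proof.
move=> ow nt; apply: (Wcomp_ind (A := [set w | ac w (rv t) = rv t])) ow => [|s os /=].
  exact: act_fix_subgroup.
rewrite act_gen; apply: refl_fix => [est|st]; first by apply: nt; rewrite -est.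
exact: nt (omega_edge os st).
Qed.

(** Independence comes from faithfulness: a component fixes the simple roots of all others, so an
    element common to it and to their product fixes every simple root. *)
Lemma Wcomp_dprod : is_dprod (@Wcomp S m W e).
Proof.
split=> [o o' noo' x y ox o'y|| o].
- apply: gen_commute ox o'y => _ _ [s os <-] [t o't <-].
  apply: comm_nonedge => [est|st].
    by apply: noo'; apply: omega_eq os _; rewrite est.
  by apply: noo'; apply: omega_eq (omega_edge os st) o't.
- apply/seteqP; split=> // w _; apply: (cox_gen WS) => [|s]; first exact: sg_closed.
  have [o os] := omega_ex s.
  by apply: (sub_subprod (l := o)) => //; exact: Wcomp_gen.
- apply/seteqP; split=> [w [ow o'w]|_ ->]; last by split; exact: sg1.
  apply: (act_faithful (WS := WS)) => t.
  have [ot|not] := pselect (val o t); last exact: Wcomp_fix ow not.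
  apply: (subprod_ind (A := [set w | ac w (rv t) = rv t])) o'w.
    exact: act_fix_subgroup.
  move=> o' x no' /Wcomp_fix; apply=> o't; apply: no'.
  exact: omega_eq o't ot.
Qed.

End Components.

Section CenterComp.
Variables (S : Type) (m : S -> S -> option nat) (W : groupType) (e : S -> W).
Hypothesis WS : coxeter_system m e.

Let mP : coxeter_matrix m := proj1 WS.
Local Notation rv := (rvec m).
Local Notation ac := (act WS).
Local Notation V := (S + S -> Rdefinitions.R).
Implicit Types o : Omega m.

Let oppv (f : V) : V := lin (-1) f 0 f.

Let oppvK : involutive oppv.
Proof. by move=> f; apply/funext => x; rewrite /oppv /lin; lra. Qed.

Let lin1 s : lin 1 (rv s) 0 (rv s) = rv s.
Proof. by apply/funext => x; rewrite /lin; lra. Qed.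

(** By invariance of the form, the signs by which z acts on two roots with nonzero pairing agree. *)
Let central_sign o z s t : (forall r, val o r -> commute z (e r)) ->
  val o s -> val o t -> cox_edge m s t -> ac z (rv s) = rv s -> ac z (rv t) = rv t.
Proof.
move=> cz os ot st hs; have [k hk] := comm_act_scal WS (cz t ot).
have [kk _] := act_scal_comm hk.
have c0 := cox_cos_edge st.
have : ac z^-1 (ac z (rv t)) (inl s) = rv t (inl s) by rewrite actK.
rewrite hk act_lin /lin act_sym hs rvecC // [rv t (inl s)]/= cox_cosC // => h.
have k1 : k = 1%coqR by nra.
by rewrite k1; exact: lin1.
Qed.

Lemma center_Wcomp_sign o z : sg_set (Wcomp e o) z ->
  (forall s, val o s -> commute z (e s)) -> z <> 1 ->
  forall s, val o s -> ac z (rv s) = oppv (rv s).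
Proof.
move=> oz cz nz s os; have [k hk] := comm_act_scal WS (cz s os).
have [kk _] := act_scal_comm hk.
have [k1|k1] : k = 1%coqR \/ k = (-1)%coqR.
- have : ((k - 1) * (k + 1) = 0)%coqR by nra.
  by move=> /Rmult_integral[]; [left|right]; lra.
- case: nz; apply: (act_faithful (WS := WS)) => t.
  have [ot|not] := pselect (val o t); last exact: (Wcomp_fix WS oz not).
  apply: (omega_ind WS (Q := fun t => ac z (rv t) = rv t)) os ot _.
    by move=> ? ?; exact: central_sign.
  by rewrite hk k1 lin1.
- by rewrite hk k1.
Qed.

Lemma center_Wcomp_sq o z : sg_set (Wcomp e o) z ->
  (forall s, val o s -> commute z (e s)) -> z * z = 1.
Proof.
move=> oz cz; have [->|nz] := pselect (z = 1); first by rewrite mulg1.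
apply: (act_faithful (WS := WS)) => t; rewrite actM.
have [ot|not] := pselect (val o t); last by rewrite !(Wcomp_fix WS oz not).
rewrite (center_Wcomp_sign oz cz nz ot) act_lin (center_Wcomp_sign oz cz nz ot).
exact: oppvK.
Qed.

(* Since z acts as -1 on the roots of the component, a word for z makes every
   positive one of them negative, and a word does this to finitely many roots. *)
Lemma center_Wcomp_finite o z : sg_set (Wcomp e o) z ->
  (forall s, val o s -> commute z (e s)) -> z <> 1 ->
  finite_set (sg_set (Wcomp e o)) /\ finite_set (val o).
Proof.
move=> oz cz nz; have neg_z := center_Wcomp_sign oz cz nz.
have cz' w : sg_set (Wcomp e o) w -> commute z w.
  apply: (@Wcomp_ind _ _ _ _ _ [set w | commute z w]) => //.
  have := centraliser_subgroup [set z]; congr subgroup_set.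
  by apply/seteqP; split=> [v /= h|v /= h _ ->]; apply/commute_sym => //; exact: h.
have [s0 _] := omegaP o.
have [u uz] := prods_onto WS z.
(* The root given by [neg_root_mem] when the sign flips at position k of u. *)
pose cand k := ac (prods e (drop k.+1 u))^-1 (rv (nth s0 u k)).
pose L := cand @` `I_(size u).
have finL : finite_set (L `|` (oppv @` L)).
  by rewrite finite_setU; split; do ?apply: finite_image; exact: finite_II.
have inL w s : sg_set (Wcomp e o) w -> val o s -> pos (ac w (rv s)) -> L (ac w (rv s)).
  move=> ow os p; have n : neg (ac (prods e u * w) (rv s)).
    rewrite uz cz' // actM neg_z // act_lin => t; have := p t; rewrite /lin; lra.
  have [u1 [r [u2 [eu h]]]] := neg_root_mem p n.
  exists (size u1); first by rewrite eu size_cat /= -addSnnS leq_addr.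
  by rewrite /cand eu nth_cat ltnn subnn -cat_rcons drop_size_cat ?size_rcons.
have inLL w s : sg_set (Wcomp e o) w -> val o s -> (L `|` (oppv @` L)) (ac w (rv s)).
  move=> ow os; have [p|n] := tits_pos_neg WS w s; first by left; exact: inL.
  right; exists (ac (w * e s) (rv s)); last first.
    rewrite actM act_gen; apply/funext => x.
    have -> : refl m s (rv s) = oppv (rv s).
      by apply/funext => y; rewrite /refl /oppv /lin rvec_id //; lra.
    by rewrite act_lin /oppv /lin; lra.
  apply: inL => //; first by apply: sgM => //; exact: Wcomp_gen.
  rewrite actM act_gen => t; have := n t.
  have -> : refl m s (rv s) = oppv (rv s).
    by apply/funext => y; rewrite /refl /oppv /lin rvec_id //; lra.
  by rewrite act_lin /lin; lra.
have fino : finite_set (val o).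
  apply: (finite_inj (f := rv)) finL _ _ => [s os|s t _ _].
    by rewrite -[rv s](act1 WS); apply: inLL => //; exact: sg1.
  move=> /(congr1 (fun f => f (inr s))); rewrite rvec_inr => h.
  by apply: contrapT => nst; move: h; rewrite rvec_inr0; [lra|exact/nesym].
split=> //; apply: (finite_det (r := fun w s => ac w (rv s))) fino finL _ _ => //.
move=> x y ox oy h; apply: (act_inj (WS := WS)) => t.
have [ot|not] := pselect (val o t); first exact: h.
by rewrite (Wcomp_fix WS ox not) (Wcomp_fix WS oy not).
Qed.

End CenterComp.

Section Indecomposable.
Variables (S : Type) (m : S -> S -> option nat) (W : groupType) (e : S -> W).
Hypothesis WS : coxeter_system m e.

Let mP : coxeter_matrix m := proj1 WS.
Local Notation rv := (rvec m).
Local Notation ac := (act WS).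
Local Notation V := (S + S -> Rdefinitions.R).
Implicit Types o : Omega m.

(* With b0 e(s) = e(s) b0, the rank one operator E f = f(s) rv s is a multiple of
   b0^-1 - a0; hence D = b E b^-1 - E commutes with A.  As the image of D is
   spanned by rv s and b rv s, this plane contains A rv s. *)
Lemma commuting_plane (A B : set W) s a0 b0 b a :
  (forall a b, A a -> B b -> commute a b) -> subgroup_set B ->
  A a0 -> B b0 -> e s = a0 * b0 -> B b -> ~ commute b (e s) -> A a ->
  exists p q, ac a (rv s) = lin p (rv s) q (ac b (rv s)).
Proof.
move=> AB sB Aa0 Bb0 es Bb nb Aa.
have Bb0V : B b0^-1 by exact: subgV.
have BbV : B b^-1 by exact: subgV.
have cb0 : commute b0^-1 (e s).
  by rewrite es; apply: commuteM; [apply/commute_sym/AB|apply/commute_sym/commuteV].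
have [k hk] := comm_act_scal WS cb0; have [kk _] := act_scal_comm hk.
have b0s f : ac b0^-1 f (inl s) = (k * f (inl s))%coqR.
  have := congr1 (fun w => ac w f (inr s)) cb0.
  rewrite !actM !act_gen.
  have -> : refl m s f = lin 1 f (- f (inl s)) (rv s).
    by apply/funext => x; rewrite /refl /lin; lra.
  by rewrite act_lin hk /lin /refl /lin rvec_inr; lra.
have E f : lin (f (inl s)) (rv s) 0 (rv s) = lin k (ac b0^-1 f) (- k) (ac a0 f).
  have -> : a0 = e s * b0^-1 by rewrite es mulgK.
  rewrite actM act_gen; apply/funext => x; rewrite /lin /refl b0s.
  transitivity ((k * k) * f (inl s) * rv s x)%coqR; first by rewrite kk; ring.
  ring.
have D f x : (ac b^-1 f (inl s) * ac b (rv s) x - f (inl s) * rv s x =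
    k * (ac (b * b0^-1 * b^-1) f x - ac b0^-1 f x))%coqR.
  have := congr1 (fun g => ac b g x) (E (ac b^-1 f)).
  rewrite !act_lin /= -!actM.
  have -> : b * a0 * b^-1 = a0 by rewrite -(AB a0 b) // mulgK.
  have := congr1 (fun g => g x) (E f); rewrite /lin; lra.
(* If b preserved the line of [rv s] it would commute with e(s); so another simple root occurs in b
   (rv s). *)
have [t nts ht] : exists2 t, t <> s & (ac b (rv s) (inr t) <> 0)%coqR.
  apply: contrapT => h; apply: nb.
  have sp : in_span m (ac b (rv s)) by apply/act_span/in_span_rvec.
  have hb := in_span_inr sp (fun t nts => contrapT (fun n => h (ex_intro2 _ _ t nts n))).
  by case: (act_scal_comm hb).
set y := ac b (rv s) (inr t) in ht *; pose x := ac b (rv s) (inr s).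
(* Chosen so that f pairs to 1 and b^-1 f to 0 with the root of s; then D f = - rv s. *)
pose f := lin 1 (dual_basis s) (- (x / y)) (dual_basis t).
have fs : f (inl s) = 1%coqR.
  rewrite /f /lin /=; case: pselect => [?|//]; case: pselect => [/nts //|?] /=; lra.
have fb : ac b^-1 f (inl s) = 0%coqR.
  by rewrite /f act_lin /lin !act_dual -/x -/y; field.
have := D f; rewrite fs fb => Df.
have cN u : B u -> forall g, ac a (ac u g) = ac u (ac a g).
  by move=> Bu g; rewrite -!actM (AB a u).
have BM : B (b * b0^-1 * b^-1) by apply: subgM => //; exact: subgM.
have {}Df : rv s = lin (- k) (ac (b * b0^-1 * b^-1) f) k (ac b0^-1 f).
  by apply/funext => z; have := Df z; rewrite /lin; lra.
(* As a commutes with D, a (rv s) = - D (a f), and these are its coefficients. *)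
exists (ac a f (inl s)), (- ac b^-1 (ac a f) (inl s))%coqR.
rewrite [in LHS]Df act_lin !cN //; apply/funext => z.
by have := D (ac a f) z; rewrite /lin; lra.
Qed.

(** A generator changes the root of a neighbour by a nonzero multiple of its own root, so along
    edges all simple roots of the component get into the plane; independence leaves room for two. *)
Lemma stable_plane o s (g1 g2 : V) : val o s ->
  (exists p q, rv s = lin p g1 q g2) ->
  (forall w, sg_set (Wcomp e o) w -> forall f, (exists p q, f = lin p g1 q g2) ->
     exists p q, ac w f = lin p g1 q g2) ->
  exists2 t, val o t & forall r, val o r -> r = s \/ r = t.
Proof.
move=> os Ps st.
have P r : val o r -> exists p q, rv r = lin p g1 q g2.
  move=> or; apply: (omega_ind WS (Q := fun r => exists p q, rv r = lin p g1 q g2)) os or Ps.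
  move=> u v ou ov uv Pu.
  have [p' [q' h']] := st _ (Wcomp_gen (e:=e) ov) _ Pu; have [p [q h]] := Pu.
  have c0 := cox_cos_edge uv; set c := cox_cos m u v in c0.
  exists ((p' - p) / c)%coqR, ((q' - q) / c)%coqR; apply/funext => x.
  apply: (Rmult_eq_reg_l c); last lra.
  have := congr1 (fun f => f x) h'; rewrite act_gen refl_rvec // h /lin -/c => e'.
  by transitivity (p' * g1 x + q' * g2 x - (p * g1 x + q * g2 x))%coqR; [lra|field; lra].
apply: contrapT => no.
have [t [ot nts]] : exists t, val o t /\ t <> s.
  apply: contrapT => h; apply: no; exists s => // r or; left.
  by apply: contrapT => nrs; apply: h; exists r.
have [r [or nrs nrt]] : exists r, [/\ val o r, r <> s & r <> t].
  apply: contrapT => h; apply: no; exists t => // r or.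
  have [rs|nrs] := pselect (r = s); [by left|right].
  by apply: contrapT => nrt; apply: h; exists r.
have [[p1 [q1 h1]] [p2 [q2 h2]] [p3 [q3 h3]]] := And3 (P _ os) (P _ ot) (P _ or).
(* The 2 x 2 minors of the coefficients give a linear relation between three vectors of a plane. *)
have rel x : ((p2 * q3 - p3 * q2) * rv s x + (p3 * q1 - p1 * q3) * rv t x +
    (p1 * q2 - p2 * q1) * rv r x = 0)%coqR.
  by rewrite h1 h2 h3 /lin; ring.
have e3 := rel (inr r); rewrite rvec_inr !rvec_inr0 in e3; [|exact/nesym|exact/nesym].
have r2 x : (q2 * rv s x - q1 * rv t x = 0)%coqR.
  rewrite h1 h2 /lin; transitivity ((p1 * q2 - p2 * q1) * g1 x)%coqR; first ring.
  have -> : (p1 * q2 - p2 * q1 = 0)%coqR by lra. ring.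
have r1 x : (p2 * rv s x - p1 * rv t x = 0)%coqR.
  rewrite h1 h2 /lin; transitivity (- (p1 * q2 - p2 * q1) * g2 x)%coqR; first ring.
  have -> : (p1 * q2 - p2 * q1 = 0)%coqR by lra. ring.
have p10 : p1 = 0%coqR.
  by have := r1 (inr t); rewrite rvec_inr rvec_inr0; [lra|exact/nesym].
have q10 : q1 = 0%coqR.
  by have := r2 (inr t); rewrite rvec_inr rvec_inr0; [lra|exact/nesym].
by have := congr1 (fun f => f (inr s)) h1; rewrite /lin rvec_inr p10 q10; lra.
Qed.

Section Split.
Variables (o : Omega m) (A B : set W).
Hypotheses (sA : subgroup_set A) (sB : subgroup_set B).
Hypotheses (Ao : A `<=` sg_set (Wcomp e o)) (Bo : B `<=` sg_set (Wcomp e o)).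
Hypothesis AB : forall a b, A a -> B b -> commute a b.
Hypothesis oAB : forall w, sg_set (Wcomp e o) w -> exists a b,
  [/\ A a, B b & w = a * b].

Let inP (g1 g2 f : V) := exists p q, f = lin p g1 q g2.

Let inP_lin g1 g2 p f q g : inP g1 g2 f -> inP g1 g2 g -> inP g1 g2 (lin p f q g).
Proof.
move=> [a [b ->]] [c [d ->]]; exists (p * a + q * c)%coqR, (p * b + q * d)%coqR.
by apply/funext => x; rewrite /lin; ring.
Qed.

Let inP1 g1 g2 : inP g1 g2 g1.
Proof. by exists 1%coqR, 0%coqR; apply/funext => x; rewrite /lin; ring. Qed.

Let inP2 g1 g2 : inP g1 g2 g2.
Proof. by exists 0%coqR, 1%coqR; apply/funext => x; rewrite /lin; ring. Qed.

Let stable_AB g1 g2 s : val o s -> inP g1 g2 (rv s) ->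
  (forall a, A a -> inP g1 g2 (ac a g1) /\ inP g1 g2 (ac a g2)) ->
  (forall b, B b -> inP g1 g2 (ac b g1) /\ inP g1 g2 (ac b g2)) ->
  exists2 t, val o t & forall r, val o r -> r = s \/ r = t.
Proof.
move=> os Ps hA hB; apply: stable_plane os Ps _ => w /oAB[a [b [Aa Bb ->]]] f [p [q ->]].
rewrite act_lin !actM; have [h1 h2] := hB b Bb; have [k1 k2] := hA a Aa.
have h g : inP g1 g2 g -> inP g1 g2 (ac a g).
  by move=> [p' [q' ->]]; rewrite act_lin; exact: inP_lin.
by apply: inP_lin; exact: h.
Qed.

Let small s t : val o s -> val o t -> (forall r, val o r -> r = s \/ r = t) ->
  (forall a w, A a -> sg_set (Wcomp e o) w -> commute a w) \/
  (forall b w, B b -> sg_set (Wcomp e o) w -> commute b w).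
Proof.
move=> os ot st; have oE : sg_set (Wcomp e o) = sg_set (gen [set e s; e t]).
  congr (sg_set (gen _)); apply/seteqP; split=> [_ [r /st[] -> <-]|_ [] ->].
  - by left.
  - by right.
  - by exists s.
  - by exists t.
move: Ao Bo oAB; rewrite oE => Ao' Bo' oAB'.
exact: (dihedral_indec (cox_sq WS s) (cox_sq WS t) Ao' Bo' AB oAB').
Qed.

Let centralA : (forall s a, val o s -> A a -> commute a (e s)) ->
  forall a w, A a -> sg_set (Wcomp e o) w -> commute a w.
Proof.
move=> h a w Aa; apply: (@Wcomp_ind _ _ _ _ _ [set w | commute a w]).
  have := centraliser_subgroup [set a]; congr subgroup_set.
  by apply/seteqP; split=> [v /= k|v /= k _ ->]; apply/commute_sym => //; exact: k.
by move=> s os; exact: h.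
Qed.

Let centralB : (forall s b, val o s -> B b -> commute b (e s)) ->
  forall b w, B b -> sg_set (Wcomp e o) w -> commute b w.
Proof.
move=> h a w Aa; apply: (@Wcomp_ind _ _ _ _ _ [set w | commute a w]).
  have := centraliser_subgroup [set a]; congr subgroup_set.
  by apply/seteqP; split=> [v /= k|v /= k _ ->]; apply/commute_sym => //; exact: k.
by move=> s os; exact: h.
Qed.

Let cA s := forall a, A a -> commute a (e s).
Let cB s := forall b, B b -> commute b (e s).

(** [commuting_plane] puts the A-images of [rv s] into a plane containing b1 (rv s), and the
    B-images into one containing a1 (rv s). As a1 (rv s) lies in the first plane off the line of
    [rv s], the planes coincide. *)
Let both_fail s : val o s -> ~ cA s -> ~ cB s ->
  exists2 t, val o t & forall r, val o r -> r = s \/ r = t.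
Proof.
move=> os ncA ncB.
have [a1 Aa1 na1] : exists2 a, A a & ~ commute a (e s).
  by apply: contrapT => h; apply: ncA => a Aa; apply: contrapT => n; apply: h; exists a.
have [b1 Bb1 nb1] : exists2 b, B b & ~ commute b (e s).
  by apply: contrapT => h; apply: ncB => b Bb; apply: contrapT => n; apply: h; exists b.
have [a0 [b0 [Aa0 Bb0 es]]] := oAB (Wcomp_gen (e:=e) os).
have es' : e s = b0 * a0 by rewrite es AB.
have BA b a : B b -> A a -> commute b a by move=> Bb Aa; apply/commute_sym/AB.
have hA a : A a -> inP (rv s) (ac b1 (rv s)) (ac a (rv s)).
  exact: (commuting_plane AB sB Aa0 Bb0 es Bb1 nb1).
have hB b : B b -> inP (rv s) (ac a1 (rv s)) (ac b (rv s)).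
  exact: (commuting_plane BA sA Bb0 Aa0 es' Aa1 na1).
have [p [q ha1]] := hA a1 Aa1; have [p' [q' hb1]] := hB b1 Bb1.
have q0 : (q <> 0)%coqR.
  move=> q0; apply: na1; apply: (proj2 (act_scal_comm (WS := WS) (k := p) _)).
  by rewrite ha1 q0; apply/funext => x; rewrite /lin; lra.
have q'0 : (q' <> 0)%coqR.
  move=> q0'; apply: nb1; apply: (proj2 (act_scal_comm (WS := WS) (k := p') _)).
  by rewrite hb1 q0'; apply/funext => x; rewrite /lin; lra.
have hB' b : B b -> inP (rv s) (ac b1 (rv s)) (ac b (rv s)).
  move=> /hB[c [d ->]]; apply: inP_lin => //; exact: hA.
apply: (stable_AB (g1 := rv s) (g2 := ac b1 (rv s))) os _ _ _ => // [a Aa|b Bb].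
  split; first exact: hA.
  have hb : ac b1 (rv s) = lin (1 / q) (ac a1 (rv s)) (- p / q) (rv s).
    by rewrite ha1; apply/funext => x; rewrite /lin; field.
  have : inP (rv s) (ac b1 (rv s))
      (ac a (lin (1 / q) (ac a1 (rv s)) (- p / q) (rv s))).
    rewrite act_lin; apply: inP_lin; last exact: hA.
    by rewrite -actM; apply: hA; exact: subgM.
  by rewrite -hb.
by split; [exact: hB'|rewrite -actM; apply: hB'; exact: subgM].
Qed.

Let normA a w : sg_set (Wcomp e o) w -> A a -> A (w^-1 * a * w).
Proof.
move=> /oAB[a' [b' [Aa' Bb' ->]]] Aa.
have -> : (a' * b')^-1 * a * (a' * b') = a'^-1 * a * a'.
  transitivity (b'^-1 * (a'^-1 * a * a') * b'); first by rewrite invgM !mulgA.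
  rewrite -mulgA (AB (a := a'^-1 * a * a')) ?mulKg //.
  by apply: subgM => //; apply: subgM => //; exact: subgV.
by apply: subgM => //; apply: subgM => //; exact: subgV.
Qed.

Let normB b w : sg_set (Wcomp e o) w -> B b -> B (w^-1 * b * w).
Proof.
move=> /oAB[a' [b' [Aa' Bb' ->]]] Bb.
have -> : (a' * b')^-1 * b * (a' * b') = b'^-1 * b * b'.
  transitivity (b'^-1 * (a'^-1 * (b * a')) * b'); first by rewrite invgM !mulgA.
  by rewrite -(AB Aa' Bb) mulKg.
by apply: subgM => //; apply: subgM => //; exact: subgV.
Qed.

(** A and B may overlap, so indecomposability says that one of them is central; in a centerless
    component it is then trivial. *)
Theorem Wcomp_indec :
  (forall a w, A a -> sg_set (Wcomp e o) w -> commute a w) \/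
  (forall b w, B b -> sg_set (Wcomp e o) w -> commute b w).
Proof.
have [[s [os nA nB]]|good] := pselect (exists s, [/\ val o s, ~ cA s & ~ cB s]).
  by have [t ot st] := both_fail os nA nB; exact: small os ot st.
have {}good s : val o s -> ~ cA s -> cB s.
  by move=> os nA; apply: contrapT => nB; apply: good; exists s.
have [allA|nallA] := pselect (forall s, val o s -> cA s).
  by left; apply: centralA => s a os; exact: allA.
have [allB|nallB] := pselect (forall s, val o s -> cB s).
  by right; apply: centralB => s b os; exact: allB.
have [s os nAs] : exists2 s, val o s & ~ cA s.
  by apply: contrapT => h; apply: nallA => s os; apply: contrapT => n; apply: h; exists s.
have [t ot nBt] : exists2 t, val o t & ~ cB t.
  by apply: contrapT => h; apply: nallB => s' os'; apply: contrapT => n; apply: h; exists s'.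
have cAt : cA t by apply: contrapT => nA; apply: nBt; exact: good.
(* Going from s to t, some edge leads from a generator not centralised by A to one not centralised
   by B: a neighbour y centralised by both would commute with e(x) = a b. *)
have [x [y [ox oy xy nAx nBy]]] : exists x y,
    [/\ val o x, val o y, cox_edge m x y, ~ cA x & ~ cB y].
  apply: contrapT => h; suff : ~ cA t by [].
  apply: (omega_ind WS (Q := fun r => ~ cA r)) os ot nAs => x y ox oy xy nAx cAy.
  have cBy : cB y by apply: contrapT => nBy; apply: h; exists x, y.
  apply: (edge_ncomm WS xy).
  have [a [b [Aa Bb ->]]] := oAB (Wcomp_gen (e:=e) ox).
  by apply/commute_sym/commuteM; apply/commute_sym; [exact: cAy|exact: cBy].
have cBx : cB x by exact: good.
have cAy : cA y by apply: contrapT => nA; apply: nBy; exact: good.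
have c0 := cox_cos_edge xy; have c0' := cox_cos_edge (cox_edge_sym WS xy).
(* u preserves the line of [rv z1] and that of its image rv z1 + c rv z2 under e(z2); as c is
   nonzero, it preserves the plane of both roots. *)
have P1 z1 z2 u : commute u (e z1) -> val o z1 -> val o z2 ->
    (0 < cox_cos m z1 z2)%coqR ->
    commute ((e z2)^-1 * u * e z2) (e z1) ->
    inP (rv z1) (rv z2) (ac u (rv z1)) /\ inP (rv z1) (rv z2) (ac u (rv z2)).
  move=> c1 o1 o2 c12 c2.
  have [k hk] := comm_act_scal WS c1; have [k' hk'] := comm_act_scal WS c2.
  split; first by rewrite hk; exact: inP_lin.
  have : ac u (ac (e z2) (rv z1)) = ac (e z2) (lin k' (rv z1) 0 (rv z1)).
    by rewrite -hk' -!actM !mulgA mulgV mul1g.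
  rewrite act_lin !act_gen refl_rvec // act_lin hk.
  set c := cox_cos m z1 z2 in c12 *; move=> h.
  have -> : ac u (rv z2) = lin (1 / c)%coqR
     (lin k' (lin 1 (rv z1) c (rv z2)) 0 (rv z1)) (- k / c)%coqR (rv z1).
    apply/funext => z; have := congr1 (fun f => f z) h; rewrite /lin => hz.
    apply: (Rmult_eq_reg_l c); last lra.
    transitivity (k' * (1 * rv z1 z + c * rv z2 z) - k * rv z1 z)%coqR; first lra.
    field; lra.
  by apply: inP_lin => //; apply: inP_lin => //; exact: inP_lin.
have swapP g1 g2 f : inP g1 g2 f -> inP g2 g1 f.
  by move=> [p [q ->]]; exists q, p; apply/funext => z; rewrite /lin; lra.
have [] := stable_AB (g1 := rv x) (g2 := rv y) ox (inP1 _ _).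
- move=> a Aa; have [] := P1 y x a (cAy a Aa) oy ox c0'.
    by apply: cAy; apply: normA => //; exact: Wcomp_gen.
  by move=> h1 h2; split; exact: swapP.
- move=> b Bb; apply: (P1 x y b (cBx b Bb) ox oy c0).
  by apply: cBx; apply: normB => //; exact: Wcomp_gen.
by move=> r or xr; exact: small ox or xr.
Qed.

End Split.
End Indecomposable.

(** * Automorphisms of Coxeter groups *)

Section CoxeterAut.
Variables (S : Type) (m : S -> S -> option nat) (W : groupType) (e : S -> W).
Hypothesis WS : coxeter_system m e.

Let F : Omega m -> subgroup W := @Wcomp S m W e.
Let GF : is_dprod F := Wcomp_dprod WS.
Local Notation coord := (coord GF).
Implicit Types (o : Omega m) (a b : Aut W).

Definition centerless o := forall z, sg_set (F o) z -> center z -> z = 1.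

Lemma inf_centerless o : Om_inf m e o -> centerless o.
Proof.
move=> oinf z oz cz; apply: contrapT => nz; apply: oinf.
by have [] := center_Wcomp_finite WS oz (fun s _ => cz (e s)) nz.
Qed.

Lemma Wcomp_nontrivial o : exists2 x, sg_set (F o) x & x <> 1.
Proof.
have [s os] := omegaP o; exists (e s); last exact: (gen_neq1 WS).
by apply: Wcomp_gen; rewrite os; exact: rst_refl.
Qed.

(** The substitute for (C1). Some [F k] has nontrivial image; this image and that of the other
    factors commute and together make up [F o]. By [Wcomp_indec] one of them is central, hence
    trivial, and it must be the second. *)
Lemma centerless_onto o (f : W -> W) : centerless o -> {morph f : x y / x * y} ->
  (forall x, sg_set (F o) (f x)) ->
  (forall y, sg_set (F o) y -> exists x, f x = y) ->
  exists k, forall y, sg_set (F o) y -> exists2 x, sg_set (F k) x & f x = y.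
Proof.
move=> co fM fo fS.
have ceno x : sg_set (F o) x -> (forall w, sg_set (F o) w -> commute x w) -> x = 1.
  by move=> ox h; apply: co => //; apply/(center_factor GF ox).
have [k [x0 kx0 fx0]] : exists k, exists2 x, sg_set (F k) x & f x <> 1.
  have [y oy ny] := Wcomp_nontrivial o; have [x ex] := fS y oy.
  apply: contrapT => h; apply: ny; rewrite -ex.
  apply: (eq_dprod GF (f := f) (g := fun=> 1)) => // [u v|k u ku].
    by rewrite mulg1.
  by apply: contrapT => n; apply: h; exists k, u.
exists k => y oy; have [x xy] := fS y oy.
pose A := f @` sg_set (F k); pose B := f @` sg_set (subprod F (~` [set k])).
have sA : subgroup_set A by apply: image_subgroup => //; exact: sg_closed.
have sB : subgroup_set B by apply: image_subgroup => //; exact: sg_closed.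
have Ao : A `<=` sg_set (Wcomp e o) by move=> _ [u _ <-]; exact: fo.
have Bo : B `<=` sg_set (Wcomp e o) by move=> _ [u _ <-]; exact: fo.
have AB u v : A u -> B v -> commute u v.
  move=> [u' ku' <-] [v' kv' <-]; rewrite /commute -!fM; congr f.
  exact: (subprod_commute GF (setICr [set k]) (sub_subprod (Q := [set k]) erefl ku') kv').
have oAB w : sg_set (Wcomp e o) w -> exists u v, [/\ A u, B v & w = u * v].
  move=> /fS[u <-]; exists (f (coord k u)), (f (restr GF (~` [set k]) u)); split.
  - by exists (coord k u) => //; exact: coord_in.
  - by exists (restr GF (~` [set k]) u) => //; exact: restr_in.
  - by rewrite -fM -restr_split.
have [cA|cB] := Wcomp_indec WS sA sB Ao Bo AB oAB.
  by case: fx0; apply: ceno => // w; apply: cA; exists x0.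
exists (coord k x); first exact: coord_in.
rewrite -xy [in RHS](restr_split GF [set k] x) fM.
rewrite [f (restr GF (~` _) x)](ceno _ (fo _)) ?mulg1 // => w.
by apply: cB; exists (restr GF (~` [set k]) x) => //; exact: restr_in.
Qed.

Lemma centerless_nonabelian o : centerless o ->
  ~ (forall x y, sg_set (F o) x -> sg_set (F o) y -> commute x y).
Proof.
move=> co h; have [x ox nx] := Wcomp_nontrivial o; apply: nx; apply: co => //.
by apply/(center_factor GF ox) => y; exact: h.
Qed.

Section Core.
Variable P : set (Omega m).
Hypothesis P_centerless : forall o, P o -> centerless o.
(** Keeps the map on indices inside P: for the infinite components, a component with an infinite
    image is itself infinite. *)
Hypothesis P_image : forall o k (f : W -> W), P o ->
  (forall y, sg_set (F o) y -> exists2 x, sg_set (F k) x & f x = y) -> P k.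
Variable idW : forall o' o : Omega m, grp (F o) -> grp (F o').
Hypothesis idWP : iso_system P idW.

(** The off-diagonal parts of c are central, hence trivial in centerless components, so c preserves
    the coordinates in P exactly. *)
Lemma coxeter_aut_decomposition a : exists c b s : Aut W,
  [/\ forall o x, P o -> coord o (c x) = coord o x,
      factor_auts F P b, sym_auts idW (iso_classes F P) s & a = c * b * s].
Proof.
have h1 o (f : W -> W) : P o -> {morph f : x y / x * y} ->
    (forall x, sg_set (F o) (f x)) ->
    (forall y, sg_set (F o) y -> exists x, f x = y) ->
    exists2 k, P k & forall y, sg_set (F o) y -> exists2 x, sg_set (F k) x & f x = y.
  move=> Po fM fo fS; have [k hk] := centerless_onto (P_centerless Po) fM fo fS.
  by exists k => //; exact: P_image Po hk.
have h2 o : P o -> ~ (forall x y, sg_set (F o) x -> sg_set (F o) y -> commute x y).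
  by move=> Po; apply: centerless_nonabelian; exact: P_centerless.
have h3 o (c : W -> W) : P o ->
    (forall x y, sg_set (F o) x -> sg_set (F o) y -> c (x * y) = c x * c y) ->
    (forall x, sg_set (F o) x -> sg_set (F o) (c x) /\ center (c x)) ->
    forall z, sg_set (F o) z -> center z -> c z = 1.
  move=> Po cM _ z oz cz; rewrite (P_centerless Po oz cz).
  have o1 : sg_set (F o) 1 by exact: sg1.
  by apply: (@mulgI _ (c 1)); rewrite -cM ?mulg1.
have [c [b [s [cP bP sP ->]]]] := aut_decomposition GF h1 h2 h3 idWP a.
exists c, b, s; split=> // o x Po; have [c1 c2] := cP o Po.
apply: (eq_dprod GF (f := coord o \o c) (g := coord o)) => [y z|y z|k y ky] /=.
- by rewrite aut_morph coordM.
- by rewrite coordM.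
have [eko|nko] := pselect (k = o).
  by rewrite eko in ky; rewrite c1 ?coord_id.
rewrite (coord_ne GF nko ky); apply: (P_centerless Po); first exact: coord_in.
exact: c2 ky.
Qed.

End Core.

Local Notation Ofin := (Om_fin m e).
Local Notation Oinf := (Om_inf m e).
Local Notation N := (Wfin m e).
Local Notation I := (Winf m e).

Lemma Wfin_coord x : sg_set N x <-> forall o, Oinf o -> coord o x = 1.
Proof. exact: (coord_subprod GF Ofin x). Qed.

Lemma center_Wfin z : center z -> sg_set N z.
Proof.
move=> cz; apply/Wfin_coord => o oinf; apply: (inf_centerless oinf).
  exact: coord_in.
exact: (@center_coord_center _ _ _ GF).
Qed.

Lemma Wfin_Winf_comm x y : sg_set N x -> sg_set I y -> commute x y.
Proof. by move=> Nx Ix; exact: (subprod_commute GF (setICr Ofin) Nx Ix). Qed.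

Lemma Wfin_ind (A : set W) : subgroup_set A ->
  (forall o x, Ofin o -> sg_set (F o) x -> A x) -> sg_set N `<=` A.
Proof. exact: subprod_ind. Qed.

Lemma Winf_ind (A : set W) : subgroup_set A ->
  (forall o x, Oinf o -> sg_set (F o) x -> A x) -> sg_set I `<=` A.
Proof. exact: subprod_ind. Qed.

Lemma in_Wfin o x : Ofin o -> sg_set (F o) x -> sg_set N x.
Proof. exact: sub_subprod. Qed.

Lemma in_Winf o x : Oinf o -> sg_set (F o) x -> sg_set I x.
Proof. exact: sub_subprod. Qed.

Lemma aut_ext a b : (forall x, sg_set N x -> a x = b x) ->
  (forall x, sg_set I x -> a x = b x) -> a = b.
Proof.
move=> hN hI; apply: autP; apply: (eq_dprod GF) => [||o x ox]; try exact: aut_morph.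
by have [/in_Wfin/(_ ox)/hN|/in_Winf/(_ ox)/hI] := pselect (Ofin o).
Qed.

Variable idW : forall o' o : Omega m, grp (F o) -> grp (F o').
Hypothesis idWP : iso_system [set: Omega m] idW.

Lemma isog_finite (A B : subgroup W) : isog (grp A) (grp B) ->
  finite_set (sg_set A) -> finite_set (sg_set B).
Proof.
move=> /isog_sym[g [h gK hK]] finA.
pose f x := if pselect (sg_set B x) is left Bx then gval (g (mkg Bx)) else 1.
apply: (finite_inj (f := f)) finA _ _ => [x Bx|x y Bx By]; rewrite /f.
  by case: pselect => // ?; exact: gvalP.
case: pselect => [Bx'|//]; case: pselect => [By'|//].
by move=> /gval_inj /(can_inj gK) /(congr1 (@gval _ _)).
Qed.

Lemma Ups_infE : Ups_inf m e = iso_classes F Oinf.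
Proof.
apply/seteqP; split=> X.
  move=> [[o _ <-] nfin]; have oinf : Oinf o.
    move=> ofin; apply: nfin; split; first by exists o.
    by move=> o' [_ oo']; exact: isog_finite oo' ofin.
  exists o => //; apply/seteqP; split=> o' [_ oo']; split=> //.
  by move=> o'fin; apply: oinf; exact: isog_finite (isog_sym oo') o'fin.
move=> [o oinf <-]; split.
  exists o => //; apply/seteqP; split=> o' [_ oo']; split=> //.
  by move=> o'fin; apply: oinf; exact: isog_finite (isog_sym oo') o'fin.
by move=> [_ /(_ o)] h; apply: (oinf); apply: h; split=> //; exact: isog_refl.
Qed.

Lemma iso_system_inf : iso_system Oinf idW.
Proof.
move=> X; rewrite -Ups_infE => -[UX _]; exact: idWP UX.
Qed.

Let dec a : exists c b s : Aut W,
  [/\ forall o x, Oinf o -> coord o (c x) = coord o x,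
      factor_auts F Oinf b, sym_auts idW (iso_classes F Oinf) s & a = c * b * s].
Proof.
apply: coxeter_aut_decomposition => [o|o k f oinf fk kfin|].
- exact: inf_centerless.
- apply: oinf; apply: sub_finite_set (finite_image f kfin) => y /fk[x kx <-].
  by exists x.
- exact: iso_system_inf.
Qed.

Local Notation H1 := (flat_set (HomZ_factor I N)).
Local Notation H2 := (factor_Aut N I).
Local Notation H3 := (factor_auts F Oinf).
Local Notation H4 := (sym_auts idW (iso_classes F Oinf)).

Lemma factor_fixN b : H3 b -> forall y, sg_set N y -> b y = y.
Proof.
move=> /factor_autsP[_ bN]; apply: Wfin_ind => [|o x ofin ox].
  by apply: (eq_subgroup (g := id)) => //; exact: aut_morph.
by apply: (bN o) => // oinf; exact: oinf.
Qed.

Lemma sym_fixN b : H4 b -> forall y, sg_set N y -> b y = y.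
Proof.
move=> /sym_autsP[t [t' [_ _ _ _ bN]]]; apply: Wfin_ind => [|o x ofin ox].
  by apply: (eq_subgroup (g := id)) => //; exact: aut_morph.
by apply: (bN o) => // oinf; exact: oinf.
Qed.

Lemma factor_I b x : H3 b -> sg_set I x -> sg_set I (b x).
Proof.
move=> bH; apply: (Winf_ind (A := [set x | sg_set I (b x)])) => [|o {}x oinf ox].
  by apply: preim_subgroup; [exact: aut_morph|exact: sg_closed].
by apply: (in_Winf oinf); apply: factor_auts_in bH oinf ox.
Qed.

Lemma sym_I b x : H4 b -> sg_set I x -> sg_set I (b x).
Proof.
move=> /sym_autsP[t [t' tb]]; apply: (Winf_ind (A := [set x | sg_set I (b x)])).
  by apply: preim_subgroup; [exact: aut_morph|exact: sg_closed].
move=> o {}x oinf ox; apply: (in_Winf (o := t o)); last exact: sym_spec_in tb ox.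
exact/(sym_spec_P o tb).
Qed.

(** Of the three parts of a, s and b fix [Wfin] pointwise, and c preserves the infinite coordinates,
    which are trivial on it. *)
Lemma aut_Wfin a x : sg_set N x -> sg_set N (a x).
Proof.
have [c [b [s [cP bP sP ->]]]] := dec a => Nx.
rewrite !autM (sym_fixN sP Nx) (factor_fixN bP Nx); apply/Wfin_coord => o oinf.
by rewrite cP //; move/Wfin_coord: Nx; exact.
Qed.

Lemma hom_factorP a : H1 a <-> central_auts a /\ forall y, sg_set N y -> a y = y.
Proof.
split=> [[f [Hf [f1 f1Z ff1]] af]|[ca aN]].
  split; first by move=> w; rewrite (flat_central Hf af); case: Hf.
  move=> y /grpP[y' <-]; rewrite af /flat.
  have := ff1 1 y'; rewrite gval1 mul1g (morph_mul1 (gmulfM (s := f1))) => ->.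
  by rewrite invg1 mulg1.
exists (fun w => (a w)^-1 * w); last by move=> w; rewrite /flat invgM invgK mulVKg.
have [fM fZ] := central_HomZ ca; split; first exact: central_HomZ.
have f1M : {morph (fun x : grp I => (a (gval x))^-1 * gval x) : x y / x * y}.
  by move=> x y; rewrite gvalM; exact: fM.
exists (mkmul f1M) => [x|x y]; first exact: fZ.
by rewrite fM (aN _ (gvalP y)) mulVg mulg1.
Qed.

Lemma factor_AutP a : H2 a <-> forall y, sg_set I y -> a y = y.
Proof.
split=> [[b [_ h]] y /grpP[y' <-] //|aI].
pose f (x : grp N) := mkg (aut_Wfin a (gvalP x)).
pose g (x : grp N) := mkg (aut_Wfin (aut_V a) (gvalP x)).
have fM : {morph f : x y / x * y}.
  by move=> x y; apply: gval_inj; rewrite gvalM !gval_mkg gvalM aut_morph.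
have fK : cancel f g by move=> x; apply: gval_inj; rewrite !gval_mkg [LHS]aut_funK.
have gK : cancel g f by move=> x; apply: gval_inj; rewrite !gval_mkg [LHS]aut_invK.
exists (MkAut fM fK gK); split=> [x|y]; first by [].
by apply: aI; exact: gvalP.
Qed.

Let H1s : subgroup_set H1.
Proof.
suff -> : H1 = @central_auts W `&` [set a | forall y, sg_set N y -> a y = y].
  apply: subgroup_setI; first exact: central_auts_subgroup.
  apply: subgroup_setP => [y _|a b aN bN y Ny|a aN y Ny] //=.
    by rewrite bN // aN.
  by apply: autV_fix; exact: aN.
by apply/seteqP; split=> a /hom_factorP.
Qed.

Let H2s : subgroup_set H2.
Proof.
suff -> : H2 = [set a : Aut W | forall y, sg_set I y -> a y = y].
  apply: subgroup_setP => [y _|a b aN bN y Ny|a aN y Ny] //=.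
    by rewrite bN // aN.
  by apply: autV_fix; exact: aN.
by apply/seteqP; split=> a /factor_AutP.
Qed.

Let H3s : subgroup_set H3. Proof. exact: factor_auts_subgroup. Qed.
Let H4s : subgroup_set H4. Proof. exact: sym_auts_subgroup iso_system_inf. Qed.

Let H1J a b : H1 a -> H1 (a ^ b).
Proof.
move=> /hom_factorP[ca aN]; apply/hom_factorP; split; first exact: central_autsJ.
by move=> y Ny; rewrite autJ aN ?autVK //; exact: aut_Wfin.
Qed.

Lemma fix_comm a b : H2 a -> (forall y, sg_set N y -> b y = y) ->
  (forall y, sg_set I y -> sg_set I (b y)) -> commute a b.
Proof.
move=> /factor_AutP aI bN bI; apply: aut_ext => x hx; rewrite !autM.
  by rewrite (bN x) // bN //; exact: aut_Wfin.
by rewrite (aI x) // aI //; exact: bI.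
Qed.

Let H23C a b : H2 a -> H3 b -> commute a b.
Proof.
by move=> h2 h3; apply: fix_comm => //; [exact: factor_fixN|move=> y; exact: factor_I].
Qed.

Let H24C a b : H2 a -> H4 b -> commute a b.
Proof. by move=> h2 h4; apply: fix_comm => //; [exact: sym_fixN|move=> y; exact: sym_I]. Qed.

Lemma fix_eq1 a : H2 a -> (forall y, sg_set N y -> a y = y) -> a = 1.
Proof. by move=> /factor_AutP aI aN; apply: aut_ext => x hx; [exact: aN|exact: aI]. Qed.

Let H23s : subgroup_set (setmul H2 H3).
Proof.
apply: setmul_subgroup; [exact: H2s|exact: H3s|] => a b h2 h3.
by rewrite conjgE (H23C h2 h3) mulKg.
Qed.

Let H123s : subgroup_set (setmul H1 (setmul H2 H3)).
Proof. by apply: setmul_subgroup => [||a b h1 _]; [exact: H1s|exact: H23s|exact: H1J]. Qed.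

Let H34J b s : H3 b -> H4 s -> H3 (b ^ s).
Proof. exact: (factor_auts_sym iso_system_inf). Qed.

Let H234J x s : setmul H2 H3 x -> H4 s -> setmul H2 H3 (x ^ s).
Proof.
move=> [a h2 [b h3 <-]] h4; rewrite conjMg; exists a => //; exists (b ^ s).
  exact: H34J.
by congr (_ * _); rewrite conjgE (H24C h2 h4) mulKg.
Qed.

(** On an infinite component c differs from the identity by central elements, whose coordinate there
    is 1; so c a b cannot move that component elsewhere. *)
Let H123_H4 x : setmul H1 (setmul H2 H3) x -> H4 x -> x = 1.
Proof.
move=> [c /hom_factorP[cc _] [_ [a h2 [b h3 <-]] <-]] x4.
apply: (sym_auts_eq1 (GF := GF) iso_system_inf x4) => o oinf.
have [w ow nw] := Wcomp_nontrivial o.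
have ob : sg_set (F o) (aut_inv b w) by move/factor_autsP: h3 => [/(_ o oinf w ow)[]].
exists (aut_inv b w) => //; rewrite !autM aut_invK.
have /factor_AutP -> : H2 a by []; last exact: in_Winf ow.
have h : coord o ((c w)^-1 * w) = 1.
  by apply: (inf_centerless oinf); [exact: coord_in|exact: (@center_coord_center _ _ _ GF)].
move=> cw; apply: nw; move: h; rewrite coordM coordV cw invg1 mul1g coord_id //.
Qed.

(** Restriction to [Wfin] shows a = 1. Then x = b preserves each infinite component and changes its
    elements by central ones, which are trivial there. *)
Let H1_H23 x : H1 x -> setmul H2 H3 x -> x = 1.
Proof.
move=> /hom_factorP[cx xN] [a h2 [b h3 ex]].
have a1 : a = 1.
  apply: fix_eq1 => // y Ny; have := xN y Ny.
  by rewrite -ex autM (factor_fixN h3).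
have bx : b = x by rewrite -ex a1 mul1g.
apply: aut_ext => [y|]; first exact: xN.
apply: Winf_ind => [|o y oinf oy]; first exact: (eq_subgroup (g := id) (aut_morph x)).
have oxy : sg_set (F o) (x y) by rewrite -bx; exact: factor_auts_in h3 oinf oy.
apply/esym/(@mulgI _ (x y)^-1); rewrite mulVg.
apply: (inf_centerless oinf) => //; apply: sgM => //; exact: sgV.
Qed.

(** The part c preserves the infinite coordinates but may act on [Wfin] and alter elements of [Winf]
    by factors from it. Here h takes out the action on [Wfin], and the remainder k lies in H1. *)
Let H1234 a : exists h1 h2 h3 h4 : Aut W,
  [/\ H1 h1, H2 h2, H3 h3, H4 h4 & a = h1 * (h2 * h3) * h4].
Proof.
have [c [b [s [cP bP sP ->]]]] := dec a.
pose f (d : W -> W) x := d (restr GF Ofin x) * restr GF Oinf x.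
have rN x : sg_set N (restr GF Ofin x) := restr_in GF x.
have rI x : sg_set I (restr GF Oinf x) := restr_in GF x.
have fM (d : Aut W) : {morph f d : x y / x * y}.
  move=> x y; rewrite /f !restrM aut_morph !mulgA; congr (_ * _).
  rewrite -!mulgA; congr (_ * _).
  by apply: Wfin_Winf_comm => //; exact: aut_Wfin.
have fN (d : Aut W) x : restr GF Ofin (f d x) = d (restr GF Ofin x).
  rewrite /f restrM (restr_subprod GF (aut_Wfin d (rN x))).
  by rewrite (restr_subprod1 GF (setICl Ofin) (rI x)) mulg1.
have fI (d : Aut W) x : restr GF Oinf (f d x) = restr GF Oinf x.
  rewrite /f restrM (restr_subprod1 GF (setICr Ofin) (aut_Wfin d (rN x))) mul1g.
  exact: (restr_subprod GF (rI x)).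
have fK (d d' : Aut W) : cancel d d' -> cancel (f d) (f d').
  move=> dK x; rewrite {1}/f fN fI dK; apply/esym; exact: (restr_split GF Ofin).
pose h := MkAut (fM c) (fK c (aut_V c) (aut_funK c)) (fK (aut_V c) c (aut_invK c)).
have hI : H2 h.
  apply/factor_AutP => y Iy; rewrite /= /f (restr_subprod GF Iy).
  by rewrite (restr_subprod1 GF (setICl Ofin) Iy) (morph_mul1 (@aut_morph _ c)) mul1g.
have hN y : sg_set N y -> h y = c y.
  move=> Ny; rewrite /= /f (restr_subprod GF Ny).
  by rewrite (restr_subprod1 GF (setICr Ofin) Ny) mulg1.
pose k := c * h^-1.
have kN y : sg_set N y -> k y = y.
  move=> Ny; rewrite autM -hN ?aut_invK //.
  exact: (aut_Wfin h^-1).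
have kI y : sg_set I y -> k y = c y.
  move=> Iy; rewrite autM; congr (c _); apply: autV_fix.
  by have /factor_AutP := hI; apply.
exists k, h, b, s; split=> //; last by rewrite mulgA mulgVK.
apply/hom_factorP; split=> // w.
apply: (dprod_ind GF (A := [set w | center ((k w)^-1 * w)])) => [|o {}w ow].
  exact: central_on_subgroup.
have [ofin|oinf] := pselect (Ofin o).
  have -> : [set w | center ((k w)^-1 * w)] w = center ((k w)^-1 * w) by [].
  by rewrite kN ?mulVg; [exact: center1|exact: in_Wfin ow].
have Iw : sg_set I w := in_Winf oinf ow.
(* This defect lies in [Wfin], so it commutes with [Winf]. It commutes with [Wfin] because w does
   and k fixes that group pointwise. *)
have Nk : sg_set N ((k w)^-1 * w).
  apply/Wfin_coord => o' o'inf; rewrite kI // coordM coordV cP // mulVg //.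
move=> x; apply: (dprod_ind GF (A := [set x | commute ((k w)^-1 * w) x])).
  apply: subgroup_setP => [|y z|y]; [exact: commute1|exact: commuteM|exact: commuteV].
move=> o' {}x o'x /=; have [o'fin|o'inf] := pselect (Ofin o').
  have Nx := in_Wfin o'fin o'x.
  apply/commute_sym/commuteM; last exact: Wfin_Winf_comm.
  apply: commuteV; have := congr1 k (Wfin_Winf_comm Nx Iw).
  by rewrite !(@aut_morph _ k) (kN x Nx).
exact: Wfin_Winf_comm Nk (in_Winf o'inf o'x).
Qed.

Theorem aut_coxeter :
  let H23 := setmul H2 H3 in
  [/\ HomZ_factor I N `<=` @HomZ_units W,
      is_direct H23 H2 H3,
      (is_semidirect (setmul H1 H23) H1 H23 /\
       is_semidirect [set: Aut W] (setmul H1 H23) H4) /\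
      (is_semidirect (setmul H23 H4) H23 H4 /\
       is_semidirect [set: Aut W] H1 (setmul H23 H4)),
      is_direct (setmul H2 H4) H2 H4 &
      is_semidirect (setmul H3 H4) H3 H4].
Proof.
move=> H23; have [s1 s2 s3 s4] := And4 H1s H2s H3s H4s.
have s123 := H123s; have s23 : subgroup_set H23 := H23s.
have sT : subgroup_set [set: Aut W] by [].
have s234 : subgroup_set (setmul H23 H4) by apply: setmul_subgroup => //; exact: H234J.
have e1 x : H23 x -> H4 x -> x = 1.
  by move=> h; apply: H123_H4; apply: setmul_r.
have norm x y : setmul H1 H23 x -> setmul H1 H23 (x ^ y).
  have [h1 [h2 [h3 [h4 [p1 p2 p3 p4 ->]]]]] := H1234 y => hx.
  have h123 : setmul H1 H23 (h1 * (h2 * h3)).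
    by exists h1 => //; exists (h2 * h3) => //; exists h2 => //; exists h3.
  have [u hu [v hv uv]] : setmul H1 H23 (x ^ (h1 * (h2 * h3))).
    by apply: subgM => //; [exact: subgV|exact: subgM].
  rewrite conjgM -uv conjMg.
  by exists (u ^ h4); [exact: H1J|exists (v ^ h4) => //; exact: H234J].
split.
(* The values of f are central, hence in [Wfin], where f vanishes. *)
- move=> f Hf; have [fZ [f1 f1Z ff1]] := Hf; apply: HomZ_units_sq1 => // x.
  have /center_Wfin /grpP[y <-] : center (f x) by case: fZ.
  by have := ff1 1 y; rewrite gval1 mul1g (morph_mul1 (gmulfM (s := f1))).
- by apply: direct_setmul => // x h2 /factor_fixN; exact: fix_eq1.
- split; split.
  + by apply: semidirect_setmul => // a b /H1J.
  + split=> //; first by split=> // n a hn _; exact: norm.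
      by apply: setI1P => // x; exact: H123_H4.
    apply/seteqP; split=> // a _.
    have [h1 [h2 [h3 [h4 [p1 p2 p3 p4 ->]]]]] := H1234 a.
    exists (h1 * (h2 * h3)); last by exists h4.
    by exists h1 => //; exists (h2 * h3) => //; exists h2 => //; exists h3.
  + by apply: semidirect_setmul => //; exact: H234J.
  + split=> //; first by split=> // n a /H1J.
      apply: setI1P => // x x1 [y y23 [z z4 ex]].
      have z1 : z = 1.
        apply: H123_H4 => //; rewrite -(mulKg y z) ex.
        apply: subgM => //; last exact: setmul_l.
        by apply: subgV => //; exact: setmul_r.
      by apply: H1_H23 => //; rewrite -ex z1 mulg1.
    apply/seteqP; split=> // a _.
    have [h1 [h2 [h3 [h4 [p1 p2 p3 p4 ->]]]]] := H1234 a.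
    exists h1 => //; exists (h2 * h3 * h4); last by rewrite mulgA.
    by exists (h2 * h3); [exists h2 => //; exists h3|exists h4].
- by apply: direct_setmul => // x h2 /sym_fixN; exact: fix_eq1.
- apply: semidirect_setmul => // x x3; apply: e1; exact: setmul_r.
Qed.


(** * The index of H in Aut(W) *)

Local Notation FA := (factor_auts F [set: Omega m]).
Local Notation SA := (sym_auts idW (iso_classes F [set: Omega m])).
Local Notation H := (setmul FA SA).

Lemma factor_sym_subgroup : subgroup_set H.
Proof.
apply: setmul_subgroup => [||a b]; [exact: factor_auts_subgroup| |].
  exact: sym_auts_subgroup idWP.
exact: (factor_auts_sym idWP).
Qed.

Lemma finite_index_reps (X : set (Aut W)) : finite_set X ->
  (forall a, exists x h : Aut W, [/\ X x, H h & a = x * h]) -> finite_index H.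
Proof.
move=> finX hX; apply: sub_finite_set (finite_image (fun x => setmul [set x] H) finX).
move=> _ [a _ <-]; have [x [h [Xx Hh ->]]] := hX a; exists x => //.
have Hs := factor_sym_subgroup.
apply/seteqP; split=> _ [_ -> [k Hk <-]].
  exists (x * h) => //; exists (h^-1 * k); first by apply: subgM => //; exact: subgV.
  by rewrite -mulgA mulVKg.
by exists x => //; exists (h * k); [exact: subgM|rewrite mulgA].
Qed.

(** Here every component is centerless, finite ones included, so c preserves all coordinates and is
    the identity; H is all of Aut(W). *)
Lemma center1_finite_index : @center W = [set 1] -> finite_index H.
Proof.
move=> Z1; apply: (finite_index_reps (finite_set1 1)) => a.
have cl o : [set: Omega m] o -> centerless o.
  by move=> _ z _ cz; have : center z by []; rewrite Z1.
have [c [b [s [cP bP sP ->]]]] :=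
  coxeter_aut_decomposition cl (fun _ _ _ _ _ => Logic.I) idWP a.
exists 1, (b * s); split=> //; first by exists b => //; exists s.
suff -> : c = 1 by rewrite !mul1g.
by apply: autP => x; apply: (coord_ext (GF := GF)) => o; rewrite cP.
Qed.

Lemma factor_inf_all b : H3 b -> FA b.
Proof.
move=> /factor_autsP[bP bN]; apply/factor_autsP; split=> [o _ x ox|o []//].
have [/bP/(_ x ox) //|no] := pselect (Oinf o).
have bx : b x = x by exact: bN ox.
by split; [rewrite bx|rewrite [aut_inv _ _](autV_fix bx)].
Qed.

Lemma sym_inf_all b : H4 b -> SA b.
Proof.
move=> /sym_autsP[t [t' [tK tP tN bP bN]]]; apply/sym_autsP; exists t, t'.
have tP' o : isog (grp (F o)) (grp (F (t o))).
  have [/tP[] //|no] := pselect (Oinf o); rewrite tN //; exact: isog_refl.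
split=> // [o []//|o x _ ox|o x []//].
have [oinf|no] := pselect (Oinf o); first exact: bP.
have [x' <-] := grpP ox; rewrite (bN o) //; last exact: gvalP.
rewrite tN // transportE.
have [|_ /(_ o) h _ _] := idWP
  (X := [set o' | [set: Omega m] o' /\ isog (grp (F o)) (grp (F o'))]).
  by exists o.
by rewrite h //; split=> //; exact: isog_refl.
Qed.

Local Notation oddc := (components (odd_edge m)).
Local Notation odd_rel := (clos_refl_sym_trans S (odd_edge m)).

Lemma odd_rel_cox s t : odd_rel s t -> clos_refl_sym_trans S (cox_edge m) s t.
Proof.
elim=> {s t} [s t st|s|s t _|s t r _ h1 _ h2].
- apply: rst_step; move: st; rewrite /odd_edge /cox_edge.
  by case: (m s t) => // k /andP[].
- exact: rst_refl.
- exact: rst_sym.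
- exact: rst_trans h1 h2.
Qed.

Lemma oddc_eq C s : oddc C -> C s -> C = [set t | odd_rel s t].
Proof.
move=> [r _ <-] /= rs; apply/seteqP; split=> t /= h.
  by apply: (rst_trans _ _ _ r) => //; exact: rst_sym.
exact: (rst_trans _ _ _ s).
Qed.

Lemma oddc_nonempty C : oddc C -> exists s, C s.
Proof. by move=> [s _ <-]; exists s; exact: rst_refl. Qed.

Lemma finite_omega : finite_set oddc -> finite_set [set: Omega m].
Proof.
move=> finC; have rex o : exists s, val o s by have [s ->] := omegaP o; exists s; exact: rst_refl.
have [r rP] := choice rex.
apply: (finite_inj (f := fun o => [set t | odd_rel (r o) t])) finC _ _.
  by move=> o _; exists (r o).
move=> o o' _ _ h; have : [set t | odd_rel (r o') t] (r o') by exact: rst_refl.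
rewrite -h => /odd_rel_cox oo'; have [s os] := omegaP o.
apply: omega_eq (rP o'); rewrite os; apply: (rst_trans _ _ _ (r o)) => //.
by have := rP o; rewrite os.
Qed.

Lemma finite_Wfin : finite_set [set: Omega m] -> finite_set (sg_set N).
Proof.
move=> finO; have finfin : finite_set Ofin by exact: sub_finite_set finO.
pose E := \bigcup_(o in Ofin) sg_set (F o).
have finE : finite_set E by apply: bigcup_finite.
apply: (finite_det (r := fun x o => coord o x)) finfin finE _ _ => [x o _ ofin|x y Nx Ny h].
  by exists o => //; exact: coord_in.
apply: (coord_ext (GF := GF)) => o; have [/h //|oinf] := pselect (Ofin o).
by move/Wfin_coord: Nx => ->; [move/Wfin_coord: Ny => ->|].
Qed.

(** The central elements f(e s) and f(e t) have square 1, while an odd power of their product is 1;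
    so the product is 1. *)
Lemma odd_hom (f : W -> W) s t : HomZ f -> odd_rel s t -> f (e s) = f (e t).
Proof.
move=> [fM fZ]; have f1 := morph_mul1 fM.
elim=> {s t} [s t|//|s t _ -> //|s t r _ -> _ -> //].
rewrite /odd_edge; case mk: (m s t) => [k|] // /andP[_ ko].
have sq r : f (e r) * f (e r) = 1 by rewrite -fM (cox_sq WS) f1.
have xy2 : (f (e s) * f (e t)) ^+ 2 = 1.
  by rewrite expg2 -mulgA (mulgA (f (e t))) (fZ (e t) (f (e s))) -mulgA sq mulg1 sq.
have fX n : f ((e s * e t) ^+ n) = (f (e s) * f (e t)) ^+ n.
  by elim: n => [|n IH]; [exact: f1|rewrite !expgS !fM IH].
have := fX k; rewrite (cox_rel WS mk) f1 -[k]odd_double_half ko -mul2n.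
rewrite expgnDr expgnA xy2 expg1n mulg1 expg1 => /esym/mulg1_eq <-.
by apply/esym/mulg1_eq; exact: sq.
Qed.

(** H3 and H4 lie in H, so finiteness of H1 and H2 suffices. An element of H1 is determined by one
    value per odd component, taken in the center and so in the finite group [Wfin]. *)
Lemma odd_finite_index : finite_set oddc -> finite_index H.
Proof.
move=> finC; have finO := finite_omega finC; have finN := finite_Wfin finO.
have fin1 : finite_set H1.
  pose r a C := if pselect (exists s, C s) is left h then
    (a (e (projT1 (cid h))))^-1 * e (projT1 (cid h)) else 1.
  apply: (finite_det (r := r)) finC finN _ _ =>
    [a C /hom_factorP[ca _] _|a b /hom_factorP[ca _] /hom_factorP[cb _] h].
    by rewrite /r; case: pselect => h; [apply: center_Wfin; exact: ca|exact: sg1].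
  apply: autP => w; apply: (cox_gen WS (A := [set w | a w = b w])) => [|s].
    by apply: eq_subgroup; exact: aut_morph.
  pose C := [set t | odd_rel s t]; have oC : oddc C by exists s.
  have := h C oC; rewrite /r; case: pselect => [h'|[]]; last by exists s; exact: rst_refl.
  case: (cid h') => t /= st; rewrite -(odd_hom (central_HomZ ca) st).
  by rewrite -(odd_hom (central_HomZ cb) st) => /mulIg /invg_inj.
have fin2 : finite_set H2.
  apply: (finite_det (r := fun (a : Aut W) x => a x) finN finN) =>
    [a x _|a b /factor_AutP aI /factor_AutP bI h].
    exact: aut_Wfin.
  by apply: aut_ext => // x Ix; rewrite aI ?bI.
have fin12 : finite_set [set p.1 * p.2 | p in H1 `*` H2].
  by apply: finite_image; exact: finite_setX.
apply: finite_index_reps fin12 _ => a.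
have [h1 [h2 [h3 [h4 [p1 p2 p3 p4 ->]]]]] := H1234 a.
exists (h1 * h2), (h3 * h4); split; first by exists (h1, h2).
  by exists h3; [exact: factor_inf_all|exists h4; [exact: sym_inf_all|]].
by rewrite !mulgA.
Qed.

(** The map f sends generators in C to z and the others to 1, which respects the relations since C
    is an odd component. It kills z, a product of generators outside C, so f kills its values and
    [flat f] is an automorphism. *)
Lemma transvection o z (C : set S) : sg_set (F o) z -> center z -> oddc C ->
  (forall s, C s -> ~ val o s) ->
  exists a : Aut W, forall s, a (e s) = e s * (if pselect (C s) then z else 1) /\ a z = z.
Proof.
move=> oz cz oC Co.
have zz : z * z = 1 by apply: (center_Wcomp_sq WS oz) => s _; exact: cz.
pose y s := if pselect (C s) then z else 1.
have yZ s : center (y s) by rewrite /y; case: pselect => ? //=; exact: center1.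
have yy s : y s * y s = 1 by rewrite /y; case: pselect => ? /=; rewrite ?mulg1.
(* A generator s acts on the set W by multiplication with the central element [y s]; the
   homomorphism is then w |-> act w 1. *)
have [|act [actE actM' act1']] := @cox_action S m W e WS W (fun s w => y s * w).
  move=> s t k mk x.
  have -> : iter k ((fun w => y s * w) \o (fun w => y t * w)) x = (y s * y t) ^+ k * x.
    elim: k {mk} => [|k IH]; first by rewrite mul1g.
    by rewrite iterS IH /= expgS !mulgA.
  suff -> : (y s * y t) ^+ k = 1 by rewrite mul1g.
  have sq : (y s * y t) ^+ 2 = 1.
    by rewrite expg2 -mulgA (mulgA (y t)) (yZ t (y s)) -mulgA yy mulg1 yy.
  rewrite -[k]odd_double_half -mul2n expgnDr expgnA sq expg1n mulg1.
  case ko: (odd k); rewrite ?expg0 //= expg1.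
  suff -> : y s = y t by exact: yy.
  have st : odd_rel s t.
    have [->|nst] := pselect (s = t); first exact: rst_refl.
    apply: rst_step; rewrite /odd_edge mk ko andbT.
    have := cox_mP (proj1 WS) nst mk; case: (k) ko => [|[|[|n]]] //.
  have Cst : C s <-> C t.
    split=> h; first by rewrite (oddc_eq oC h).
    by rewrite (oddc_eq oC h); exact: rst_sym.
  by rewrite /y; case: pselect => u; case: pselect => v //=; [case: v|case: u]; apply/Cst.
pose f w := act w 1.
have actE' w x : act w x = f w * x.
  have [u <-] := prods_onto WS w; elim: u x => [|s u IH] x.
    by rewrite /f /= !act1' mul1g.
  by rewrite /f /= !actM' /= !actE IH -!mulgA; congr (_ * _); rewrite IH mulg1.
have fM : {morph f : v w / v * w} by move=> v w; rewrite /f actM' /= actE'.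
have fe s : f (e s) = y s by rewrite /f actE mulg1.
have fZ w : center (f w).
  apply: (cox_gen WS (A := [set w | center (f w)])) => [|s]; last by rewrite /= fe.
  by apply: preim_subgroup => //; exact: center_subgroup.
have fz : f z = 1.
  apply: (Wcomp_ind (A := [set w | f w = 1])) oz => [|s os].
    by apply: (eq_subgroup (g := fun=> 1)) => // v w; rewrite mulg1.
  by rewrite /= fe /y; case: pselect => [u|//]; case: (Co s u os).
have ff w : f (f w) = 1.
  apply: (cox_gen WS (A := [set w | f (f w) = 1])) => [|s].
    apply: (eq_subgroup (f := f \o f) (g := fun=> 1)) => v w' /=; rewrite ?fM ?mulg1 //.
  rewrite /= fe /y; case: pselect => ? /=; [exact: fz|exact: morph_mul1].
have [a af] := flat_unit_aut (HomZ_units_sq1 (conj fM fZ) ff).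
exists a => s; rewrite !af /flat fz invg1 mulg1; split=> //; congr (_ * _).
by apply: mulg1_eq; rewrite fe yy.
Qed.

Lemma factor_sym_image h o : H h -> exists o', forall x, sg_set (F o) x -> sg_set (F o') (h x).
Proof.
move=> [b bP [s /sym_autsP[t [t' ts]] <-]]; exists (t o) => x ox; rewrite autM.
apply: (factor_auts_in bP) => //; exact: sym_spec_in ts ox.
Qed.

(* The transvections of two odd components outside o differ by an automorphism
   mapping some generator s to s z, which lies in no irreducible component; so they
   represent different cosets of H. *)
Lemma finite_index_odd : finite_index H -> @center W <> [set 1] -> finite_set oddc.
Proof.
move=> finH nZ.
have [z cz nz] : exists2 z, @center W z & z <> 1.
  apply: contrapT => h; apply: nZ; apply/seteqP; split=> [z cz|_ ->].
    by apply: contrapT => n; apply: h; exists z.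
  exact: center1.
have [o nzo] : exists o, coord o z <> 1.
  apply: contrapT => h; apply: nz; apply: (coord_ext1 (GF := GF)) => o.
  by apply: contrapT => n; apply: h; exists o.
pose z0 := coord o z; have oz0 : sg_set (F o) z0 by exact: coord_in.
have cz0 : center z0 by exact: (@center_coord_center _ _ _ GF).
(* A component with nontrivial center has finite rank, so only finitely many odd components meet it;
   those avoiding it remain to be counted. *)
have [_ fino] := center_Wcomp_finite WS oz0 (fun s _ => cz0 (e s)) nzo.
pose Cin := [set C | oddc C /\ exists2 s, C s & val o s].
pose Cout := [set C | oddc C /\ forall s, C s -> ~ val o s].
have finin : finite_set Cin.
  apply: sub_finite_set (finite_image (fun s => [set t | odd_rel s t]) fino).
  by move=> C [oC [s Cs os]]; exists s => //; rewrite (oddc_eq oC Cs).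
suff finout : finite_set Cout.
  have : finite_set (Cin `|` Cout) by rewrite finite_setU.
  apply: sub_finite_set => C oC; have [h|h] := pselect (exists2 s, C s & val o s).
    by left.
  by right; split=> // s Cs os; apply: h; exists s.
have Aex C : exists a : Aut W, Cout C ->
    forall s, a (e s) = e s * (if pselect (C s) then z0 else 1) /\ a z0 = z0.
  have [[oC Co]|n] := pselect (Cout C); last by exists 1.
  by have [a aP] := transvection oz0 cz0 oC Co; exists a.
have [A AP] := choice Aex; have Hs := factor_sym_subgroup.
apply: (finite_inj (f := fun C => setmul [set A C] H)) finH _ _ => [C _|C C' hC hC' eCC'].
  by exists (A C).
apply: contrapT => nCC'.
have [h Hh Ah] : exists2 h, H h & A C' = A C * h.
  have : setmul [set A C'] H (A C').
    by exists (A C') => //; exists 1; [exact: subg1|exact: mulg1].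
  by rewrite -eCC' => -[_ -> [h Hh <-]]; exists h.
have [[oC _] [oC' Co']] := (hC, hC').
have [s C's] := oddc_nonempty oC'.
have nCs : ~ C s by move=> Cs; apply: nCC'; rewrite (oddc_eq oC Cs) (oddc_eq oC' C's).
have hs : h (e s) = e s * z0.
  apply: (@aut_inj _ (A C)); rewrite -autM -Ah aut_morph.
  have [-> _] := AP C' hC' s; have [-> ->] := AP C hC s.
  by case: pselect => // ?; case: pselect => // ?; rewrite mulg1.
have [k ks] := omega_ex m s.
have nko : k <> o by move=> eko; apply: (Co' s C's); rewrite -eko.
have ke : sg_set (F k) (e s) by exact: Wcomp_gen.
(* h maps the component of s into a single component, but e(s) z0 has nontrivial coordinates at both
   k and o. *)
have [k' hk'] := factor_sym_image k Hh; have := hk' _ ke; rewrite hs => k'x.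
have k'k : k' = k.
  apply: contrapT => n; apply: (gen_neq1 WS (s := s)).
  have := coord_ne GF n k'x; rewrite coordM coord_id //.
  by rewrite (coord_ne GF _ oz0) ?mulg1 //; exact/nesym.
rewrite k'k in k'x; apply: nzo.
have := coord_ne GF nko k'x; rewrite coordM (coord_ne GF nko ke) mul1g coord_id //.
Qed.

Theorem finite_index_coxeter :
  [/\ subgroup_set H,
      finite_index H <-> (@center W = [set 1] \/ finite_set oddc) &
      finite_set [set: S] -> finite_index H].
Proof.
split; first exact: factor_sym_subgroup.
  split=> [finH|[/center1_finite_index //|/odd_finite_index //]].
  have [Z1|nZ] := pselect (@center W = [set 1]); [by left|right].
  exact: finite_index_odd.
by move=> finS; apply: odd_finite_index; exact: finite_image.
Qed.

End CoxeterAut.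

Theorem theorem3p10
  (Lam : Type) (G : groupType) (F : Lam -> subgroup G)
  (GF : is_dprod F) (Fnt : forall l, sg_set (F l) <> [set 1])
  (GC1 : cond_C1 (fun l => grp (F l) : groupType))
  (GC2 : cond_C2 (fun l => grp (F l) : groupType))
  (idG : forall m l, grp (F l) -> grp (F m))
  (idGP : iso_system (LamNZ F) idG)
  (S : Type) (m : S -> S -> option nat) (W : groupType) (e : S -> W)
  (WS : coxeter_system m e)
  (idW : forall o' o : Omega m, grp (Wcomp e o) -> grp (Wcomp e o'))
  (idWP : iso_system [set: Omega m] idW) :
  (* (i) *)
  (let H1 := flat_set (@HomZ_units G) in
   let H2 := factor_auts F (LamNZ F) in
   let H3 := sym_auts idG (iso_classes F (LamNZ F)) in
   let H4 := flat_set (HomZo F) in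
   [/\ is_semidirect [set: Aut G] (setmul H1 H2) H3,
       normal_in H1 [set: Aut G],
       normal_in H2 (setmul H2 H3),
       HomZo F `<=` @HomZ_units G &
       H1 `&` H2 = H4])
  /\
  (* (ii) *)
  (let H1 := flat_set (HomZ_factor (Winf m e) (Wfin m e)) in
   let H2 := factor_Aut (Wfin m e) (Winf m e) in
   let H3 := factor_auts (Wcomp e) (Om_inf m e) in
   let H4 := sym_auts idW (Ups_inf m e) in
   let H23 := setmul H2 H3 in
   [/\ HomZ_factor (Winf m e) (Wfin m e) `<=` @HomZ_units W,
       is_direct H23 H2 H3,
       (is_semidirect (setmul H1 H23) H1 H23 /\
        is_semidirect [set: Aut W] (setmul H1 H23) H4) /\
       (is_semidirect (setmul H23 H4) H23 H4 /\
        is_semidirect [set: Aut W] H1 (setmul H23 H4)),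
       is_direct (setmul H2 H4) H2 H4 &
       is_semidirect (setmul H3 H4) H3 H4])
  /\
  (* (iii) *)
  (let H := setmul (factor_auts (Wcomp e) [set: Omega m])
                   (sym_auts idW (Ups m e)) in
   [/\ subgroup_set H,
       finite_index H <->
         (@center W = [set 1] \/ finite_set (components (odd_edge m))) &
       finite_set [set: S] -> finite_index H]).
Proof.
split; first by move=> /=; rewrite flat_units; exact: aut_dprod.
split; last exact: finite_index_coxeter.
by rewrite Ups_infE; exact: aut_coxeter.
Qed.
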